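(* Let $n\in\mathbb{Z}_{+}$, let $F(x,y_0,y_1,\ldots,y_n)$ be a holomorphic function in a polydisc $\Delta=\{|x|<\rho,\ |y_j|<\varepsilon_j,\ j=0,\dots,n\}\subset\mathbb{C}^{n+2}$, let $\delta=x\frac{d}{dx}$, and consider the ordinary differential equation $$F(x,y,\delta y,\ldots,\delta^n y)=0.$$ Let $\eta\in\mathbb{R}\setminus\{0\}$ and let $$\varphi=\sum_{k=0}^{\infty}\alpha_k(x^{\mathrm{i}\eta})\,x^k$$ be an exotic formal series (so the $\alpha_k(t)$ are meromorphic at $t=0$ and converge in a common punctured disc $\mathcal{D}=\{0<|t|<\varepsilon\}$) which is a formal solution of this equation, that is, $F(x,\Phi)=0$ with $\Phi:=(\varphi,\delta\varphi,\dots,\delta^n\varphi)$. Suppose that $\frac{\partial F}{\partial y_n}(x,\Phi)\not\equiv 0$. Suppose furthermore that there is an integer $N\geqslant 0$, the same for all $i$, such that each exotic formal series $\frac{\partial F}{\partial y_i}(x,\Phi)$ has the form $$\frac{\partial F}{\partial y_i}(x,\Phi)=B_i(x^{\mathrm{i}\eta})\,x^N+D_i(x^{\mathrm{i}\eta})\,x^{N+1}+\ldots,\qquad i=0,1,\ldots,n$$ (i.e. it contains no terms with powers of $x$ lower than $x^N$), where $B_n\not\equiv 0$ and $$\mathrm{ord}_0\,B_i\geqslant \mathrm{ord}_0\,B_n,\qquad i=0,1,\dots,n.$$ Then there exist a branch of $\log x$ on $\mathbb{C}\setminus\mathbb{R}_+$ (defining $x^{\mathrm{i}\eta}=e^{\mathrm{i}\eta\log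 x}$) and an open sector $S\subset\mathbb{C}\setminus\mathbb{R}_+$ with vertex at the origin and of sufficiently small radius such that $x^{\mathrm{i}\eta}\in\mathcal{D}$ for all $x\in S$ and the series $\sum_{k=0}^{\infty}\alpha_k(x^{\mathrm{i}\eta})\,x^k$ converges uniformly in $S$.
   Context: Here $\mathrm{i}=\sqrt{-1}$ and $\mathbb{R}_+=[0,+\infty)$. Exotic formal series. Fix $\eta\in\mathbb{R}\setminus\{0\}$. An exotic formal series is a formal expression $\sum_{k=0}^{\infty}\alpha_k(x^{\mathrm{i}\eta})x^k$ in which $$\alpha_k(t)=t^{-r_k}\sum_{\ell=0}^{\infty}\alpha_{k\ell}\,t^{\ell},\qquad r_k\in\mathbb{Z},\ \alpha_{k\ell}\in\mathbb{C},$$ and, for some $\varepsilon>0$ independent of $k$, every power series $t^{r_k}\alpha_k(t)$ converges in $\{|t|<\varepsilon\}$. Thus all $\alpha_k$ are holomorphic in the common punctured disc $\mathcal{D}=\{0<|t|<\varepsilon\}$ and meromorphic at $0$. Formally, such a series is treated as the formal power series $\sum_k\alpha_k(t)x^k$ in $x$, with $t=x^{\mathrm{i}\eta}$ treated as independent of $x$; it is zero iff all its coefficients $\alpha_k(t)$ are identically zero, and $\not\equiv 0$ otherwise. Sums and products are those of formal power series in $x$. Derivation. The operator $\delta=x\frac{d}{dx}$ acts on exotic formal series termwise by $$\delta\bigl(\alpha(x^{\mathrm{i}\eta})x^k\bigr)=\beta(x^{\mathrm{i}\eta})x^k,\qquad \beta(t)=k\,\alpha(t)+\mathrm{i}\,\eta\,t\,\frac{d\alpha}{dt}(t).$$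 Substitution. Let $\Phi_0(t)=\bigl(\alpha_0(t),(\mathrm{i}\eta\,t\tfrac{d}{dt})\alpha_0(t),\dots,(\mathrm{i}\eta\,t\tfrac{d}{dt})^n\alpha_0(t)\bigr)$ be the vector of $x^0$-coefficients of $\Phi=(\varphi,\delta\varphi,\dots,\delta^n\varphi)$. It is assumed that the substitution of $\Phi$ into $F$ makes sense, i.e. $(0,\Phi_0(t))\in\Delta$ for $t\in\mathcal{D}$ (after decreasing $\varepsilon$ if necessary). For $G=F$ or $G=\partial F/\partial y_i$, the exotic formal series $G(x,\Phi)$ is obtained by Taylor expanding $G$ at the point $(0,\Phi_0(t))$, substituting $\Phi-\Phi_0(t)$ (which has no $x^0$-term) for the increments of $(y_0,\dots,y_n)$, and collecting powers of $x$; its coefficients are meromorphic functions of $t$ at $0$. Order. For a function $B(t)$ meromorphic at $t=0$, $\mathrm{ord}_0 B\in\mathbb{Z}\cup\{+\infty\}$ is the exponent of the lowest nonzero term of its Laurent expansion at $0$, with $\mathrm{ord}_0\,0=+\infty$. An open sector with vertex at the origin and radius $R>0$ is a nonempty set $\{x:\ 0<|x|<R,\ \theta_1<\arg x<\theta_2\}$. *)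

(* Defs.v *)
From HB Require Import structures.
From mathcomp Require Import all_boot all_order all_algebra.
From mathcomp Require Import complex.
From mathcomp Require Import all_classical all_reals all_analysis.
Set Implicit Arguments.
Unset Strict Implicit.
Unset Printing Implicit Defensive.
Import Order.TTheory GRing.Theory Num.Theory.
Import numFieldNormedType.Exports.
Local Open Scope classical_set_scope.
Local Open Scope complex_scope.
Local Open Scope ring_scope.

(* The complex numbers R[i], packed as a numClosedFieldType: MathComp-Analysis
   attaches the topology of the norm to abstract number fields only, not to the
   concrete type R[i]. *)
Definition Cplx (R : realType) : numClosedFieldType := R[i].

Definition cplx_of_real (R : realType) (r : R) : Cplx R := r%:C.

Section ExpLog.
Variable R : realType.
Local Notation C := (Cplx R).

Definition cexp (z : C) : C :=
  expR (complex.Re z) * cos (complex.Im z)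
    +i* (expR (complex.Re z) * sin (complex.Im z)).

Definition nneg_reals : set C :=
  [set cplx_of_real r | r in [set r : R | 0 <= r]].

Definition log_branch (A : set C) (L : C -> C) : Prop :=
  {within A, continuous L} /\ forall x, A x -> cexp (L x) = x.

(* x^(i eta), for the branch L of the logarithm. *)
Definition ipow (L : C -> C) (eta : R) (x : C) : C :=
  cexp ('i * cplx_of_real eta * L x).

Definition sector (theta1 theta2 rad : R) : set C :=
  [set x | exists r theta : R, [/\ 0 < r < rad, theta1 < theta < theta2
     & x = cplx_of_real r * cexp ('i * cplx_of_real theta)]].

End ExpLog.

(* From here on C is an arbitrary numClosedFieldType, to be instantiated with
   Cplx R; radii and eta are then reals embedded in C. *)
Section Germs.
Variable C : numClosedFieldType.
Implicit Types (eps t : C) (B : C -> C).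

Definition punctured_disc eps : set C := [set t | 0 < `|t| < eps].

Definition laurent_order B (m : int) : Prop :=
  exists b : nat -> C, b 0%N != 0 /\
    \forall t \near 0^',
      series (fun l : nat => b l * t ^ (m + l%:Z)) @ \oo --> B t.

(* Only meaningful for B meromorphic at 0 (junk value 0 otherwise). *)
Definition order_at0 B : \bar int :=
  if `[< \forall t \near 0^', B t = 0 >] then +oo%E
  else (xget 0 [set m | laurent_order B m])%:E.

End Germs.

Section Taylor.
Variables (C : numClosedFieldType) (m : nat).
Implicit Types (G : 'rV[C]_m -> C) (z : 'rV[C]_m) (p : 'I_m -> nat).

Definition partial (j : 'I_m) G : 'rV[C]_m -> C :=
  fun z => 'D_(delta_mx 0 j) G z.

Definition mixed_partial p G : 'rV[C]_m -> C :=
  foldr (fun j => iter (p j) (partial j)) G (enum 'I_m).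

Definition taylor_coef G z p : C :=
  mixed_partial p G z / (\prod_j (p j)`!)%:R.

(* The coefficient of x^k in G(u_0, ..., u_{m-1}), for formal power series
   u_j = sum_l (u j l) x^l: Taylor expansion of G at the constant terms,
   followed by substitution of u_j - u_j(0) for the increments.  As these have
   no constant term, only exponents p_j <= k contribute to x^k, and the series
   may be truncated to polynomials of degree <= k. *)
Definition fps_subst G (u : 'I_m -> nat -> C) (k : nat) : C :=
  let increment j : {poly C} :=
    \poly_(l < k.+1) (if l == 0%N then 0 else u j l) in
  \sum_(p : {ffun 'I_m -> 'I_k.+1})
     taylor_coef G (\row_j u j 0%N) (fun j => p j)
     * (\prod_j increment j ^+ p j)`_k.

End Taylor.

Section Exotic.
Variable C : numClosedFieldType.
Implicit Types (eps eta t : C) (alpha A : nat -> C -> C).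

(* A : nat -> C -> C stands for the formal series sum_k A_k(t) x^k with
   t = x^(i eta); only the values of A_k on the punctured disc matter. *)
Definition exotic_series eps alpha : Prop :=
  exists (r : nat -> int) (a : nat -> nat -> C), forall k : nat,
    (forall t, `|t| < eps ->
       cvgn (series (fun l : nat => a k l * t ^+ l))) /\
    (forall t, punctured_disc eps t ->
       alpha k t = t ^ (- r k) * limn (series (fun l : nat => a k l * t ^+ l))).

Definition fzero eps A : Prop :=
  forall k t, punctured_disc eps t -> A k t = 0.

(* x d/dx on exotic series. *)
Definition delta eta alpha : nat -> C -> C :=
  fun k t => k%:R * alpha k t + 'i * eta * t * derive1 (alpha k) t.

(* The entries of (x, phi, delta phi, delta^2 phi, ...): index 0 is the series
   x, index i.+1 is delta^i phi. *)
Definition jet eta alpha (j : nat) : nat -> C -> C :=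
  if j is i.+1 then iter i (delta eta) alpha else fun k _ => (k == 1%N)%:R.

(* The point (0, Phi_0(t)). *)
Definition jet0 (n : nat) eta alpha t : 'rV[C]_n.+2 :=
  \row_j jet eta alpha j 0%N t.

(* The exotic series G(x, Phi). *)
Definition jet_subst (n : nat) eta alpha (G : 'rV[C]_n.+2 -> C) :
    nat -> C -> C :=
  fun k t => fps_subst G (fun j l => jet eta alpha j l t) k.

(* Coordinate 0 of 'rV_n.+2 is x, coordinate [lift ord0 i] is y_i. *)
Definition polydisc (n : nat) (rho : C) (e : 'I_n.+1 -> C) : set 'rV[C]_n.+2 :=
  [set z | `|z 0 0| < rho /\ forall i, `|z 0 (lift ord0 i)| < e i].

Definition partial_y (n : nat) (i : 'I_n.+1) (F : 'rV[C]_n.+2 -> C) :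
    'rV[C]_n.+2 -> C :=
  partial (lift ord0 i) F.

End Exotic.

(* Main.v *)
(* Idea. On a circle |t| = s the operator D_k = k + i eta t d/dt, through which
   delta acts on the coefficient of x^k, is k + eta d/dphi; looking at a point
   where |u| is maximal gives sup |D_k u| >= k sup |u| on every rotation
   invariant compact set. Choose a thin annulus around 0 on which B_n does not
   vanish. The coefficient of x^(N+k) in F(x, Phi) = 0 expresses
   sum_i B_i D_k^i alpha_k through the alpha_l with l < k, and for k large the
   estimate makes B_n D_k^n alpha_k the dominant term, so that a majorant argument
   bounds sup |alpha_k| geometrically on the annulus. On the branch of log x
   chosen, x^(i eta) stays in this annulus, and the Weierstrass test applies.

   Cauchy's theory is derived without integrals: in the coordinate log t,
   Goursat's bisection shows that midpoint sums over circles are asymptotically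
   independent of the radius, and all estimates pass to the limit. *)
Require Import Defs.
From HB Require Import structures.
From mathcomp Require Import all_boot all_order all_algebra.
From mathcomp Require Import complex.
From mathcomp Require Import all_classical all_reals all_analysis.
From mathcomp Require Import zify ring lra.
Set Implicit Arguments.
Unset Strict Implicit.
Unset Printing Implicit Defensive.
Import Order.TTheory GRing.Theory Num.Theory.
Import numFieldNormedType.Exports.
Local Open Scope classical_set_scope.
Local Open Scope ring_scope.

(** The delicate point is the exponent N. The coefficient of x^(N+k) contains alpha_k linearly, but
    also products of earlier coefficients whose orders add up to N + k. An induction on bounds e_l
    r^l <= const would lose a factor r^(-N) at each step. The weights are therefore kept flat up to
    some K > N: e_l is multiplied by r^(l - min(l, K)). In a product of total order N + k all of
    whose factors have order below k, the truncated orders min(l, K) still add up to at least N + K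
    + 1, whereas the left side carries only N + K. The surplus factor r closes the induction. The
    other obstacle is t = 0, where alpha_0 might have a pole and (0, Phi_0(t)) might reach the
    boundary of the polydisc. Both are excluded, so the Taylor coefficients of F along Phi_0 extend
    holomorphically over 0 and B_n is meromorphic there; its zeros then do not accumulate at 0,
    which provides the annulus. In several variables only partial derivatives, their symmetry and
    Cauchy bounds for Taylor coefficients are needed; they are drawn from one variable along
    curves. *)

Local Notation "r %:C" := (cplx_of_real r) (format "r %:C") : ring_scope.

(** * The real-valued norm on normed spaces over C *)

Section RealNorm.
Variable R : realType.
Local Notation C := (Cplx R).
Implicit Types (r s : R).

(** The norm of a normed module over [C] has values in [C]; its real part moves all estimates to the
    ordered field [R], where [lra] and [nra] apply. *)
Definition nm (V : normedZmodType C) (v : V) : R := complex.Re `|v|.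

Lemma rcD r s : (r + s)%:C = r%:C + s%:C.
Proof. exact: (raddfD (real_complex R)). Qed.
Lemma rcN r : (- r)%:C = - r%:C.
Proof. exact: (raddfN (real_complex R)). Qed.
Lemma rcB r s : (r - s)%:C = r%:C - s%:C.
Proof. exact: (raddfB (real_complex R)). Qed.
Lemma rcM r s : (r * s)%:C = r%:C * s%:C.
Proof. exact: (rmorphM (real_complex R)). Qed.
Lemma rc0 : 0%:C = 0 :> C. Proof. by []. Qed.
Lemma rc1 : 1%:C = 1 :> C. Proof. by []. Qed.
Lemma rcV r : (r^-1)%:C = (r%:C)^-1.
Proof. exact: (fmorphV (real_complex R)). Qed.
Lemma rcX r n : (r ^+ n)%:C = r%:C ^+ n.
Proof. exact: (rmorphXn (real_complex R)). Qed.
Lemma rcn n : (n%:R)%:C = n%:R :> C.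
Proof. exact: (rmorph_nat (real_complex R)). Qed.
Lemma lerc r s : (r%:C <= s%:C :> C) = (r <= s).
Proof. exact: lecR. Qed.
Lemma ltrc r s : (r%:C < s%:C :> C) = (r < s).
Proof. exact: ltcR. Qed.
Lemma rc_inj r s : r%:C = s%:C -> r = s.
Proof. by case. Qed.

Lemma gt0_rc (z : C) : 0 < z -> exists2 r, 0 < r & z = r%:C.
Proof.
move=> z0; exists (complex.Re z).
  by move: z0; rewrite ltcE /= => /andP[].
by rewrite /cplx_of_real RRe_real // gtr0_real.
Qed.

Section Norm.
Variable V : normedZmodType C.
Implicit Types v w : V.

Lemma nmE v : `|v| = (nm v)%:C.
Proof. by rewrite /nm /cplx_of_real RRe_real // normr_real. Qed.
Lemma nm_ge0 v : 0 <= nm v.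
Proof. by rewrite -lerc -nmE normr_ge0. Qed.
Lemma nm0 : nm (0 : V) = 0.
Proof. by rewrite /nm normr0. Qed.
Lemma nm0_eq0 v : nm v = 0 -> v = 0.
Proof. by move=> h; apply/normr0_eq0; rewrite nmE h. Qed.
Lemma nm_gt0 v : (0 < nm v) = (v != 0).
Proof. by rewrite -ltrc -nmE normr_gt0. Qed.
Lemma nmD v w : nm (v + w) <= nm v + nm w.
Proof. by rewrite -lerc rcD -!nmE ler_normD. Qed.
Lemma nmN v : nm (- v) = nm v.
Proof. by rewrite /nm normrN. Qed.
Lemma nmB v w : nm (v - w) <= nm v + nm w.
Proof. by rewrite -(nmN w) nmD. Qed.
Lemma nmC v w : nm (v - w) = nm (w - v).
Proof. by rewrite -nmN opprB. Qed.
Lemma nm_tri u v w : nm (u - w) <= nm (u - v) + nm (v - w).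
Proof. by rewrite (le_trans _ (nmD _ _)) // addrA subrK. Qed.
Lemma nm_sub v w : nm v - nm w <= nm (v - w).
Proof. by rewrite lerBlDr (le_trans _ (nmD _ _)) // subrK. Qed.
Lemma nm_sum (I : Type) (r : seq I) (P : pred I) (f : I -> V) :
  nm (\sum_(i <- r | P i) f i) <= \sum_(i <- r | P i) nm (f i).
Proof.
elim/big_rec2: _ => [|i y x _ h]; first by rewrite nm0.
by rewrite (le_trans (nmD _ _)) // lerD2l.
Qed.
End Norm.

Lemma nmM (z w : C) : nm (z * w) = nm z * nm w.
Proof. by apply: rc_inj; rewrite rcM -!nmE normrM. Qed.
Lemma nm1 : nm (1 : C) = 1.
Proof. by apply: rc_inj; rewrite -!nmE normr1. Qed.
Lemma nmV (z : C) : nm z^-1 = (nm z)^-1.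
Proof. by apply: rc_inj; rewrite rcV -!nmE normfV. Qed.
Lemma nmX (z : C) n : nm (z ^+ n) = nm z ^+ n.
Proof. by apply: rc_inj; rewrite rcX -!nmE normrX. Qed.
Lemma nm_rc r : nm (r%:C : C) = `|r|.
Proof.
have h t : 0 <= t -> nm (t%:C : C) = t.
  by move=> t0; apply: rc_inj; rewrite -nmE ger0_norm // -rc0 lerc.
have [r0|r0] := leP 0 r; first by rewrite h // ger0_norm.
by rewrite -nmN -rcN h ?ltr0_norm // oppr_ge0 ltW.
Qed.
Lemma nm_nat n : nm (n%:R : C) = n%:R.
Proof. by rewrite -rcn nm_rc ger0_norm. Qed.
Lemma nmi : nm ('i : C) = 1.
Proof. by rewrite /nm normCi. Qed.
Lemma nmZ (V : normedModType C) (z : C) (v : V) : nm (z *: v) = nm z * nm v.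
Proof. by apply: rc_inj; rewrite rcM -!nmE normrZ. Qed.

Lemma nmRe (z : C) : `|complex.Re z| <= nm z.
Proof. by rewrite -lerc -nmE; exact: normc_ge_Re. Qed.
Lemma nmIm (z : C) : `|complex.Im z| <= nm z.
Proof.
have := nmRe ('i * z); rewrite nmM nmi mul1r => h; apply: le_trans h.
rewrite -complexiE; case: z => a b /=; rewrite mul0r mul1r sub0r normrN //.
Qed.
Lemma nm_ReIm (z : C) : nm z <= `|complex.Re z| + `|complex.Im z|.
Proof.
rewrite {1}(complexE z) -nm_rc -[X in _ <= _ + X]nm_rc.
apply: (le_trans (nmD _ _)).
by rewrite nmM complexiE nmi mul1r.
Qed.

Section Topology.
Variable V : normedModType C.
Implicit Types v w : V.

Lemma nbhs_nm v (A : set V) :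
  nbhs v A <-> exists2 e : R, 0 < e & forall w, nm (w - v) < e -> A w.
Proof.
split=> [/nbhs_ballP[_ /gt0_rc[e e0 ->]] h|[e e0 h]].
  exists e => // w wv; apply: h; rewrite -ball_normE /ball_ /=.
  by rewrite nmE ltrc nmC.
apply/nbhs_ballP; exists e%:C; first by rewrite /= -rc0 ltrc.
by move=> w; rewrite -ball_normE /ball_ /= nmE ltrc nmC; exact: h.
Qed.

Lemma cvg_nm (T : Type) (F : set_system T) (FF : Filter F) (f : T -> V) v :
  f @ F --> v <-> forall e : R, 0 < e -> \forall x \near F, nm (f x - v) < e.
Proof.
split=> [/cvgrPdist_lt h e e0|h].
  have e1 : 0 < e%:C :> C by rewrite -rc0 ltrc.
  by near do rewrite nmC -ltrc -nmE; exact: h.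
apply/cvgrPdist_lt => _ /gt0_rc[e e0 ->].
by near do rewrite nmE ltrc nmC; exact: h.
Unshelve. all: by end_near. Qed.
End Topology.

End RealNorm.

(** * Complex derivatives in epsilon form, completeness of C *)

Section Deriv.
Variable R : realType.
Local Notation C := (Cplx R).

(** The field is arbitrary because the criterion serves functions on [C] and also the real functions
    exp, cos and sin in [has_deriv_cexp]. *)
Lemma is_derive_eps (K : numFieldType) (f : K -> K) (t d : K) :
  is_derive t 1 f d <-> forall e : K, 0 < e -> exists2 del : K, 0 < del &
    forall h, `|h| < del -> `|f (t + h) - f t - h * d| <= e * `|h|.
Proof.
have quot h : h != 0 -> h^-1 *: ((f \o shift t) (h *: 1) - f t) - d =
    h^-1 * (f (t + h) - f t - h * d).
  move=> h0; rewrite mulrBr mulKf //= /GRing.scale /= mulr1 [h + t]addrC //.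
split=> [[/= dv dE] e e0|h].
  have /cvgrPdist_lt /(_ e e0) : h^-1 *: ((f \o shift t) (h *: 1) - f t) @[h --> 0^'] --> d.
    by rewrite -dE; exact: dv.
  rewrite near_withinE => /nbhs_ballP[del del0 hdel].
  exists del => // h hh; have [->|h0] := eqVneq h 0.
    by rewrite addr0 subrr mul0r subr0 normr0 mulr0.
  have := hdel h; rewrite -ball_normE /ball_ /= sub0r normrN => /(_ hh h0).
  rewrite distrC quot // normrM normfV => /ltW.
  by rewrite ler_pdivrMl ?normr_gt0 // [leRHS]mulrC.
have cv : h^-1 *: ((f \o shift t) (h *: 1) - f t) @[h --> 0^'] --> d.
  apply/cvgrPdist_le => e e0; have [del del0 hdel] := h e e0.
  rewrite near_withinE; apply/nbhs_ballP; exists del => // k.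
  rewrite -ball_normE /ball_ /= sub0r normrN => kd k0.
  rewrite distrC quot // normrM normfV ler_pdivrMl ?normr_gt0 //.
  by rewrite [leRHS]mulrC; exact: hdel.
split; first by apply/cvg_ex; exists d.
exact: cvg_lim cv.
Qed.

(** Multiplied out by [h], so that [h = 0] is allowed: in the chain rule the increment of the inner
    function may vanish. *)
Definition has_deriv (f : C -> C) (t d : C) := forall e : R, 0 < e ->
  exists2 del : R, 0 < del &
    forall h, nm h < del -> nm (f (t + h) - f t - h * d) <= e * nm h.

Lemma has_derivP (f : C -> C) (t d : C) : has_deriv f t d <-> is_derive t 1 f d.
Proof.
split=> h.
  apply/is_derive_eps => _ /gt0_rc[e e0 ->]; have [del del0 hdel] := h e e0.
  exists del%:C; first by rewrite -rc0 ltrc.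
  by move=> k; rewrite !nmE ltrc -rcM lerc; exact: hdel.
move=> e e0; have e1 : 0 < e%:C :> C by rewrite -rc0 ltrc.
have /is_derive_eps /(_ _ e1)[_ /gt0_rc[del del0 ->] hdel] := h.
by exists del => // k kd; rewrite -lerc rcM -!nmE hdel // nmE ltrc.
Qed.

Definition cdiff (f : C -> C) (t : C) := derivable f t 1.

Lemma has_deriv_cdiff f t d : has_deriv f t d -> cdiff f t.
Proof. by move=> /has_derivP[]. Qed.
Lemma has_deriv_derive1 f t d : has_deriv f t d -> derive1 f t = d.
Proof. by rewrite derive1E => /has_derivP[]. Qed.
Lemma cdiff_hd f t : cdiff f t -> has_deriv f t (derive1 f t).
Proof. by rewrite derive1E => h; apply/has_derivP; split. Qed.
Lemma has_deriv_ext f t d d' : d = d' -> has_deriv f t d -> has_deriv f t d'.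
Proof. by move=> ->. Qed.

Lemma has_deriv_cont (f : C -> C) t d : has_deriv f t d -> {for t, continuous f}.
Proof.
move=> /has_deriv_cdiff /derivable1_diffP; exact: differentiable_continuous.
Qed.

Lemma has_deriv_near (f g : C -> C) t d (r : R) : 0 < r ->
  (forall x, nm (x - t) < r -> f x = g x) -> has_deriv f t d -> has_deriv g t d.
Proof.
move=> r0 fg h e e0; have [del del0 hdel] := h e e0.
exists (Num.min del r); first by rewrite lt_min del0.
move=> k; rewrite lt_min => /andP[k1 k2].
by rewrite -!fg ?hdel ?subrr ?nm0 // [t + k]addrC addrK.
Qed.

Lemma has_deriv_cst c t : has_deriv (fun=> c) t 0.
Proof. by apply/has_derivP; exact: is_derive_cst. Qed.
Lemma has_deriv_id t : has_deriv (fun x => x) t 1.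
Proof. by apply/has_derivP; exact: is_derive_id. Qed.
Lemma has_derivD f g t a b : has_deriv f t a -> has_deriv g t b -> has_deriv (fun x => f x + g x) t (a + b).
Proof. by move=> /has_derivP ? /has_derivP ?; apply/has_derivP; exact: is_deriveD. Qed.
Lemma has_derivN f t a : has_deriv f t a -> has_deriv (fun x => - f x) t (- a).
Proof. by move=> /has_derivP ?; apply/has_derivP; exact: is_deriveN. Qed.
Lemma has_derivB f g t a b : has_deriv f t a -> has_deriv g t b -> has_deriv (fun x => f x - g x) t (a - b).
Proof. by move=> h /has_derivN; exact: has_derivD. Qed.
Lemma has_derivM f g t a b : has_deriv f t a -> has_deriv g t b ->
  has_deriv (fun x => f x * g x) t (a * g t + f t * b).
Proof.
move=> /has_derivP ? /has_derivP ?; apply/has_derivP; apply: is_derive_eq.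
by rewrite /GRing.scale /= addrC [g t * a]mulrC.
Qed.
Lemma has_derivV f t a : has_deriv f t a -> f t != 0 -> has_deriv (fun x => (f x)^-1) t (- a / f t ^+ 2).
Proof.
move=> /has_derivP [h1 h2] f0; apply/has_derivP; split; first exact: derivableV.
by rewrite deriveV // h2 /GRing.scale /= mulNr mulrC mulNr.
Qed.
Lemma has_deriv_comp f g t a b : has_deriv f t a -> has_deriv g (f t) b -> has_deriv (fun x => g (f x)) t (a * b).
Proof.
move=> hf hg e e0.
have A0 : 0 <= nm a by exact: nm_ge0.
have B0 : 0 <= nm b by exact: nm_ge0.
(* The total error will be at most [e1 * (nm a + nm b + e1) * nm h], and [e1 <= e]. *)
pose e1 := e / (nm a + nm b + e + 1).
have D0 : 0 < nm a + nm b + e + 1 by lra.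
have e10 : 0 < e1 by rewrite divr_gt0.
have e1D : e1 * (nm a + nm b + e + 1) = e by rewrite divfK // gt_eqF.
have [d1 d10 h1] := hf _ e10.
have [d2 d20 h2] := hg _ e10.
have S0 : 0 < nm a + e1 by lra.
exists (Num.min d1 (d2 / (nm a + e1))); first by rewrite lt_min d10 divr_gt0.
move=> h; rewrite lt_min => /andP[hh1]; rewrite ltr_pdivlMr // => hh2.
pose k := f (t + h) - f t.
have kE : nm (k - h * a) <= e1 * nm h by exact: h1.
have kn : nm k <= (nm a + e1) * nm h.
  have := nmD (k - h * a) (h * a); rewrite subrK nmM; lra.
have h3 : nm (g (f t + k) - g (f t) - k * b) <= e1 * nm k.
  by apply: h2; apply: le_lt_trans kn _; rewrite mulrC.
rewrite [f t + k]addrC subrK in h3.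
have -> : g (f (t + h)) - g (f t) - h * (a * b) =
   (g (f (t + h)) - g (f t) - k * b) + (k - h * a) * b by ring.
apply: (le_trans (nmD _ _)); rewrite nmM.
have H0 := nm_ge0 h.
have : nm (k - h * a) * nm b <= e1 * nm h * nm b by rewrite ler_wpM2r.
have : e1 * nm k <= e1 * ((nm a + e1) * nm h) by rewrite ler_pM2l.
have e1e : e1 <= e.
  by rewrite ler_pdivrMr // -[X in X <= _]mulr1 ler_pM2l //; lra.
have : e1 * ((nm a + e1) * nm h) <= e1 * ((nm a + e) * nm h).
  by rewrite ler_pM2l // ler_wpM2r // lerD2l.
have : 0 <= e1 * nm h by rewrite mulr_ge0 // ltW.
have -> : e * nm h = e1 * (nm a + nm b + e + 1) * nm h by rewrite e1D.
set u := e1 * nm h; nra.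
Qed.
Lemma has_derivX f t a n : has_deriv f t a -> has_deriv (fun x => f x ^+ n) t (n%:R * a * f t ^+ n.-1).
Proof.
move=> h; elim: n => [|n IH]; first by rewrite mul0r mul0r; exact: has_deriv_cst.
have := has_derivM h IH; congr has_deriv => //; first by apply/funext=> x; rewrite exprS.
case: n {IH} => [|n] /=; first by rewrite !expr0 mulr1 !mul0r mulr0 addr0 mul1r mulr1.
by rewrite -!natr1 exprS; ring.
Qed.
Lemma has_deriv_sum (I : Type) (r : seq I) (f : I -> C -> C) (d : I -> C) t :
  (forall i, has_deriv (f i) t (d i)) -> has_deriv (fun x => \sum_(i <- r) f i x) t (\sum_(i <- r) d i).
Proof.
move=> h; elim: r => [|i r IH].
  rewrite big_nil; have := has_deriv_cst 0 t; congr has_deriv => //.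
  by apply/funext => x; rewrite big_nil.
rewrite big_cons; have := has_derivD (h i) IH; congr has_deriv => //.
by apply/funext => x; rewrite big_cons.
Qed.

(** Completeness of [R] applied to the real and imaginary parts, which are 1-Lipschitz. *)
Lemma nm_complete (T : Type) (F : set_system T) (FF : ProperFilter F) (f : T -> C) :
  (forall e : R, 0 < e -> exists z : C, \forall x \near F, nm (f x - z) < e) ->
  exists l : C, f @ F --> l.
Proof.
move=> h.
have cv (g : C -> R) : (forall z w : C, `|g z - g w| <= nm (z - w)) ->
    exists l : R, (g \o f) @ F --> l.
  move=> gl; have /cauchy_cvg cg : cauchy ((g \o f) @ F).
    apply: cauchy_exP => e e0; have [z hz] := h _ e0; exists (g z).
    rewrite /=; near=> x; rewrite -ball_normE /ball_ /=.
    rewrite distrC (le_lt_trans (gl _ _)) //; near: x; exact: hz.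
  by exists (lim ((g \o f) @ F)).
have [a ha] : exists l : R, (@complex.Re R \o f) @ F --> l.
  by apply: cv => -[a b] [c d]; exact: (nmRe (Complex (a - c) (b - d) : C)).
have [b hb] : exists l : R, (@complex.Im R \o f) @ F --> l.
  by apply: cv => -[a' b] [c d]; exact: (nmIm (Complex (a' - c) (b - d) : C)).
exists (Complex a b : C); apply/cvg_nm => e e0.
have e2 : 0 < e / 2 by lra.
move: ha => /cvgrPdist_lt /(_ _ e2) ha; move: hb => /cvgrPdist_lt /(_ _ e2) hb.
near=> x.
have H1 : `|a - complex.Re (f x)| < e / 2 by near: x; exact: ha.
have H2 : `|b - complex.Im (f x)| < e / 2 by near: x; exact: hb.
apply: le_lt_trans (nm_ReIm _) _; rewrite (splitr e).
by case: (f x) H1 H2 => u v /= ? ?; rewrite ltrD // distrC.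
Unshelve. all: by end_near. Qed.

End Deriv.

(** * The complex exponential, arguments and branches of the logarithm *)

Section CExp.
Variable R : realType.
Local Notation C := (Cplx R).
Implicit Types (z w : C) (r s : R).

Lemma nm_sqr z : nm z ^+ 2 = complex.Re z ^+ 2 + complex.Im z ^+ 2.
Proof. by apply: rc_inj; rewrite rcX -nmE; exact/esym/add_Re2_Im2. Qed.

Lemma cexpD z w : cexp (z + w) = cexp z * cexp w.
Proof.
case: z w => a b [c d]; rewrite /cexp /= expRD cosD sinD.
by apply/eqP; rewrite eq_complex /=; apply/andP; split; apply/eqP; ring.
Qed.
Lemma cexp0 : cexp 0 = 1 :> C.
Proof. by rewrite /cexp /= expR0 cos0 sin0 mulr0 mulr1. Qed.
Lemma cexp_rc r : cexp r%:C = (expR r)%:C.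
Proof. by rewrite /cexp /= cos0 sin0 mulr0 mulr1. Qed.
Lemma irc r : 'i * r%:C = Complex 0 r :> C.
Proof.
rewrite -complexiE; apply/eqP; rewrite eq_complex /=.
by apply/andP; split; apply/eqP; ring.
Qed.
Lemma cexp_irc r : cexp ('i * r%:C) = Complex (cos r) (sin r).
Proof. by rewrite irc /cexp /= expR0 !mul1r. Qed.
Lemma nm_cexp z : nm (cexp z) = expR (complex.Re z).
Proof.
apply/eqP; rewrite -(@eqrXn2 _ 2) ?nm_ge0 ?expR_ge0 //; apply/eqP.
rewrite nm_sqr /cexp /= !exprMn -mulrDr cos2Dsin2 mulr1 //.
Qed.
Lemma cexp_neq0 z : cexp z != 0.
Proof. by rewrite -nm_gt0 nm_cexp expR_gt0. Qed.
Lemma cexpMn z n : cexp (z *+ n) = cexp z ^+ n.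
Proof. by elim: n => [|n IH]; rewrite ?cexp0 // mulrS cexpD IH exprS. Qed.
Lemma cexpN z : cexp (- z) = (cexp z)^-1.
Proof.
by apply: (mulfI (cexp_neq0 z)); rewrite -cexpD subrr cexp0 mulfV ?cexp_neq0.
Qed.
Lemma cexp_2pi : cexp ('i * (pi *+ 2)%:C) = 1 :> C.
Proof. by rewrite cexp_irc cos2pi sin2pi. Qed.

(** The derivative at 0 follows from the first-order expansions of exp, cos and sin; the addition
    theorem carries it to [z]. *)
Lemma has_deriv_cexp z : has_deriv (@cexp R) z (cexp z).
Proof.
have small (f : R -> R) (x d e : R) : is_derive x 1 f d -> 0 < e ->
    exists2 del : R, 0 < del &
    forall h, `|h| < del -> `|f (x + h) - f x - h * d| <= e * `|h|.
  by move=> /is_derive_eps; exact.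
have h0 : has_deriv (@cexp R) 0 1.
  move=> e e0; have e4 : 0 < e / 4 by lra.
  have [d1 d10 h1] := small _ _ _ _ (is_derive_expR 0) e4.
  have [d2 d20 h2] := small _ _ _ _ (is_derive_cos 0) e4.
  have [d3 d30 h3] := small _ _ _ _ (is_derive_sin 0) e4.
  have [d5 d50 h5] := small _ _ _ _ (is_derive_expR 0) ltr01.
  have [d6 d60 h6] := small _ _ _ _ (is_derive_sin 0) ltr01.
  (* Three linear errors contribute [e / 4] each; the bounds [1 / 8] and [e / 32] reduce the two
     product terms to [e / 16] and [e / 8], for a total of 15/16 of [e]. *)
  pose m := Num.min (Num.min d1 d2) (Num.min (Num.min d3 d5) (Num.min d6 (Num.min (1 / 8) (e / 32)))).
  exists m; first by rewrite /m !lt_min d10 d20 d30 d50 d60 /=; lra.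
  move=> k; rewrite /m !lt_min.
  move=> /andP[/andP[k1 k2] /andP[/andP[k3 k5] /and3P[k6 k7 k8]]].
  have -> : cexp (0 + k) - cexp 0 - k * 1 =
      Complex (expR (complex.Re k) * cos (complex.Im k) - 1 - complex.Re k)
        (expR (complex.Re k) * sin (complex.Im k) - complex.Im k) :> C.
    rewrite add0r mulr1 cexp0; case: (k) => a b.
    by apply/eqP; rewrite eq_complex /=; apply/andP; split; apply/eqP; ring.
  have := nmIm k; have := nmRe k.
  have := nm_ge0 k; move: (complex.Re k) (complex.Im k) (nm k) k1 k2 k3 k5 k6 k7 k8.
  move=> a b n k1 k2 k3 k5 k6 k7 k8 n0 an bn {small}.
  have {}h1 := h1 _ (le_lt_trans an k1); have {}h5 := h5 _ (le_lt_trans an k5).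
  have {}h2 := h2 _ (le_lt_trans bn k2); have {}h3 := h3 _ (le_lt_trans bn k3).
  have {}h6 := h6 _ (le_lt_trans bn k6).
  move: h1 h2 h3 h5 h6.
  rewrite !add0r expR0 cos0 sin0 oppr0 mulr0 !addr0 !mulr1 !subr0 !mul1r => h1 h2 h3 h5 h6.
  apply: le_trans (nm_ReIm _) _ => /=.
  have ea : `|expR a - 1| <= 2 * n.
    have := ler_normD (expR a - 1 - a) a; rewrite subrK; lra.
  have sbn : `|sin b| <= 2 * n.
    have := ler_normD (sin b - b) b; rewrite subrK; lra.
  have E : 0 <= e / 4 by lra.
  have h1' : `|expR a - 1 - a| <= e / 4 * n by apply: le_trans h1 _; rewrite ler_wpM2l.
  have h2' : `|cos b - 1| <= e / 4 * n by apply: le_trans h2 _; rewrite ler_wpM2l.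
  have h3' : `|sin b - b| <= e / 4 * n by apply: le_trans h3 _; rewrite ler_wpM2l.
  have -> : expR a * cos b - 1 - a =
      (expR a - 1 - a) + ((expR a - 1) * (cos b - 1) + (cos b - 1)) by ring.
  have -> : expR a * sin b - b = (expR a - 1) * sin b + (sin b - b) by ring.
  have P1 : `|(expR a - 1) * (cos b - 1)| <= 2 * n * (e / 4 * n).
    by rewrite normrM ler_pM.
  have P2 : `|(expR a - 1) * sin b| <= 2 * n * (2 * n).
    by rewrite normrM ler_pM.
  have Q1 : n * (e / 4 * n) <= 1 / 8 * (e / 4 * n).
    by rewrite ler_wpM2r ?(ltW k7) // mulr_ge0.
  have Q2 : n * n <= e / 32 * n by rewrite ler_wpM2r ?(ltW k8).
  have := ler_normD (expR a - 1 - a) ((expR a - 1) * (cos b - 1) + (cos b - 1)).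
  have := ler_normD ((expR a - 1) * (cos b - 1)) (cos b - 1).
  have := ler_normD ((expR a - 1) * sin b) (sin b - b).
  have : 0 <= e * n by rewrite mulr_ge0 // ltW.
  lra.
have sh : has_deriv (fun w : C => w - z) z 1.
  by rewrite -(subr0 1); apply: has_derivB; [exact: has_deriv_id|exact: has_deriv_cst].
have := has_derivM (has_deriv_cst (cexp z) z) (has_deriv_comp sh (_ : has_deriv (@cexp R) (z - z) 1)).
rewrite subrr mul1r mul0r add0r mulr1 => /(_ h0); congr has_deriv.
by apply/funext => w; rewrite -cexpD addrC subrK.
Qed.

(** For x = |x| exp(i theta) with 0 < theta < 2 pi, Im x / (|x| - Re x) is the cotangent of theta /
    2, so the formula returns theta. On the nonnegative reals the quotient is 0 / 0 = 0 and the
    value is pi, so [carg_itv] holds for every [x]. *)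
Definition carg (x : C) : R := pi - atan (complex.Im x / (nm x - complex.Re x)) *+ 2.

Lemma carg_itv x : 0 < carg x < pi *+ 2.
Proof.
rewrite /carg; set u := (X in atan X).
have := atan_ltpi2 u; have := atan_gtNpi2 u; move: (atan u) (@pi R) => a p h1 h2.
by rewrite !mulr2n; apply/andP; split; lra.
Qed.

Lemma nnegP x : (~` @nneg_reals R) x -> 0 < nm x - complex.Re x.
Proof.
move=> h; have := nmRe x; rewrite ler_norml => /andP[_ h1].
rewrite subr_gt0 lt_neqAle h1 andbT; apply/eqP => E; apply: h.
exists (complex.Re x); first by rewrite /= E nm_ge0.
apply/eqP; rewrite eq_complex /= eqxx /=; apply/eqP.
have := nm_sqr x; rewrite -E; nra.
Qed.

Lemma nneg_neq0 x : (~` @nneg_reals R) x -> 0 < nm x.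
Proof.
by move=> /nnegP; have := nmRe x; rewrite ler_norml => /andP[]; lra.
Qed.

Lemma cexp_carg x : (~` @nneg_reals R) x ->
  cexp ((ln (nm x))%:C + 'i * (carg x)%:C) = x.
Proof.
move=> xn; have d0 := nnegP xn; have n0 := nneg_neq0 xn.
rewrite cexpD cexp_rc lnK ?posrE // cexp_irc /carg.
set u := _ / _; set a := atan u.
rewrite cosB sinB cospi sinpi.
have u1 : 0 < 1 + u ^+ 2 by rewrite ltr_pwDl ?sqr_ge0.
have uE : 1 + u ^+ 2 = 2 * nm x / (nm x - complex.Re x).
  have -> : 1 + u ^+ 2 = ((nm x - complex.Re x) ^+ 2 + complex.Im x ^+ 2) / (nm x - complex.Re x) ^+ 2.
    by rewrite /u; field; rewrite gt_eqF.
  have -> : (nm x - complex.Re x) ^+ 2 + complex.Im x ^+ 2 =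
     2 * nm x * (nm x - complex.Re x) + (complex.Re x ^+ 2 + complex.Im x ^+ 2 - nm x ^+ 2) by ring.
  by rewrite nm_sqr subrr addr0; field; rewrite gt_eqF.
have c2 : cos a ^+ 2 = (1 + u ^+ 2)^-1.
  by rewrite /a cos_atan exprVn sqr_sqrtr // ltW.
have ca0 : cos a != 0.
  by rewrite -sqrf_eq0 c2 invr_eq0 gt_eqF.
have sa : sin a = u * cos a.
  by have := atanK u; rewrite /tan -/a => <-; rewrite divfK.
have cE : cos (a *+ 2) = - complex.Re x / nm x.
  have -> : cos (a *+ 2) = 2 * cos a ^+ 2 - 1 by rewrite cos_mulr2n; ring.
  by rewrite c2 uE; field; rewrite !gt_eqF.
have sE : sin (a *+ 2) = complex.Im x / nm x.
  have -> : sin (a *+ 2) = 2 * u * cos a ^+ 2 by rewrite sin_mulr2n sa; ring.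
  by rewrite c2 uE /u; field; rewrite !gt_eqF.
rewrite cE sE; apply/eqP; rewrite eq_complex /=; apply/andP; split; apply/eqP.
  by field; rewrite gt_eqF.
by field; rewrite gt_eqF.
Qed.

(** The closed range includes the positive reals, where the argument is 0 and differs from
    [carg]. *)
Lemma cexp_polar x : x != 0 ->
  exists2 th : R, 0 <= th <= pi *+ 2 & x = cexp ((ln (nm x))%:C + 'i * th%:C).
Proof.
move=> x0; have [[r /= r0 rx]|xn] := pselect (@nneg_reals R x); last first.
  exists (carg x); last by rewrite cexp_carg.
  by have /andP[h1 h2] := carg_itv x; rewrite !ltW.
exists 0; first by rewrite lexx mulrn_wge0 // pi_ge0.
have := x0; rewrite -nm_gt0 => n0.
rewrite rc0 mulr0 addr0 cexp_rc lnK ?posrE // -rx nm_rc ger0_norm //.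
Qed.

Lemma log_branch_shift (c : R) : cexp ('i * c%:C) = 1 ->
  log_branch (~` @nneg_reals R) (fun x => (ln (nm x))%:C + 'i * (carg x + c)%:C).
Proof.
move=> hc; split=> [|x xn]; last first.
  by rewrite rcD mulrDr addrA cexpD hc mulr1 cexp_carg.
have cR (f : C -> R) x : (forall z w : C, `|f z - f w| <= nm (z - w)) -> f y @[y --> x] --> f x.
  move=> fl; apply/(@cvgrPdist_lt _ _ _ _ (nbhs_filter x)) => e e0; apply/nbhs_nm; exists e => // y yx.
  by rewrite (le_lt_trans (fl _ _)) // nmC.
have cC (f : C -> R) x : f y @[y --> x] --> f x -> (f y)%:C @[y --> x] --> (f x)%:C.
  move=> /(@cvgrPdist_lt _ _ _ _ (nbhs_filter x)) h; apply/(@cvg_nm _ _ _ _ (nbhs_filter x)) => e e0.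
  by near do rewrite -rcB nm_rc distrC; exact: h.
apply: continuous_in_subspaceT => x /set_mem xn.
have d0 := nnegP xn; have n0 := nneg_neq0 xn.
have cre : complex.Re y @[y --> x] --> complex.Re x.
  by apply: cR => -[a b] [a' b']; exact: (nmRe (Complex (a - a') (b - b') : C)).
have cim : complex.Im y @[y --> x] --> complex.Im x.
  by apply: cR => -[a b] [a' b']; exact: (nmIm (Complex (a - a') (b - b') : C)).
have cnm : nm y @[y --> x] --> nm x.
  apply: cR => z w; rewrite ler_norml nm_sub andbT lerNl opprB nmC; exact: nm_sub.
have FN := nbhs_filter x.
apply: (@cvgD _ _ _ _ FN).
  by apply: (cC (fun y => ln (nm y))); apply: (cvg_comp _ _ cnm (continuous_ln n0)).
apply: (@cvgM _ _ _ FN); first exact: (@cvg_cst _ _ _ _ FN).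
apply: (cC (fun y => carg y + c)); apply: (@cvgD _ _ _ _ FN); last exact: (@cvg_cst _ _ _ _ FN).
apply: (@cvgB _ _ _ _ FN); first exact: (@cvg_cst _ _ _ _ FN).
apply: (@cvgMn _ _ _ _ FN).
suff cu : complex.Im y / (nm y - complex.Re y) @[y --> x] --> complex.Im x / (nm x - complex.Re x).
  exact: (cvg_comp _ _ cu (@continuous_atan _ _)).
apply: (@cvgM _ _ _ FN); first exact: cim.
by apply: (@cvgV _ _ _ FN); [rewrite gt_eqF|apply: (@cvgB _ _ _ _ FN)].
Unshelve. all: by end_near. Qed.

End CExp.

(** * Compactness of parallelograms by dyadic subdivision *)

Section Cousin.
Variable R : realType.
Local Notation C := (Cplx R).
Implicit Types (p q v w : C).

(* Cousin's lemma on the parallelogram p + [0,1] v1 + [0,1] v2, whose dyadic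
   cells are q + h [0,1] v1 + h [0,1] v2 with h = 2 ^- k. *)
Lemma cousin p v1 v2 (P : C -> R -> Prop) :
  (forall q h, 0 < h -> P q (h / 2) -> P (q + (h / 2)%:C * v1) (h / 2) ->
     P (q + (h / 2)%:C * v2) (h / 2) -> P (q + (h / 2)%:C * (v1 + v2)) (h / 2) ->
     P q h) ->
  (forall s t : R, 0 <= s <= 1 -> 0 <= t <= 1 ->
     exists2 d : R, 0 < d & forall q h, 0 < h < d ->
       nm (q - (p + s%:C * v1 + t%:C * v2)) <= h * (nm v1 + nm v2) -> P q h) ->
  P p 1.
Proof.
move=> split loc; apply: contrapT => nP.
pose pt (x : R * R) := p + x.1%:C * v1 + x.2%:C * v2.
pose h k : R := 2^-1 ^+ k.
have h0 k : 0 < h k by rewrite exprn_gt0 // invr_gt0.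
have hS k : h k.+1 = h k / 2 by rewrite /h exprS mulrC.
(* One of the four quarters of a failing cell fails; [f] selects its corner in the coordinates of
   [v1] and [v2]. *)
have [f hf] : exists f : R * R -> nat -> R * R, forall x k, ~ P (pt x) (h k) ->
   [/\ ~ P (pt (f x k)) (h k.+1), x.1 <= (f x k).1, (f x k).1 + h k.+1 <= x.1 + h k,
    x.2 <= (f x k).2 & (f x k).2 + h k.+1 <= x.2 + h k].
  suff /choice[f hf] : forall xk : (R * R) * nat, exists y : R * R, ~ P (pt xk.1) (h xk.2) ->
     [/\ ~ P (pt y) (h xk.2.+1), xk.1.1 <= y.1, y.1 + h xk.2.+1 <= xk.1.1 + h xk.2,
      xk.1.2 <= y.2 & y.2 + h xk.2.+1 <= xk.1.2 + h xk.2].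
    by exists (fun x k => f (x, k)) => x k; exact: (hf (x, k)).
  move=> [[a b] k] /=; have [hP|hP] := pselect (P (pt (a, b)) (h k)).
    by exists (a, b) => /(_ hP).
  have H := hS k; have H0 := h0 k.
  have [p1|p1] := pselect (P (pt (a, b)) (h k.+1)); last first.
    by exists (a, b) => _ /=; split=> //; lra.
  have [p2|p2] := pselect (P (pt (a + h k.+1, b)) (h k.+1)); last first.
    by exists (a + h k.+1, b) => _ /=; split=> //; lra.
  have [p3|p3] := pselect (P (pt (a, b + h k.+1)) (h k.+1)); last first.
    by exists (a, b + h k.+1) => _ /=; split=> //; lra.
  have [p4|p4] := pselect (P (pt (a + h k.+1, b + h k.+1)) (h k.+1)); last first.
    by exists (a + h k.+1, b + h k.+1) => _ /=; split=> //; lra.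
  exfalso; apply: hP; apply: split => //; rewrite -?hS //.
  - by move: p2; congr P; rewrite /pt /= rcD; ring.
  - by move: p3; congr P; rewrite /pt /= rcD; ring.
  - by move: p4; congr P; rewrite /pt /= !rcD; ring.
pose x := fix x k := if k is j.+1 then f (x j) j else ((0, 0) : R * R).
have xP k : ~ P (pt (x k)) (h k).
  elim: k => [|k IH]; last by have [] := hf _ _ IH.
  by rewrite /h expr0 /pt /= rc0 !mul0r !addr0.
(* In each coordinate the lower ends increase and the upper ends decrease, so the supremum of the
   lower ends lies in all cells. *)
have lim (g : R * R -> R) : g (0, 0) = 0 ->
    (forall k, g (x k) <= g (x k.+1)) ->
    (forall k, g (x k.+1) + h k.+1 <= g (x k) + h k) ->
    exists2 s : R, 0 <= s <= 1 & forall k, g (x k) <= s <= g (x k) + h k.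
  move=> g0 up dn.
  have mono j k : (j <= k)%N -> g (x j) <= g (x k) /\ g (x k) + h k <= g (x j) + h j.
    elim: k => [|k IH]; first by rewrite leqn0 => /eqP ->.
    rewrite leq_eqVlt => /orP[/eqP -> //|]; rewrite ltnS => /IH[a1 a2].
    by split; [apply: le_trans (up k)|apply: le_trans (dn k) _].
  have bnd j k : g (x j) <= g (x k) + h k.
    have [jk|/ltnW kj] := leqP j k.
      by have [a1 _] := mono _ _ jk; apply: le_trans a1 _; rewrite lerDl ltW.
    have [_ a2] := mono _ _ kj; apply: le_trans a2; rewrite lerDl ltW //.
  pose A := range (fun k => g (x k)).
  have A0 : A !=set0 by exists (g (x 0%N)); exists 0%N.
  have Ab k : ubound A (g (x k) + h k) by move=> _ [j _ <-].
  have hs k : g (x k) <= sup A <= g (x k) + h k.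
    apply/andP; split; last by apply: ge_sup.
    apply: ub_le_sup; last by exists k.
    by exists (g (x 0%N) + h 0%N); exact: Ab.
  exists (sup A) => //; have := hs 0%N.
  by rewrite /= g0 add0r /h expr0.
have [s s01 hs] := lim fst erefl (fun k => let: And5 _ a _ _ _ := hf _ _ (xP k) in a)
  (fun k => let: And5 _ _ a _ _ := hf _ _ (xP k) in a).
have [t t01 ht] := lim snd erefl (fun k => let: And5 _ _ _ a _ := hf _ _ (xP k) in a)
  (fun k => let: And5 _ _ _ _ a := hf _ _ (xP k) in a).
have [d d0 has_deriv] := loc _ _ s01 t01.
have [k hk] : exists k, h k < d.
  have : h k @[k --> \oo] --> 0 by apply: cvg_expr; rewrite ger0_norm ?invr_ge0 // invf_lt1 // ltr1n.
  move=> /cvgrPdist_lt /(_ _ d0)[k _ /(_ k (leqnn _))].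
  by rewrite sub0r normrN gtr0_norm // => ?; exists k.
apply: (xP k); apply: has_deriv; first by rewrite h0.
have -> : pt (x k) - (p + s%:C * v1 + t%:C * v2) =
    ((x k).1 - s)%:C * v1 + ((x k).2 - t)%:C * v2.
  by rewrite /pt !rcB; ring.
apply: le_trans (nmD _ _) _; rewrite !nmM !nm_rc mulrDr.
have /andP[s1 s2] := hs k; have /andP[t1 t2] := ht k.
by rewrite lerD // ler_wpM2r ?nm_ge0 // ler_norml; lra.
Qed.

End Cousin.

(** * Goursat's theorem for midpoint sums *)

Section Goursat.
Variable R : realType.
Local Notation C := (Cplx R).
Implicit Types (p q v w : C) (G H : C -> C).

(** The midpoint rule with 2^n equal pieces for the integral of [G] along the segment from [p] to
    [p + v]. *)
Fixpoint midsum n G p v : C :=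
  if n is k.+1 then midsum k G p (v / 2) + midsum k G (p + v / 2) (v / 2)
  else v * G (p + v / 2).

Lemma midsum_bound n G p v (M : R) :
  (forall s : R, 0 <= s <= 1 -> nm (G (p + s%:C * v)) <= M) ->
  nm (midsum n G p v) <= nm v * M.
Proof.
elim: n p v => [|n IH] p v h /=.
  have h2 := h 2^-1; rewrite nmM ler_wpM2l ?nm_ge0 //.
  by move: h2; rewrite rcV rcn mulrC; apply; rewrite invr_ge0 ler0n invf_le1 // ler1n.
apply: le_trans (nmD _ _) _.
have -> : nm v * M = nm (v / 2) * M + nm (v / 2) * M.
  by rewrite nmM nmV nm_nat; field.
have two : (2 : C) = (2 : R)%:C by rewrite rcn.
apply: lerD; apply: IH => s s01.
  have -> : p + s%:C * (v / 2) = p + (s / 2)%:C * v.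
    by rewrite rcM rcV -two; ring.
  by apply: h; lra.
have -> : p + v / 2 + s%:C * (v / 2) = p + ((1 + s) / 2)%:C * v.
  by rewrite rcM rcV -two rcD rc1; ring.
by apply: h; lra.
Qed.

(** The midpoint rule is exact on affine functions, so their contour sums vanish at every level, as
    required for Goursat's argument. *)
Lemma midsum_affine n (a b : C) p v :
  midsum n (fun w => a + b * w) p v = v * (a + b * (p + v / 2)).
Proof.
elim: n p v => [//|n IH] p v /=; rewrite !IH; by field.
Qed.

Lemma midsumD n G H p v :
  midsum n (fun w => G w + H w) p v = midsum n G p v + midsum n H p v.
Proof. by elim: n p v => [|n IH] p v /=; rewrite ?mulrDr // !IH addrACA. Qed.

Lemma midsum_periodic n G p v (u : C) : (forall w, G (w + u) = G w) ->
  midsum n G (p + u) v = midsum n G p v.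
Proof.
move=> h; elim: n p v => [|n IH] p v /=; first by rewrite addrAC h.
by rewrite addrAC !IH.
Qed.

Definition contour n G p v1 v2 : C :=
  midsum n G p v1 + midsum n G (p + v1) v2 - midsum n G (p + v2) v1 - midsum n G p v2.

(** The sums over interior edges occur twice with opposite signs. The identity is exact because
    halving a side of a level [n.+1] sum gives two level [n] sums. *)
Lemma contour_split n G p v1 v2 : contour n.+1 G p v1 v2 =
  contour n G p (v1 / 2) (v2 / 2) + contour n G (p + v1 / 2) (v1 / 2) (v2 / 2) +
  contour n G (p + v2 / 2) (v1 / 2) (v2 / 2) +
  contour n G (p + (v1 / 2 + v2 / 2)) (v1 / 2) (v2 / 2).
Proof.
rewrite /contour /=.
have -> : p + (v1 / 2 + v2 / 2) + v1 / 2 = p + v1 + v2 / 2 by field.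
have -> : p + (v1 / 2 + v2 / 2) + v2 / 2 = p + v2 + v1 / 2 by field.
have -> : p + (v1 / 2 + v2 / 2) = p + v1 / 2 + v2 / 2 by ring.
have -> : p + v1 / 2 + v1 / 2 = p + v1 by field.
have -> : p + v2 / 2 + v2 / 2 = p + v2 by field.
have -> : p + v2 / 2 + v1 / 2 = p + v1 / 2 + v2 / 2 by ring.
ring.
Qed.

(** The bound is proportional to the area [h ^+ 2] of a cell, hence additive under subdivision; on
    small cells it comes from removing the tangent affine function. *)
Lemma goursat G p v1 v2 :
  (forall s t : R, 0 <= s <= 1 -> 0 <= t <= 1 ->
     exists d, has_deriv G (p + s%:C * v1 + t%:C * v2) d) ->
  forall e : R, 0 < e -> exists D, forall n, (D <= n)%N ->
    nm (contour n G p v1 v2) <= e.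
Proof.
move=> hG e e0.
pose P (q : C) (h : R) := exists D, forall n, (D <= n)%N ->
  nm (contour n G q (h%:C * v1) (h%:C * v2)) <= e * h ^+ 2.
suff : P p 1.
  by move=> [D hD]; exists D => n /hD; rewrite rc1 !mul1r expr1n mulr1.
have two : (2 : C) = (2 : R)%:C by rewrite rcn.
apply: (@cousin _ p v1 v2 P).
  move=> q h h0 [D1 h1] [D2 h2] [D3 h3] [D4 h4].
  (* The successor pays for the level used up by [contour_split]. *)
  exists (maxn (maxn D1 D2) (maxn D3 D4)).+1 => -[//|n]; rewrite ltnS !geq_max.
  move=> /andP[/andP[n1 n2] /andP[n3 n4]]; rewrite contour_split.
  have E v : h%:C * v / 2 = (h / 2)%:C * v by rewrite rcM rcV -two; ring.
  rewrite !E -mulrDr.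
  set T := e * (h / 2) ^+ 2 in h1 h2 h3 h4.
  have -> : e * h ^+ 2 = T + T + T + T by rewrite /T; field.
  apply: le_trans (nmD _ _) (lerD _ (h4 _ n4)).
  apply: le_trans (nmD _ _) (lerD _ (h3 _ n3)).
  exact: le_trans (nmD _ _) (lerD (h1 _ n1) (h2 _ n2)).
move=> s t s01 t01; have [d has_deriv] := hG _ _ s01 t01.
set w := p + s%:C * v1 + t%:C * v2 in has_deriv *.
set L := nm v1 + nm v2.
have L0 : 0 <= L by rewrite addr_ge0 ?nm_ge0.
(* Points of a cell lie within [2 * h * L] of the tag [w] and the perimeter is [2 * h * L], so the
   remainder contributes [4 * L ^+ 2 * e1 * h ^+ 2]; the summand 1 covers [L = 0]. *)
pose e1 := e / (4 * L ^+ 2 + 1).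
have D0 : 0 < 4 * L ^+ 2 + 1 by have := sqr_ge0 L; lra.
have e10 : 0 < e1 by rewrite divr_gt0.
have e1E : 4 * L ^+ 2 * e1 <= e.
  have : (4 * L ^+ 2 + 1) * e1 = e by rewrite mulrC divfK // gt_eqF.
  lra.
have [del del0 hdel] := has_deriv _ e10.
exists (del / (2 * L + 1)); first by rewrite divr_gt0 //; lra.
move=> q h /andP[h0]; rewrite ltr_pdivlMr; last by lra.
move=> hdl qw; exists 0%N => n _.
pose E z := G z + (d * w - G w + - d * z).
have GE : G = fun z => (G w - d * w + d * z) + E z.
  by apply/funext => z; rewrite /E; ring.
have Eb z : nm (z - w) <= 2 * h * L -> nm (E z) <= e1 * (2 * h * L).
  move=> zw; have -> : E z = G (w + (z - w)) - G w - (z - w) * d.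
    by rewrite [w + _]addrC subrK /E; ring.
  apply: le_trans (hdel _ _) _; last by rewrite ler_wpM2l // ltW.
  by apply: le_lt_trans zw _; nra.
have Jn v : contour n (fun z => (G w - d * w + d * z) + E z) q (h%:C * v1) (h%:C * v2) =
   contour n E q (h%:C * v1) (h%:C * v2).
  by rewrite /contour !(midsumD n (fun z => G w - d * w + d * z) E) !midsum_affine; field.
rewrite {1}GE Jn // /contour.
have cell a b : 0 <= a <= 1 -> 0 <= b <= 1 ->
    nm (q + a%:C * (h%:C * v1) + b%:C * (h%:C * v2) - w) <= 2 * h * L.
  move=> /andP[a0 a1] /andP[b0 b1].
  have -> : q + a%:C * (h%:C * v1) + b%:C * (h%:C * v2) - w =
    (q - w) + (a%:C * (h%:C * v1) + b%:C * (h%:C * v2)) by ring.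
  have := nmD (q - w) (a%:C * (h%:C * v1) + b%:C * (h%:C * v2)).
  have := nmD (a%:C * (h%:C * v1)) (b%:C * (h%:C * v2)).
  rewrite !nmM !nm_rc (ger0_norm a0) (ger0_norm b0) (gtr0_norm h0).
  have : a * (h * nm v1) <= h * nm v1 by rewrite ler_piMl // mulr_ge0 ?nm_ge0 // ltW.
  have : b * (h * nm v2) <= h * nm v2 by rewrite ler_piMl // mulr_ge0 ?nm_ge0 // ltW.
  move: qw; rewrite /L; lra.
have nh v : nm (h%:C * v) = h * nm v by rewrite nmM nm_rc gtr0_norm.
have z01 : (0 : R) <= (0 : R) <= (1 : R) by lra.
have o01 : (0 : R) <= (1 : R) <= (1 : R) by lra.
have B1 : nm (midsum n E q (h%:C * v1)) <= h * nm v1 * (e1 * (2 * h * L)).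
  rewrite -nh; apply: midsum_bound => a a01; apply: Eb.
  by have := cell _ _ a01 z01; rewrite rc0 mul0r addr0.
have B2 : nm (midsum n E (q + h%:C * v1) (h%:C * v2)) <= h * nm v2 * (e1 * (2 * h * L)).
  rewrite -nh; apply: midsum_bound => a a01; apply: Eb.
  by have := cell _ _ o01 a01; rewrite rc1 mul1r.
have B3 : nm (midsum n E (q + h%:C * v2) (h%:C * v1)) <= h * nm v1 * (e1 * (2 * h * L)).
  rewrite -nh; apply: midsum_bound => a a01; apply: Eb.
  by rewrite [_ + h%:C * v2 + _]addrAC; have := cell _ _ a01 o01; rewrite rc1 mul1r.
have B4 : nm (midsum n E q (h%:C * v2)) <= h * nm v2 * (e1 * (2 * h * L)).
  rewrite -nh; apply: midsum_bound => a a01; apply: Eb.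
  by have := cell _ _ z01 a01; rewrite rc0 mul0r addr0.
apply: (@le_trans _ _ (4 * L ^+ 2 * e1 * h ^+ 2)); last by rewrite ler_wpM2r // sqr_ge0.
have -> : 4 * L ^+ 2 * e1 * h ^+ 2 = h * nm v1 * (e1 * (2 * h * L)) +
  h * nm v2 * (e1 * (2 * h * L)) + h * nm v1 * (e1 * (2 * h * L)) +
  h * nm v2 * (e1 * (2 * h * L)) by rewrite /L; ring.
apply: le_trans (nmB _ _) (lerD _ B4).
apply: le_trans (nmB _ _) (lerD _ B3).
exact: le_trans (nmD _ _) (lerD B1 B2).
Qed.

End Goursat.

(** * Cauchy's estimates and the mean value inequality *)

Section Cauchy.
Variable R : realType.
Local Notation C := (Cplx R).
Implicit Types (a t w z : C) (f g : C -> C).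

(* In the logarithmic coordinate the two horizontal sides of the contour cancel
   by periodicity, so circle averages do not depend on the radius. *)
Lemma circle_bound g (c : C) (r s M : R) : 0 < s < r ->
  (forall t, 0 < nm t < r -> cdiff g t) ->
  (forall e : R, 0 < e -> exists2 d : R, 0 < d &
     forall t, 0 < nm t < d -> nm (g t - c) <= e) ->
  (forall t, nm t = s -> nm (g t) <= M) -> nm c <= M.
Proof.
move=> /andP[s0 sr] gd gc gM; apply/ler_addgt0Pr => e e0.
have e2 : 0 < e / 2 by lra.
have [d d0 hd0] := gc _ e2.
pose s0' := Num.min (d / 2) s.
have s00 : 0 < s0' by rewrite lt_min s0; lra.
have s0s : s0' <= s by rewrite ge_min lexx orbT.
have s0d : s0' < d by rewrite gt_min; apply/orP; left; lra.
pose G w := g (cexp w).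
pose v2 : C := 'i * (pi *+ 2)%:C.
pose p : C := (ln s0')%:C.
pose v1 : C := (ln s - ln s0')%:C.
have pv : p + v1 = (ln s)%:C by rewrite /p /v1 rcB addrC subrK.
have nv2 : nm v2 = pi *+ 2.
  by rewrite nmM nmi mul1r nm_rc ger0_norm // mulrn_wge0 // pi_ge0.
have v20 : 0 < nm v2 by rewrite nv2 mulrn_wgt0 // pi_gt0.
have nr (x : R) (b : R) : 0 < x -> nm (cexp ((ln x)%:C + b%:C * v2)) = x.
  move=> x0; rewrite nm_cexp /v2 mulrCA -rcM irc /= addr0 lnK //.
have per w : G (w + v2) = G w by rewrite /G cexpD cexp_2pi mulr1.
have hG (a b : R) : 0 <= a <= 1 -> 0 <= b <= 1 ->
    exists d, has_deriv G (p + a%:C * v1 + b%:C * v2) d.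
  move=> /andP[a0 a1] /andP[b0 b1].
  have := @gd (cexp (p + a%:C * v1 + b%:C * v2)).
  have -> : nm (cexp (p + a%:C * v1 + b%:C * v2)) = expR (ln s0' + a * (ln s - ln s0')).
    by rewrite nm_cexp /p /v1 /v2 mulrCA -!rcM irc /= addr0.
  rewrite expR_gt0 /=; set ex := expR _.
  have exs : ex <= s.
    have ls : ln s0' <= ln s by rewrite ler_ln ?posrE.
    rewrite -[leRHS](lnK (x := s)) ?posrE // ler_expR; nra.
  move=> /(_ (le_lt_trans exs sr)) /cdiff_hd h.
  by eexists; apply: has_deriv_comp h; exact: has_deriv_cexp.
have [D hD] := goursat hG (mulr_gt0 v20 e2).
have := hD D (leqnn _).
rewrite /contour (midsum_periodic D p v1 per) pv.
have -> : forall x y z : C, x + y - x - z = y - z by move=> x y z; ring.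
have B1 : nm (midsum D G (ln s)%:C v2) <= nm v2 * M.
  by apply: midsum_bound => b b01; apply: gM; rewrite nr.
have B2 : nm (midsum D (fun w => G w - c) p v2) <= nm v2 * (e / 2).
  by apply: midsum_bound => b b01; apply: hd0; rewrite nr // s00.
have E : midsum D G p v2 = midsum D (fun w => G w - c) p v2 + v2 * c.
  have -> : v2 * c = midsum D (fun w => c + 0 * w) p v2 by rewrite midsum_affine; ring.
  rewrite -midsumD; congr midsum; apply/funext => w; ring.
rewrite E; set x := midsum _ _ _ _ in B1 *; set y := midsum _ _ _ _ in B2 * => H.
have : nm (v2 * c) <= nm v2 * (M + e).
  have -> : v2 * c = x - (x - (y + v2 * c)) - y by ring.
  have -> : nm v2 * (M + e) = nm v2 * M + nm v2 * (e / 2) + nm v2 * (e / 2) by field.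
  by apply: le_trans (nmB _ _) (lerD _ B2); apply: le_trans (nmB _ _) (lerD B1 H).
by rewrite nmM ler_pM2l.
Qed.

Lemma has_deriv_shift g a t d : has_deriv g (a + t) d -> has_deriv (fun z => g (a + z)) t d.
Proof.
move=> h; rewrite -(mul1r d).
apply: (@has_deriv_comp R (fun z => a + z)) => //.
by rewrite -(add0r 1); apply: has_derivD; [exact: has_deriv_cst|exact: has_deriv_id].
Qed.

Lemma cauchy_value g a (r s M : R) : 0 < s < r ->
  (forall t, nm (t - a) < r -> cdiff g t) ->
  (forall t, nm (t - a) = s -> nm (g t) <= M) -> nm (g a) <= M.
Proof.
move=> sr gd gM; apply: (circle_bound (g := fun z => g (a + z)) sr).
- move=> t /andP[_ tr]; apply: has_deriv_cdiff; apply: has_deriv_shift; apply: cdiff_hd.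
  by apply: gd; rewrite addrC addKr.
- have /andP[s0 s1] := sr.
  have /has_deriv_cont : has_deriv g a (derive1 g a).
    by apply: cdiff_hd; apply: gd; rewrite subrr nm0; lra.
  move=> /(@cvg_nm _ _ _ _ (nbhs_filter a)) h e e0.
  have /nbhs_nm[d d0 hd0] := h _ e0; exists d => // t /andP[_ td].
  by apply: ltW; apply: hd0; rewrite addrC addKr.
- by move=> t ts; apply: gM; rewrite addrC addKr.
Qed.

(** The circle bound is applied to the difference quotient at [a], whose limit is the derivative;
    the numerator is a difference of two values of [g], whence the factor 2. *)
Lemma cauchy_deriv g a (r s M : R) : 0 < s < r ->
  (forall t, nm (t - a) < r -> cdiff g t) ->
  (forall t, nm (t - a) = s -> nm (g t) <= M) -> nm (derive1 g a) <= 2 * M / s.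
Proof.
move=> sr gd gM; have /andP[s0 s1] := sr.
have ga : nm (g a) <= M by exact: cauchy_value sr gd gM.
apply: (circle_bound (g := fun z => (g (a + z) - g a) / z) sr).
- move=> t /andP[t0 tr]; apply: has_deriv_cdiff; apply: has_derivM; last first.
    by apply: has_derivV; [exact: has_deriv_id|rewrite -nm_gt0].
  apply: has_derivB; last exact: has_deriv_cst.
  apply: has_deriv_shift; apply: cdiff_hd.
  by apply: gd; rewrite addrC addKr.
- have h : has_deriv g a (derive1 g a).
    by apply: cdiff_hd; apply: gd; rewrite subrr nm0; lra.
  move=> e e0; have [d d0 hd0] := h _ e0; exists d => // t /andP[t0 td].
  have tn : t != 0 by rewrite -nm_gt0.
  have -> : (g (a + t) - g a) / t - derive1 g a = (g (a + t) - g a - t * derive1 g a) / t.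
    by field.
  by rewrite nmM nmV ler_pdivrMr //; exact: hd0.
- move=> t ts; rewrite nmM nmV ts ler_pM2r ?invr_gt0 //.
  by have := nmB (g (a + t)) (g a); have := gM (a + t); rewrite addrC addKr => /(_ ts); lra.
Qed.

(* The constant 3 (instead of 1) comes from Cousin's lemma. *)
Lemma mean_value g a (r K : R) :
  (forall t, nm (t - a) < r -> exists2 d, has_deriv g t d & nm d <= K) ->
  forall t u, nm (t - a) < r -> nm (u - a) < r -> nm (g u - g t) <= 3 * K * nm (u - t).
Proof.
move=> gd t u ta ua; apply/ler_addgt0Pr => e0 e00.
have K0 : 0 <= K by have [d _] := gd _ ta; have := nm_ge0 d; lra.
have [->|ut] := eqVneq u t; first by rewrite !subrr !nm0 mulr0 add0r ltW.
have L0 : 0 < nm (u - t) by rewrite nm_gt0 subr_eq0.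
pose v := u - t.
pose e := e0 / (3 * nm v).
have e1 : 0 < e by rewrite divr_gt0 // mulr_gt0.
have eE : 3 * e * nm v = e0 by rewrite /e; field; rewrite gt_eqF.
pose P q (h : R) := nm (g (q + h%:C * v) - g q) <= 3 * (K + e) * (h * nm v).
suff : P t 1.
  have tv : t + v = u by rewrite /v addrC subrK.
  rewrite /P rc1 !mul1r tv -/v; lra.
(* With second side 0 the parallelogram degenerates to the segment from [t] to [u]. *)
apply: (@cousin _ t v 0 P).
  move=> q h h0 P1 P2 _ _; rewrite /P.
  apply: le_trans (nm_tri _ (g (q + (h / 2)%:C * v)) _) _.
  have -> : 3 * (K + e) * (h * nm v) =
     3 * (K + e) * (h / 2 * nm v) + 3 * (K + e) * (h / 2 * nm v) by field.
  apply: lerD P1; move: P2; rewrite /P -addrA -mulrDl -rcD.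
  by have -> : h / 2 + h / 2 = h by field.
move=> b c b01 c01.
set w := t + b%:C * v.
have wa : nm (w - a) < r.
  have -> : w - a = (1 - b)%:C * (t - a) + b%:C * (u - a).
    by rewrite /w /v rcB rc1; ring.
  apply: le_lt_trans (nmD _ _) _; rewrite !nmM !nm_rc !ger0_norm; try lra.
  pose m := Num.max (nm (t - a)) (nm (u - a)).
  have mr : m < r by rewrite gt_max ta.
  have m1 : nm (t - a) <= m by rewrite le_max lexx.
  have m2 : nm (u - a) <= m by rewrite le_max lexx orbT.
  have /andP[b0 b1] := b01.
  have b1' : 0 <= 1 - b by lra.
  by have := ler_wpM2l b0 m2; have := ler_wpM2l b1' m1; lra.
have [d dw dK] := gd _ wa.
have [del del0 hdel] := dw _ e1.
exists (del / (2 * nm v)); first by rewrite divr_gt0 // mulr_gt0.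
move=> q h /andP[h0]; rewrite ltr_pdivlMr ?mulr_gt0 // => hdl.
rewrite mulr0 addr0 nm0 addr0 -/w => qw.
(* The tag is only known to be within [h * nm v] of the end [q], so the other end may be twice as
   far; the two distances add up to the factor 3. *)
have n2 : nm (q + h%:C * v - w) <= 2 * (h * nm v).
  rewrite addrAC; apply: le_trans (nmD _ _) _; rewrite nmM nm_rc gtr0_norm //; lra.
have B x : nm (x - w) <= 2 * (h * nm v) -> nm (g x - g w) <= (K + e) * nm (x - w).
  move=> xw; have H : nm (g x - g w - (x - w) * d) <= e * nm (x - w).
    have := hdel (x - w); rewrite [w + _]addrC subrK; apply.
    by apply: le_lt_trans xw _; lra.
  have := nmD (g x - g w - (x - w) * d) ((x - w) * d); rewrite subrK nmM.
  have := ler_wpM2l (nm_ge0 (x - w)) dK; lra.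
have hv : 0 <= h * nm v by rewrite mulr_ge0 // ?nm_ge0 // ltW.
apply: le_trans (nm_tri _ (g w) _) _.
have B2 := B _ n2.
have B1 : nm (g w - g q) <= (K + e) * nm (q - w) by rewrite nmC; apply: B; lra.
have K1 : 0 <= K + e by lra.
have := ler_wpM2l K1 n2; have := ler_wpM2l K1 qw; lra.
Qed.
End Cauchy.

(** * Second-order Taylor bounds and limits of bounded sequences *)

Section Taylor2.
Variable R : realType.
Local Notation C := (Cplx R).
Implicit Types (a t w z h : C) (f g : C -> C).

(** Circles of radius [r / 4] about points of the half disc stay in the disc, which gives 2 M / (r /
    4); the mean value inequality multiplies this by 3. *)
Lemma lipschitz_bound g a (r M : R) : 0 < r ->
  (forall t, nm (t - a) < r -> cdiff g t /\ nm (g t) <= M) ->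
  forall t u, nm (t - a) < r / 2 -> nm (u - a) < r / 2 ->
  nm (derive1 g t) <= 8 * M / r /\ nm (g u - g t) <= 24 * M / r * nm (u - t).
Proof.
move=> r0 gd.
have d1 t : nm (t - a) < r / 2 -> nm (derive1 g t) <= 8 * M / r.
  move=> ta; have near u : nm (u - t) < r / 2 -> nm (u - a) < r.
    by move=> ut; have := nm_tri u t a; lra.
  have := @cauchy_deriv R g t (r / 2) (r / 4) M.
  have -> : 2 * M / (r / 4) = 8 * M / r by field; rewrite gt_eqF.
  apply; first by lra.
    by move=> u /near /gd[].
  by move=> u ut; apply: (gd _ (near _ _)).2; lra.
move=> t u ta ua; split; first exact: d1.
have -> : 24 * M / r = 3 * (8 * M / r) by field; rewrite gt_eqF.
apply: (@mean_value R g a (r / 2)) => // x xa.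
by exists (derive1 g x); [apply: cdiff_hd; apply: (gd _ _).1; lra|exact: d1].
Qed.

(** Second derivatives are avoided: the increment of g' at [a] is the derivative of g(z + h) - g(z),
    which is at most 24 M |h| / r, and Cauchy's estimate with radius [r / 8] gives the constant 384.
    The mean value inequality on the disc of radius 2 |h| then gives 3 * 2 * 384 = 2304. *)
Lemma taylor2 g a (r M : R) : 0 < r ->
  (forall t, nm (t - a) < r -> cdiff g t /\ nm (g t) <= M) ->
  forall h, nm h <= r / 8 ->
  nm (g (a + h) - g a - h * derive1 g a) <= 2304 * M / r ^+ 2 * nm h ^+ 2.
Proof.
move=> r0 gd.
have M0 : 0 <= M.
  have : nm (a - a) < r by rewrite subrr nm0.
  by move=> /gd[_]; exact/le_trans/nm_ge0.
have aa : nm (a - a) < r / 2 by rewrite subrr nm0; lra.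
have d2 h : nm h < r / 4 -> nm (derive1 g (a + h) - derive1 g a) <= 384 * M / r ^+ 2 * nm h.
  move=> hr; pose f z := g (z + h) - g z.
  have near z : nm (z - a) < r / 4 -> nm (z + h - a) < r / 2 /\ nm (z - a) < r / 2.
    move=> za; split; last by lra.
    by rewrite addrAC; have := nmD (z - a) h; lra.
  have fd z : nm (z - a) < r / 4 -> has_deriv f z (derive1 g (z + h) - derive1 g z).
    move=> /near[z1 z2]; apply: has_derivB; last by apply: cdiff_hd; apply: (gd _ _).1; lra.
    have -> : (fun x => g (x + h)) = (fun x => g (h + x)).
      by apply/funext => x; rewrite addrC.
    by apply: has_deriv_shift; rewrite addrC; apply: cdiff_hd; apply: (gd _ _).1; lra.
  have fa : nm (a - a) < r / 4 by rewrite subrr nm0; lra.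
  rewrite -(has_deriv_derive1 (fd _ fa)).
  have -> : 384 * M / r ^+ 2 * nm h = 2 * (24 * M / r * nm h) / (r / 8).
    by field; rewrite gt_eqF.
  apply: (@cauchy_deriv R f a (r / 4)); first by lra.
    by move=> z /fd /has_deriv_cdiff.
  move=> z za; have za' : nm (z - a) < r / 4 by lra.
  have [n1 n2] := near _ za'.
  have [_] := lipschitz_bound r0 gd n2 n1.
  by rewrite /f [z + h - z]addrAC subrr add0r.
move=> h hr; have [->|h0] := eqVneq h 0.
  by rewrite addr0 subrr mul0r subr0 !nm0 expr0n mulr0.
have n0 : 0 < nm h by rewrite nm_gt0.
pose f z := g z - z * derive1 g a.
have -> : g (a + h) - g a - h * derive1 g a = f (a + h) - f a by rewrite /f; ring.
have -> : 2304 * M / r ^+ 2 * nm h ^+ 2 =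
    3 * (384 * M / r ^+ 2 * (2 * nm h)) * nm (a + h - a).
  by rewrite [a + h]addrC addrK; field; rewrite gt_eqF.
apply: (@mean_value R f a (2 * nm h)).
- move=> t ta; exists (derive1 g t - derive1 g a).
    apply: has_derivB; first by apply: cdiff_hd; apply: (gd _ _).1; lra.
    by have := has_derivM (has_deriv_id t) (has_deriv_cst (derive1 g a) t); rewrite mul1r mulr0 addr0.
  have := d2 (t - a); rewrite [a + _]addrC subrK => h2.
  apply: le_trans (h2 _) _; first by lra.
  apply: ler_wpM2l; last by lra.
  apply: divr_ge0; last exact: sqr_ge0.
  by apply: mulr_ge0 M0; exact: ler0n.
- by rewrite subrr nm0; lra.
- by rewrite [a + h]addrC addrK; lra.
Qed.

(* Only pointwise convergence is needed: the remainder estimate of [taylor2] is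
   uniform in the index, so the derivatives form a Cauchy family. *)
Lemma bounded_limit (f : nat -> C -> C) (g : C -> C) a (r M : R) : 0 < r ->
  (\forall i \near \oo, forall t, nm (t - a) < r -> cdiff (f i) t /\ nm (f i t) <= M) ->
  (forall t, nm (t - a) < r -> f i t @[i --> \oo] --> g t) ->
  exists2 d, has_deriv g a d & derive1 (f i) a @[i --> \oo] --> d.
Proof.
move=> r0 fd fg.
pose K := 2304 * M / r ^+ 2.
have fT : \forall i \near \oo, forall h, nm h <= r / 8 ->
   nm (f i (a + h) - f i a - h * derive1 (f i) a) <= K * nm h ^+ 2.
  by near=> i; apply: taylor2 => //; near: i.
have K0 : 0 <= K.
  have [i _ /(_ i (leqnn i)) hi] := fd.
  have /hi[_ m0] : nm (a - a) < r by rewrite subrr nm0.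
  apply: divr_ge0; last exact: sqr_ge0.
  by apply: mulr_ge0 (le_trans (nm_ge0 _) m0); exact: ler0n.
have cv h : nm h <= r / 8 -> forall e : R, 0 < e ->
    \forall i \near \oo, nm (f i (a + h) - g (a + h)) < e /\ nm (f i a - g a) < e.
  move=> hr e e0.
  have /fg/cvg_nm/(_ e e0) c1 : nm (a + h - a) < r by rewrite addrAC subrr add0r; lra.
  have /fg/cvg_nm/(_ e e0) c2 : nm (a - a) < r by rewrite subrr nm0.
  by near=> i; split; near: i.
have [|d hd0] := @nm_complete R _ \oo _ (fun i => derive1 (f i) a).
  (* For this fixed [h] the remainder is at most [e * h / 4], and the difference quotients of [f i]
     tend to that of [g], so eventually the derivatives lie within [e] of one number. *)
  move=> e e0; pose h : R := Num.min (r / 8) (e / (4 * (K + 1))).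
  have h0 : 0 < h by rewrite lt_min !divr_gt0 // mulr_gt0 //; lra.
  have hr : h <= r / 8 by rewrite ge_min lexx.
  have hK : h * (4 * (K + 1)) <= e by rewrite -ler_pdivlMr ?ge_min ?lexx ?orbT // mulr_gt0 //; lra.
  have nh : nm (h%:C : C) = h by rewrite nm_rc gtr0_norm.
  have hn0 : h%:C != 0 :> C by rewrite -nm_gt0 nh.
  exists ((g (a + h%:C) - g a) / h%:C).
  have eh : 0 < e * h / 4 by rewrite divr_gt0 // mulr_gt0.
  near=> i.
  have H1 : nm (f i (a + h%:C) - f i a - h%:C * derive1 (f i) a) <= K * h ^+ 2.
    by near: i; apply: filterS fT => j; rewrite -{3}nh; apply; rewrite nh.
  have [H2 H3] : nm (f i (a + h%:C) - g (a + h%:C)) < e * h / 4 /\ nm (f i a - g a) < e * h / 4.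
    by near: i; apply: cv => //; rewrite nh.
  rewrite -(ltr_pM2l h0) -{1}nh -nmM.
  set A := f i _ in H1 H2; set B := f i a in H1 H3; set D := derive1 _ _ in H1 *.
  have -> : h%:C * (D - (g (a + h%:C) - g a) / h%:C) =
     (A - g (a + h%:C)) - (B - g a) - (A - B - h%:C * D) by field.
  have := nmB ((A - g (a + h%:C)) - (B - g a)) (A - B - h%:C * D).
  have := nmB (A - g (a + h%:C)) (B - g a).
  nra.
exists d => //; move: hd0 => /cvg_nm hd0.
have gT h : nm h <= r / 8 -> nm (g (a + h) - g a - h * d) <= K * nm h ^+ 2.
  move=> hr; apply/ler_addgt0Pr => e e0.
  pose e1 := e / (2 + nm h).
  have D0 : 0 < 2 + nm h by have := nm_ge0 h; lra.
  have e10 : 0 < e1 by rewrite divr_gt0.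
  have e1E : e1 * (2 + nm h) = e by rewrite divfK // gt_eqF.
  near \oo => i.
  have [H2 H3] : nm (f i (a + h) - g (a + h)) < e1 /\ nm (f i a - g a) < e1.
    by near: i; apply: cv.
  have H4 : nm (derive1 (f i) a - d) < e1 by near: i; exact: hd0.
  have H1 : nm (f i (a + h) - f i a - h * derive1 (f i) a) <= K * nm h ^+ 2.
    by near: i; apply: filterS fT => j; exact.
  move: H1 H2 H3 H4; set A := f i _; set B := f i a; set D := derive1 _ _ => H1 H2 H3 H4.
  have -> : g (a + h) - g a - h * d =
     (A - B - h * D) + (h * (D - d) - ((A - g (a + h)) - (B - g a))) by ring.
  have := nmD (A - B - h * D) (h * (D - d) - ((A - g (a + h)) - (B - g a))).
  have := nmB (h * (D - d)) ((A - g (a + h)) - (B - g a)).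
  have := nmB (A - g (a + h)) (B - g a).
  rewrite nmM; have := ler_wpM2l (nm_ge0 h) (ltW H4); lra.
move=> e e0; exists (Num.min (r / 8) (e / (K + 1))).
  by rewrite lt_min !divr_gt0 //; lra.
move=> h; rewrite lt_min => /andP[h1]; rewrite ltr_pdivlMr; last by lra.
move=> h2; apply: le_trans (gT _ (ltW h1)) _.
by rewrite expr2 mulrA ler_wpM2r ?nm_ge0 //; have := nm_ge0 h; nra.
Unshelve. all: by end_near. Qed.
End Taylor2.

(** * Functions holomorphic along curves *)

Section CurveHolo.
Variable R : realType.
Local Notation C := (Cplx R).
Variable V : normedModType C.
Implicit Types (U : set V) (G : V -> C) (z v w : V).

Definition nopen U := forall z, U z -> exists2 r : R, 0 < r &
  forall z', nm (z' - z) < r -> U z'.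

(* Holomorphy tested on holomorphic curves; unlike Frechet differentiability it
   passes at once to locally bounded pointwise limits. *)
Definition curve_holo U G :=
  (forall z, U z -> exists r M : R, 0 < r /\
     forall z', nm (z' - z) < r -> nm (G z') <= M) /\
  (forall (gam : C -> V) a (r : R), 0 < r ->
     (forall t, nm (t - a) < r -> differentiable gam t) ->
     U (gam a) -> cdiff (fun t => G (gam t)) a).

Lemma differentiable_line z v (t : C) : differentiable (fun x : C => z + x *: v) t.
Proof.
apply: differentiableD; first exact: differentiable_cst.
by apply: differentiableZl; by apply/derivable1_diffP; exact: derivable_id.
Qed.

Lemma derive_line G z v : 'D_v G z = derive1 (fun t : C => G (z + t *: v)) 0.
Proof.
rewrite derive1E /derive.
set f := fun h => _; set g := fun h => _.
suff -> : f = g by [].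
apply/funext => h; rewrite /f /g /=.
have e : h *: (1 : C) = h by rewrite /GRing.scale /= mulr1.
by rewrite e scale0r !addr0 [h *: v + z]addrC.
Qed.

Lemma curve_holo_line U G z v (t : C) : curve_holo U G -> U (z + t *: v) ->
  has_deriv (fun x : C => G (z + x *: v)) t ('D_v G (z + t *: v)).
Proof.
move=> [_ Gc] Uz.
have h : cdiff (fun x : C => G (z + x *: v)) t.
  by apply: (Gc (fun x => z + x *: v) t 1) => // x _; exact: differentiable_line.
apply: has_deriv_ext (cdiff_hd h).
have := @has_deriv_shift R (fun x : C => G (z + x *: v)) t 0 _ _.
rewrite addr0 => /(_ _ (cdiff_hd h)) /has_deriv_derive1 <-.
rewrite derive_line; apply: (congr1 (fun f => derive1 f 0)); apply/funext => x.
by rewrite scalerDl addrA.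
Qed.

Lemma curve_holo_frechet U G : nopen U -> (forall z, U z -> differentiable G z) ->
  curve_holo U G.
Proof.
move=> Uo Gd; split=> [z Uz|gam a r r0 gd Ua].
  have /differentiable_continuous/(@cvg_nm _ _ _ _ (nbhs_filter z))/(_ 1 ltr01) := Gd _ Uz.
  move=> /nbhs_nm[r r0 hr]; exists r, (nm (G z) + 1); split=> // z' /hr h.
  by have := nm_sub (G z') (G z); lra.
apply/derivable1_diffP; apply: differentiable_comp; last exact: Gd.
by apply: gd; rewrite subrr nm0.
Qed.

(** Cauchy's estimate on the complex line through [z'] in direction [v]; the parameter circle has
    radius [s / 2], whence the constant 4. *)
Lemma derive_bound U G z v z' (r M s : R) : curve_holo U G -> 0 < s ->
  (forall x, nm (x - z) < r -> U x /\ nm (G x) <= M) ->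
  nm (z' - z) + s * nm v < r -> nm ('D_v G z') <= 4 * M / s.
Proof.
move=> Gh s0 hM zs; rewrite derive_line.
have near (t : C) : nm (t - 0) < s -> nm (z' + t *: v - z) < r.
  rewrite subr0 => ts; rewrite addrAC; apply: le_lt_trans (nmD _ _) _; rewrite nmZ.
  by have : nm t * nm v <= s * nm v; [rewrite ler_wpM2r ?nm_ge0 // ltW|lra].
have -> : 4 * M / s = 2 * M / (s / 2) by field; rewrite gt_eqF.
apply: (@cauchy_deriv R _ 0 s); first by lra.
  move=> t /near/hM[Ut _]; exact: has_deriv_cdiff (curve_holo_line Gh Ut).
by move=> t ts; apply: (hM _ (near _ _)).2; lra.
Qed.
End CurveHolo.

(** * Directional derivatives stay holomorphic and commute *)

Section CurveHoloDerive.
Variable R : realType.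
Local Notation C := (Cplx R).
Variable V : normedModType C.
Implicit Types (U : set V) (G : V -> C) (z v w : V).

(** A fixed null sequence of increments: it makes directional derivatives limits of sequences, the
    form required by [bounded_limit]. *)
Let zeta (k : nat) : C := (k.+1%:R^-1 : R)%:C.

Let zeta_gt0 k : 0 < nm (zeta k).
Proof. by rewrite nm_rc gtr0_norm // invr_gt0. Qed.

Let zeta_neq0 k : zeta k != 0.
Proof. by rewrite -nm_gt0 zeta_gt0. Qed.

Let zeta_small (d : R) : 0 < d -> \forall k \near \oo, nm (zeta k) < d.
Proof.
move=> d0; have /cvgrPdist_lt/(_ _ d0) := @cvg_harmonic R.
by apply: filterS => k; rewrite sub0r normrN nm_rc.
Qed.

Let diff_quot_cvg G z v d : has_deriv (fun x : C => G (z + x *: v)) 0 d ->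
  (G (z + zeta k *: v) - G z) / zeta k @[k --> \oo] --> d.
Proof.
move=> h; apply/cvg_nm => e e0; have e2 : 0 < e / 2 by lra.
have [del del0 hdel] := h _ e2.
near=> k; have kd : nm (zeta k) < del by near: k; exact: zeta_small.
have := hdel _ kd; rewrite add0r scale0r addr0 => H.
have -> : (G (z + zeta k *: v) - G z) / zeta k - d =
   (G (z + zeta k *: v) - G z - zeta k * d) / zeta k.
  by have := zeta_neq0 k; move: (zeta k) => x x0; field.
rewrite nmM nmV ltr_pdivrMr ?zeta_gt0 //; have := zeta_gt0 k.
by move=> ?; apply: le_lt_trans H _; rewrite ltr_pM2r //; lra.
Unshelve. all: by end_near. Qed.

(** Along the curve the difference quotients of [G] in direction [v] are bounded by the mean value
    inequality, so [bounded_limit] applies to them. The convergence of their derivatives is kept as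
    a second conclusion for [deriveC]. *)
Lemma derive_curve U G v (gam : C -> V) a (r : R) : nopen U -> curve_holo U G ->
  0 < r -> (forall t, nm (t - a) < r -> differentiable gam t) -> U (gam a) ->
  exists2 d, has_deriv (fun t => 'D_v G (gam t)) a d &
    derive1 (fun t => (G (gam t + zeta k *: v) - G (gam t)) / zeta k) a @[k --> \oo] --> d.
Proof.
move=> Uo Gh r0 gd Ua.
have [r1 r10 U1] := Uo _ Ua; have [r2 [M [r20 GM]]] := Gh.1 _ Ua.
pose rho := Num.min r1 r2.
have rho0 : 0 < rho by rewrite lt_min r10.
have {U1 GM} hM x : nm (x - gam a) < rho -> U x /\ nm (G x) <= M.
  by rewrite lt_min => /andP[x1 x2]; split; [exact: U1|exact: GM].
have gc : {for a, continuous gam}.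
  by apply: differentiable_continuous; apply: gd; rewrite subrr nm0.
have rho4 : 0 < rho / 4 by lra.
have /nbhs_nm[r3 r30 hr3] := (@cvg_nm _ _ _ _ (nbhs_filter a) _ _).1 gc _ rho4.
pose s := Num.min r r3.
have s0 : 0 < s by rewrite lt_min r0.
have gs t : nm (t - a) < s -> differentiable gam t /\ nm (gam t - gam a) < rho / 4.
  by rewrite lt_min => /andP[t1 t2]; split; [exact: gd|exact: hr3].
(* Shifting by [x *: v] with [nm x < s1] moves a point by less than [rho / 4]; with the variation of
   [gam] this stays within [rho / 2], leaving room for [derive_bound]. *)
pose s1 := rho / 4 / (nm v + 1).
have nv := nm_ge0 v.
have s10 : 0 < s1 by rewrite divr_gt0 //; lra.
have s1v : s1 * nm v < rho / 4.
  have : s1 * (nm v + 1) = rho / 4 by rewrite divfK // gt_eqF //; lra.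
  lra.
have near (x t : C) : nm (t - a) < s -> nm x < s1 -> nm (gam t + x *: v - gam a) < rho / 2.
  move=> /gs[_ t1] xs; rewrite addrAC; apply: le_lt_trans (nmD _ _) _; rewrite nmZ.
  by have : nm x * nm v <= s1 * nm v; [rewrite ler_wpM2r // ltW|lra].
apply: (@bounded_limit R (fun k t => (G (gam t + zeta k *: v) - G (gam t)) / zeta k)
  (fun t => 'D_v G (gam t)) a s (3 * (4 * M / s1))) => //; last first.
  move=> t ts; apply: diff_quot_cvg.
  have Ut : U (gam t + 0 *: v).
    by rewrite scale0r addr0; apply: (hM _ _).1; have [_] := gs _ ts; lra.
  by have := curve_holo_line Gh Ut; rewrite scale0r addr0.
near=> k => t ts.
have ks : nm (zeta k) < s1 by near: k; exact: zeta_small.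
have z0 : nm (0 : C) < s1 by rewrite nm0.
have Gd (x : C) : nm x < s1 -> cdiff (fun t => G (gam t + x *: v)) t.
  move=> xs; apply: (Gh.2 (fun t => gam t + x *: v) t (s - nm (t - a))).
  - lra.
  - move=> u ut; apply: differentiableD; last exact: differentiable_cst.
    by apply: (gs _ _).1; have := nm_tri u t a; lra.
  - by apply: (hM _ _).1; have := near _ _ ts xs; lra.
split.
  apply: has_deriv_cdiff; apply: has_derivM; last exact: has_deriv_cst.
  apply: has_derivB; first exact: cdiff_hd (Gd _ ks).
  have := Gd _ z0; rewrite (_ : (fun t => _) = (fun t => G (gam t))); last first.
    by apply/funext => u; rewrite scale0r addr0.
  exact: cdiff_hd.
rewrite nmM nmV ler_pdivrMr ?zeta_gt0 //.
have := @mean_value R (fun x : C => G (gam t + x *: v)) 0 s1 (4 * M / s1) _ 0 (zeta k).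
rewrite !subr0 scale0r addr0; apply => //.
move=> x; rewrite subr0 => xs.
have Ux : U (gam t + x *: v) by apply: (hM _ _).1; have := near _ _ ts xs; lra.
exists ('D_v G (gam t + x *: v)); first exact: curve_holo_line Gh Ux.
apply: (derive_bound (z := gam a) (r := rho) Gh) => //.
by have := near _ _ ts xs; lra.
Unshelve. all: by end_near. Qed.

Lemma curve_holo_derive U G v : nopen U -> curve_holo U G -> curve_holo U ('D_v G).
Proof.
move=> Uo Gh; split=> [z Uz|gam a r r0 gd Ua]; last first.
  by have [d /has_deriv_cdiff] := derive_curve v Uo Gh r0 gd Ua.
have [r1 r10 U1] := Uo _ Uz; have [r2 [M [r20 GM]]] := Gh.1 _ Uz.
pose rho := Num.min r1 r2.
have rho0 : 0 < rho by rewrite lt_min r10.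
have hM x : nm (x - z) < rho -> U x /\ nm (G x) <= M.
  by rewrite lt_min => /andP[x1 x2]; split; [exact: U1|exact: GM].
have nv := nm_ge0 v.
pose s := rho / 2 / (nm v + 1).
have s0 : 0 < s by rewrite divr_gt0 //; lra.
have sE : s * (nm v + 1) = rho / 2 by rewrite divfK // gt_eqF //; lra.
exists (rho / 2), (4 * M / s); split; first by lra.
move=> z' zz; apply: (derive_bound Gh s0 hM).
by move: zz sE s0; rewrite mulrDr mulr1; move: (s * nm v) => sv; lra.
Qed.

(** By [derive_curve], the derivative of 'D_v G in direction [w] is the limit of the [w]-derivatives
    of difference quotients. These are difference quotients of 'D_w G, whose limit is the other
    mixed derivative. *)
Lemma deriveC U G v w z : nopen U -> curve_holo U G -> U z ->
  'D_w ('D_v G) z = 'D_v ('D_w G) z.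
Proof.
move=> Uo Gh Uz.
have Uz0 : U (z + 0 *: w) by rewrite scale0r addr0.
have Uz0' : U (z + 0 *: v) by rewrite scale0r addr0.
have [d d1 d2] := @derive_curve U G v (fun x => z + x *: w) 0 1 Uo Gh ltr01
  (fun t _ => differentiable_line _ _ _) Uz0.
have dE : 'D_w ('D_v G) z = d.
  by rewrite (derive_line ('D_v G) z w); exact: has_deriv_derive1 d1.
apply: (etrans dE).
have h0 : has_deriv (fun x : C => 'D_w G (z + x *: v)) 0 ('D_v ('D_w G) z).
  apply: has_deriv_ext (curve_holo_line (curve_holo_derive w Uo Gh) Uz0').
  by congr ('D_v _ _); rewrite scale0r addr0.
have h := @diff_quot_cvg ('D_w G) z v _ h0.
suff d3 : derive1 (fun t => (G (z + t *: w + zeta k *: v) - G (z + t *: w)) / zeta k) 0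
    @[k --> \oo] --> 'D_v ('D_w G) z.
  exact: (cvg_unique (@norm_hausdorff _ _) d2 d3).
apply: cvg_trans h; apply: near_eq_cvg.
have [r1 r10 U1] := Uo _ Uz.
near=> k.
have Uk : U (z + zeta k *: v + 0 *: w).
  rewrite scale0r addr0; apply: U1; rewrite addrAC subrr add0r nmZ.
  have kd : nm (zeta k) < r1 / (nm v + 1).
    near: k; apply: zeta_small; rewrite divr_gt0 //; have := nm_ge0 v; lra.
  move: kd; rewrite ltr_pdivlMr; last by have := nm_ge0 v; lra.
  by have := zeta_gt0 k; nra.
apply/esym/has_deriv_derive1; apply: has_deriv_ext; last first.
  apply: has_derivM; last exact: has_deriv_cst.
  apply: has_derivB; last exact: curve_holo_line Gh Uz0.
  have := curve_holo_line Gh Uk; congr has_deriv; apply/funext => x.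
  by rewrite addrAC.
by rewrite mulr0 addr0 !scale0r !addr0.
Unshelve. all: by end_near. Qed.

Lemma curve_holo_ext U G H : nopen U -> (forall z, U z -> G z = H z) ->
  forall z v, U z -> 'D_v G z = 'D_v H z.
Proof.
move=> Uo GH z v Uz; have [r r0 Ur] := Uo _ Uz.
apply: near_eq_derive; apply/nbhs_nm; exists r => // w wz; exact/GH/Ur.
Qed.

End CurveHoloDerive.

(** * One variable: division, zeros, removable singularities, power series *)

Section Disc.
Variable R : realType.
Local Notation C := (Cplx R).
Implicit Types (a t u z : C) (f g h : C -> C).

Lemma curve_holo_cdiff (U : set C) g : nopen U ->
  curve_holo U g <-> forall t, U t -> cdiff g t.
Proof.
move=> Uo; split=> [[_ gc] t Ut|gd].
  by apply: (gc (fun x => x) t 1) => // u _; apply/derivable1_diffP; exact: derivable_id.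
by apply: curve_holo_frechet => // z /gd ?; apply/derivable1_diffP.
Qed.

Lemma nopen_ball a (r : R) : nopen (fun t => nm (t - a) < r).
Proof.
move=> z za; exists (r - nm (z - a)); first by rewrite subr_gt0.
by move=> w wz; have := nm_tri w z a; lra.
Qed.

Lemma cdiff_derive1 (U : set C) g : nopen U -> (forall t, U t -> cdiff g t) ->
  forall t, U t -> cdiff (derive1 g) t.
Proof.
move=> Uo /(curve_holo_cdiff _ Uo) gh.
have -> : derive1 g = 'D_1 g by apply/funext => x; rewrite derive1E.
exact/(curve_holo_cdiff _ Uo)/curve_holo_derive.
Qed.

(** Local bounds become uniform. The predicate [V] is abstract so that the lemma also covers bounds
    on infinite families, such as all Taylor coefficients at once. *)
Lemma cousin_bound (V : C -> R -> Prop) p v1 v2 :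
  (forall z M M', M <= M' -> V z M -> V z M') ->
  (forall s t : R, 0 <= s <= 1 -> 0 <= t <= 1 -> exists d M : R, 0 < d /\
     forall z, nm (z - (p + s%:C * v1 + t%:C * v2)) < d -> V z M) ->
  exists M : R, forall s t : R, 0 <= s <= 1 -> 0 <= t <= 1 ->
     V (p + s%:C * v1 + t%:C * v2) M.
Proof.
move=> mono loc.
pose P q (h : R) := exists M : R, forall s t : R, 0 <= s <= 1 -> 0 <= t <= 1 ->
  V (q + (s * h)%:C * v1 + (t * h)%:C * v2) M.
suff [M hM] : P p 1 by exists M => s t s01 t01; have := hM _ _ s01 t01; rewrite !mulr1.
apply: (@cousin _ p v1 v2 P).
  move=> q h h0 [M1 h1] [M2 h2] [M3 h3] [M4 h4].
  pose M := Num.max (Num.max M1 M2) (Num.max M3 M4).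
  have le1 : M1 <= M by rewrite !le_max lexx.
  have le2 : M2 <= M by rewrite !le_max lexx orbT.
  have le3 : M3 <= M by rewrite !le_max lexx orbT.
  have le4 : M4 <= M by rewrite !le_max lexx !orbT.
  have twice (x : R) : x * 2 * (h / 2) = x * h by field.
  have shift (x : R) : h / 2 + (x * 2 - 1) * (h / 2) = x * h by field.
  exists M => s t s01 t01.
  have [s2|s2] := leP s (1 / 2); have [t2|t2] := leP t (1 / 2).
  - have s01' : 0 <= s * 2 <= 1 by lra.
    have t01' : 0 <= t * 2 <= 1 by lra.
    by have := mono _ _ _ le1 (h1 _ _ s01' t01'); rewrite !twice.
  - have s01' : 0 <= s * 2 <= 1 by lra.
    have t01' : 0 <= t * 2 - 1 <= 1 by lra.
    have := mono _ _ _ le3 (h3 _ _ s01' t01'); rewrite -(shift t) -(twice s) rcD.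
    by congr V; ring.
  - have s01' : 0 <= s * 2 - 1 <= 1 by lra.
    have t01' : 0 <= t * 2 <= 1 by lra.
    have := mono _ _ _ le2 (h2 _ _ s01' t01'); rewrite -(shift s) -(twice t) rcD.
    by congr V; ring.
  - have s01' : 0 <= s * 2 - 1 <= 1 by lra.
    have t01' : 0 <= t * 2 - 1 <= 1 by lra.
    have := mono _ _ _ le4 (h4 _ _ s01' t01'); rewrite -(shift s) -(shift t) !rcD.
    by congr V; ring.
move=> s t s01 t01; have [d [M [d0 hM]]] := loc _ _ s01 t01.
set L := nm v1 + nm v2.
have L0 : 0 <= L by rewrite addr_ge0 ?nm_ge0.
exists (d / (2 * L + 1)); first by rewrite divr_gt0 //; lra.
move=> q h /andP[h0]; rewrite ltr_pdivlMr; last by lra.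
move=> has_deriv qw; exists M => x y x01 y01; apply: hM.
set w := _ + _ + t%:C * v2 in qw *.
have -> : q + (x * h)%:C * v1 + (y * h)%:C * v2 - w =
   (q - w) + ((x * h)%:C * v1 + (y * h)%:C * v2) by ring.
apply: le_lt_trans (nmD _ _) _.
have := nmD ((x * h)%:C * v1) ((y * h)%:C * v2).
have xh : 0 <= x * h <= h by have /andP[? ?] := x01; rewrite mulr_ge0 ?(ltW h0) //= ger_pMl.
have yh : 0 <= y * h <= h by have /andP[? ?] := y01; rewrite mulr_ge0 ?(ltW h0) //= ger_pMl.
have /andP[xh0 xh1] := xh; have /andP[yh0 yh1] := yh.
rewrite !nmM !nm_rc (ger0_norm xh0) (ger0_norm yh0).
have := ler_wpM2r (nm_ge0 v1) xh1; have := ler_wpM2r (nm_ge0 v2) yh1.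
move: qw has_deriv; rewrite /L; lra.
Qed.

Lemma cdiff_locally_bounded g t : cdiff g t -> exists d M : R, 0 < d /\
  forall z, nm (z - t) < d -> nm (g z) <= M.
Proof.
move=> /cdiff_hd/has_deriv_cont/(@cvg_nm _ _ _ _ (nbhs_filter t))/(_ 1 ltr01).
move=> /nbhs_nm[d d0 has_deriv]; exists d, (nm (g t) + 1); split=> // z /has_deriv h.
by have := nm_sub (g z) (g t); lra.
Qed.

(** The square of side [r / 2] centred at [a] contains the disc of radius [r / 4] and lies in the
    disc of radius [r]. *)
Lemma disc_bound g a (r : R) : 0 < r ->
  (forall t, nm (t - a) < r -> cdiff g t) ->
  exists2 M : R, 0 <= M & forall t, nm (t - a) <= r / 4 -> nm (g t) <= M.
Proof.
move=> r0 gd.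
pose p : C := a - (Complex (r / 4) (r / 4)).
have pE (s t : R) : p + s%:C * (r / 2)%:C + t%:C * ('i * (r / 2)%:C) - a =
    Complex ((s - 1 / 2) * (r / 2)) ((t - 1 / 2) * (r / 2)).
  rewrite irc /p; case: (a) => x y; apply/eqP; rewrite eq_complex /=.
  by apply/andP; split; apply/eqP; field.
have inr (s t : R) : 0 <= s <= 1 -> 0 <= t <= 1 ->
    nm (p + s%:C * (r / 2)%:C + t%:C * ('i * (r / 2)%:C) - a) < r.
  move=> s01 t01; rewrite pE; apply: le_lt_trans (nm_ReIm _) _ => /=.
  have h x : 0 <= x <= 1 -> `|(x - 1 / 2) * (r / 2)| <= r / 4.
    move=> /andP[x0 x1]; rewrite ler_norml; apply/andP; split; nra.
  by have := h _ s01; have := h _ t01; lra.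
have [M hM] : exists M : R, forall s t : R, 0 <= s <= 1 -> 0 <= t <= 1 ->
    nm (g (p + s%:C * (r / 2)%:C + t%:C * ('i * (r / 2)%:C))) <= M.
  apply: (cousin_bound (V := fun z M => nm (g z) <= M)) => [z M M' MM /le_trans|s t s01 t01]; first exact.
  by apply: cdiff_locally_bounded; apply: gd; exact: inr.
have M0 : 0 <= M.
  have := hM 0 0; rewrite lexx ler01 => /(_ isT isT); exact/le_trans/nm_ge0.
exists M => // t ta.
pose x := complex.Re (t - a); pose y := complex.Im (t - a).
have xr : `|x| <= r / 4 by apply: le_trans ta; exact: nmRe.
have yr : `|y| <= r / 4 by apply: le_trans ta; exact: nmIm.
have r2 : 0 < r / 2 by lra.
have u01 (z : R) : `|z| <= r / 4 -> 0 <= z / (r / 2) + 1 / 2 <= 1.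
  rewrite ler_norml => /andP[z1 z2].
  have : z / (r / 2) <= 1 / 2 by rewrite ler_pdivrMr //; lra.
  have : - (1 / 2) <= z / (r / 2) by rewrite ler_pdivlMr //; lra.
  lra.
have := hM _ _ (u01 _ xr) (u01 _ yr); set w := p + _ + _.
suff -> : w = t by [].
apply: (addIr (- a)); rewrite /w pE !addrK !divfK ?gt_eqF //.
by rewrite /x /y; case: (t - a).
Qed.

(** Off [a] this is the quotient rule. Differentiability at [a] requires a cubic remainder for [g],
    obtained from [taylor2] applied to g'. *)
Lemma div_cdiff g a (r : R) : 0 < r -> (forall t, nm (t - a) < r -> cdiff g t) ->
  exists2 q, (forall t, nm (t - a) < r -> cdiff q t) &
    forall t, g t = g a + (t - a) * q t.
Proof.
move=> r0 gd.
have ha : nm (a - a) < r by rewrite subrr nm0.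
have g1d := cdiff_derive1 (nopen_ball (r := r)) gd.
pose q t := if t == a then derive1 g a else (g t - g a) / (t - a).
exists q; last first.
  move=> t; rewrite /q; have [->|ta] := eqVneq t a; first by rewrite subrr mul0r addr0.
  by have : t - a != 0 by [rewrite subr_eq0]; move=> h; field.
move=> t tr; have [->{t tr}|ta] := eqVneq t a; last first.
  have n0 : 0 < nm (t - a) by rewrite nm_gt0 subr_eq0.
  apply: has_deriv_cdiff; apply: (@has_deriv_near R (fun x => (g x - g a) / (x - a)) q t _ (nm (t - a))) => //.
    move=> x xt; rewrite /q; case: eqVneq => // xa.
    by move: xt; rewrite xa nmC ltxx.
  apply: has_derivM; first by apply: has_derivB; [exact: cdiff_hd (gd _ tr)|exact: has_deriv_cst].
  by apply: has_derivV; [apply: has_derivB; [exact: has_deriv_id|exact: has_deriv_cst]|rewrite subr_eq0].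
have [d [M [d0 dM]]] := cdiff_locally_bounded (g1d _ ha).
pose s := Num.min d r; have s0 : 0 < s by rewrite lt_min d0.
have bnd t : nm (t - a) < s -> cdiff (derive1 g) t /\ nm (derive1 g t) <= M.
  by rewrite lt_min => /andP[t1 t2]; split; [exact: g1d|exact: dM].
have := taylor2 s0 bnd; set K := _ / s ^+ 2; set g2 := derive1 (derive1 g) a => T; clearbody g2.
have K0 : 0 <= K.
  apply: divr_ge0; last exact: sqr_ge0.
  apply: mulr_ge0; first exact: ler0n.
  by apply: le_trans (nm_ge0 _) (bnd a _).2; rewrite subrr nm0.
(* [g] minus the nonconstant part of its quadratic Taylor polynomial: its derivative is the
   remainder bounded in [T], so its increment from [a] is of order |h|^3. *)
pose f z := g z - (z - a) * derive1 g a - (z - a) ^+ 2 * (g2 / 2).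
have fd z : nm (z - a) < r -> has_deriv f z (derive1 g z - derive1 g a - (z - a) * g2).
  move=> zr; have zd : has_deriv (fun x => x - a) z 1.
    by rewrite -(subr0 1); apply: has_derivB; [exact: has_deriv_id|exact: has_deriv_cst].
  apply: has_deriv_ext; last first.
    apply: has_derivB; [apply: has_derivB|].
    - exact: cdiff_hd (gd _ zr).
    - exact: has_derivM zd (has_deriv_cst _ _).
    - exact: has_derivM (has_derivX 2 zd) (has_deriv_cst _ _).
  by rewrite /= expr1; move: (derive1 g z) (derive1 g a) (z - a) => u v w; field.
apply: (@has_deriv_cdiff R q a (g2 / 2)) => e e0.
exists (Num.min (s / 16) (e / (12 * (K + 1)))).
  by rewrite lt_min !divr_gt0 // ?mulr_gt0 //; lra.
move=> h; rewrite lt_min => /andP[h1]; rewrite ltr_pdivlMr; last by lra.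
move=> h2; have [->|h0] := eqVneq h 0.
  by rewrite addr0 subrr mul0r subr0 !nm0 mulr0.
have n0 : 0 < nm h by rewrite nm_gt0.
have qE : q (a + h) - q a - h * (g2 / 2) = (f (a + h) - f a) / h.
  rewrite /q eqxx /f [a + h]addrC addrK subrr.
  have -> : (h + a == a) = false.
    by apply/negbTE/eqP => E; case/eqP: h0; apply: (addIr a); rewrite E add0r.
  by field.
rewrite qE nmM nmV ler_pdivrMr //.
have sr : s <= r by rewrite ge_min lexx orbT.
have := @mean_value R f a (2 * nm h) (K * (2 * nm h) ^+ 2).
have H z : nm (z - a) < 2 * nm h -> exists2 d, has_deriv f z d & nm d <= K * (2 * nm h) ^+ 2.
  move=> zh; exists (derive1 g z - derive1 g a - (z - a) * g2); first by apply: fd; lra.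
  have := T (z - a); rewrite [a + _]addrC subrK => T1.
  apply: le_trans (T1 _) _; first by lra.
  by rewrite ler_wpM2l // lerXn2r ?nnegrE ?nm_ge0 //; lra.
move=> /(_ H a (a + h)); rewrite subrr nm0 [a + h]addrC addrK => mv.
apply: le_trans (mv _ _) _; try lra.
have -> : 3 * (K * (2 * nm h) ^+ 2) * nm h = (12 * K * nm h) * (nm h * nm h) by ring.
have -> : e * nm h * nm h = e * (nm h * nm h) by ring.
rewrite ler_wpM2r ?mulr_ge0 ?(ltW n0) //; nra.
Qed.

Definition clustering_zeros g a := forall d : R, 0 < d ->
  exists2 t, 0 < nm (t - a) < d & g t = 0.

(* Dividing repeatedly by t - a multiplies the bound on the disc of radius r / 4
   by at most 96 / r each time. *)
Lemma local_identity g a (r : R) : 0 < r -> (forall t, nm (t - a) < r -> cdiff g t) ->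
  clustering_zeros g a -> forall t, nm (t - a) < r / 192 -> g t = 0.
Proof.
move=> r0 gd gz.
have [m m0 hm] := disc_bound r0 gd.
pose c := 96 / r; have c0 : 0 < c by rewrite divr_gt0.
have step l : exists f, [/\ forall t, nm (t - a) < r -> cdiff f t,
    forall t, g t = (t - a) ^+ l * f t &
    forall t, nm (t - a) <= r / 4 -> nm (f t) <= m * c ^+ l].
  elim: l => [|l [f [fd gf fm]]].
    by exists g; split=> // [t|t /hm]; rewrite expr0 ?mul1r ?mulr1.
  have [q qd fq] := div_cdiff r0 fd.
  have fa : f a = 0.
    have aa : nm (a - a) < r by rewrite subrr nm0.
    apply: nm0_eq0; apply/eqP; rewrite eq_le nm_ge0 andbT; apply/ler_addgt0Pr => e e0.
    have /(@cvg_nm _ _ _ _ (nbhs_filter a))/(_ e e0)/nbhs_nm[d d0 has_deriv] := has_deriv_cont (cdiff_hd (fd _ aa)).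
    have [t /andP[t0 td] gt] := gz _ d0.
    have ft : f t = 0.
      have := gf t; rewrite gt => /esym/eqP; rewrite mulf_eq0 expf_eq0 => /orP[/andP[_ /eqP ta]|/eqP //].
      by move: t0; rewrite ta nm0 ltxx.
    by have := has_deriv _ td; rewrite ft sub0r nmN add0r => /ltW.
  exists q; split=> // t; first by rewrite gf fq fa add0r exprSr mulrA.
  move=> tr; set B := m * c ^+ l in fm *.
  have B0 : 0 <= B by rewrite mulr_ge0 // exprn_ge0 // ltW.
  have -> : m * c ^+ l.+1 = 96 * B / r by rewrite /B /c exprS; ring.
  have r4 : 0 < r / 4 by lra.
  have fb u : nm (u - a) < r / 4 -> cdiff f u /\ nm (f u) <= B.
    by move=> ur; split; [apply: fd|apply: fm]; lra.
  have aa : nm (a - a) < r / 4 / 2 by rewrite subrr nm0; lra.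
  have [ta|ta] := eqVneq t a.
    have qa : q a = derive1 f a.
      apply/esym/has_deriv_derive1; have /qd/cdiff_hd qh : nm (a - a) < r by rewrite subrr nm0.
      have := has_derivM (_ : has_deriv (fun x => x - a) a 1) qh.
      rewrite mul1r subrr mul0r addr0 => H.
      have : has_deriv (fun x => (x - a) * q x) a (q a).
        by apply: H; rewrite -(subr0 1); apply: has_derivB; [exact: has_deriv_id|exact: has_deriv_cst].
      by congr has_deriv; apply/funext => x; rewrite [f x]fq fa add0r.
    have [+ _] := lipschitz_bound r4 fb aa aa; rewrite ta qa => h.
    apply: le_trans h _.
    have -> : 8 * B / (r / 4) = 32 * B / r by field; rewrite gt_eqF.
    by rewrite ler_pM2r ?invr_gt0 //; lra.
  have n0 : 0 < nm (t - a) by rewrite nm_gt0 subr_eq0.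
  have qE : nm (q t) = nm (f t) / nm (t - a).
    by rewrite [f t]fq fa add0r nmM mulrC mulKf // gt_eqF.
  rewrite qE ler_pdivrMr //.
  (* Inside radius [r / 8] the Lipschitz constant 24 B / (r / 4) is the source of 96; farther out,
     division by [t - a] costs at most 8 / r. *)
  have [t8|t8] := ltP (nm (t - a)) (r / 4 / 2).
    have [_ +] := lipschitz_bound r4 fb aa t8; rewrite fa subr0 => h.
    apply: le_trans h _; rewrite le_eqVlt; apply/orP; left; apply/eqP.
    by field; rewrite gt_eqF.
  apply: le_trans (fm _ tr) _.
  have -> : 96 * B / r * nm (t - a) = B * (96 * (nm (t - a) / r)) by ring.
  rewrite ler_peMr //.
  have : 1 / 8 <= nm (t - a) / r by rewrite ler_pdivlMr //; lra.
  lra.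
move=> t tr; apply: nm0_eq0; apply/eqP; rewrite eq_le nm_ge0 andbT.
apply/ler_addgt0Pr => e e0; rewrite add0r.
have tl l : nm (g t) <= m * 2^-1 ^+ l.
  have [f [_ gf fm]] := step l; rewrite gf nmM nmX.
  have h := fm t; apply: le_trans (ler_wpM2l (exprn_ge0 _ (nm_ge0 _)) (h _)) _; first by lra.
  (* The radius [r / 192] makes each division gain a factor 1/2. *)
  have tc : nm (t - a) * c <= 2^-1 by rewrite /c mulrA ler_pdivrMr //; lra.
  rewrite mulrCA -exprMn ler_wpM2l // lerXn2r // nnegrE.
    by rewrite mulr_ge0 ?nm_ge0 // ltW.
  by rewrite invr_ge0.
have : m * 2^-1 ^+ l @[l --> \oo] --> m * 0.
  by apply: cvgMr; apply: cvg_expr; rewrite ger0_norm ?invr_ge0 // invf_lt1 // ltr1n.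
rewrite mulr0 => /cvgrPdist_lt/(_ e e0)[l _ /(_ l (leqnn l))].
rewrite sub0r normrN => h; apply: le_trans (tl l) _; apply: ltW.
exact: le_lt_trans (ler_norm _) h.
Qed.

(** If zeros accumulate at 0, [g] vanishes near 0, and the vanishing spreads along the segment from
    0 to [u] in steps so short that each new centre lies inside the previous disc of zeros. *)
Lemma isolated_zero g (r : R) u : (forall t, nm t < r -> cdiff g t) ->
  nm u < r -> g u != 0 ->
  exists2 d : R, 0 < d & forall t, 0 < nm t < d -> g t != 0.
Proof.
move=> gd ur gu; apply: contrapT => H.
have gz : clustering_zeros g 0.
  move=> d d0; apply: contrapT => H1; apply: H; exists d => // t td.
  by apply/eqP => gt; apply: H1; exists t; rewrite // subr0.
(* Discs of this radius about all points of the segment stay in the domain. *)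
pose r1 := r - nm u; have r10 : 0 < r1 by rewrite subr_gt0.
have [N hN] : exists N : nat, nm u / N.+1%:R < r1 / 192.
  have := @cvg_harmonic R.
  have e0 : 0 < r1 / 192 / (nm u + 1) by rewrite !divr_gt0 //; have := nm_ge0 u; lra.
  move=> /cvgrPdist_lt/(_ _ e0)[N _ /(_ N (leqnn N))] /=.
  rewrite sub0r normrN gtr0_norm ?invr_gt0 // ltr_pdivlMr; last by have := nm_ge0 u; lra.
  move=> h; exists N; apply: le_lt_trans h; rewrite mulrC ler_wpM2l ?invr_ge0 //; lra.
pose b (j : nat) := (j%:R / N.+1%:R : R)%:C * u.
have key j : (j <= N.+1)%N -> forall t, nm (t - b j) < r1 / 192 -> g t = 0.
  elim: j => [_|j IH jN].
    have -> : b 0%N = 0 by rewrite /b !mul0r.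
    apply: local_identity => // t; rewrite subr0 => tr; apply: gd.
    by have := nm_ge0 u; rewrite /r1 in tr; lra.
  have {}IH := IH (ltnW jN).
  have bj : nm (b j.+1) <= nm u.
    rewrite /b nmM nm_rc ger0_norm; last by rewrite divr_ge0.
    by rewrite ler_piMl ?nm_ge0 // ler_pdivrMr // mul1r ler_nat.
  apply: local_identity => //.
    move=> t tb; apply: gd; have := nmD (t - b j.+1) (b j.+1); rewrite subrK.
    by rewrite /r1 in tb; lra.
  have dist : nm (b j.+1 - b j) < r1 / 192.
    rewrite /b -mulrBl -rcB nmM nm_rc -mulrBl -natrB // subSnn mul1r.
    by rewrite ger0_norm ?invr_ge0 // mulrC.
  move=> d d0.
  pose x := Num.min d (r1 / 192 - nm (b j.+1 - b j)) / 2.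
  have x0 : 0 < x by rewrite divr_gt0 // lt_min d0 subr_gt0.
  have xd : x < d.
    have : Num.min d (r1 / 192 - nm (b j.+1 - b j)) <= d by rewrite ge_min lexx.
    by rewrite /x; lra.
  have xr : x < r1 / 192 - nm (b j.+1 - b j).
    have : Num.min d (r1 / 192 - nm (b j.+1 - b j)) <= r1 / 192 - nm (b j.+1 - b j).
      by rewrite ge_min lexx orbT.
    by move: x0; rewrite /x; lra.
  exists (x%:C + b j.+1); first by rewrite addrK nm_rc gtr0_norm // x0.
  apply: IH; rewrite -addrA; apply: le_lt_trans (nmD _ _) _.
  by rewrite nm_rc gtr0_norm //; lra.
have := key N.+1 (leqnn _) u; rewrite /b divff // rc1 mul1r subrr nm0.
by move=> h; move: gu; rewrite h ?eqxx //; lra.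
Qed.

(** Induction on the pole order: boundedness of h / t^(M+1) forces h(0) = 0, and then [h] can be
    divided by [t]. *)
Lemma removable h (r B : R) (M : nat) : 0 < r -> (forall t, nm t < r -> cdiff h t) ->
  (forall t, 0 < nm t < r -> nm (h t / t ^+ M) <= B) ->
  exists2 g, (forall t, nm t < r -> cdiff g t) &
    forall t, 0 < nm t < r -> h t / t ^+ M = g t.
Proof.
move=> r0; elim: M h => [|M IH] h hd0 hB.
  by exists h => // t _; rewrite expr0 divr1.
have B0 : 0 <= B.
  by have := hB (r / 2)%:C; rewrite nm_rc gtr0_norm; [move=> /(_ _)/(le_trans (nm_ge0 _)); apply; lra|lra].
have h0 : h 0 = 0.
  apply: nm0_eq0; apply/eqP; rewrite eq_le nm_ge0 andbT; apply/ler_addgt0Pr => e e0.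
  rewrite add0r; have e2 : 0 < e / 2 by lra.
  have z0 : nm (0 : C) < r by rewrite nm0.
  have /(@cvg_nm _ _ _ _ (nbhs_filter (0 : C)))/(_ _ e2)/nbhs_nm[d d0 has_deriv] := has_deriv_cont (cdiff_hd (hd0 _ z0)).
  pose x := Num.min (Num.min (d / 2) (r / 2)) (Num.min 1 (e / (2 * (B + 1)))).
  have x0 : 0 < x by rewrite !lt_min ltr01 !divr_gt0 //; lra.
  have xd : x < d by rewrite !gt_min; apply/orP; left; apply/orP; left; lra.
  have xr : x < r by rewrite !gt_min; apply/orP; left; apply/orP; right; lra.
  have x1 : x <= 1 by rewrite !ge_min lexx !orbT.
  have xB : x * (2 * (B + 1)) <= e.
    by rewrite -ler_pdivlMr; [rewrite !ge_min lexx !orbT|lra].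
  have nx : nm (x%:C : C) = x by rewrite nm_rc gtr0_norm.
  have := has_deriv x%:C; rewrite subr0 nx => /(_ xd) h1.
  have := hB x%:C; rewrite nx x0 xr => /(_ isT); rewrite nmM nmV nmX nx.
  rewrite ler_pdivrMr ?exprn_gt0 // => h2.
  have xM : x ^+ M.+1 <= x by rewrite exprS ler_piMr ?(ltW x0) // exprn_ile1 // ltW.
  have := ler_wpM2l B0 xM => h3.
  have := nm_sub (h 0) (h x%:C); rewrite nmC in h1; lra.
have hd0' t : nm (t - 0) < r -> cdiff h t by rewrite subr0; exact: hd0.
have [q qd hq] := div_cdiff r0 hd0'.
have E t : 0 < nm t < r -> h t / t ^+ M.+1 = q t / t ^+ M.
  move=> /andP[]; rewrite nm_gt0 => t0 _; rewrite hq h0 add0r subr0 exprS.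
  by rewrite invfM mulrACA divff // mul1r.
have [|t tr|g gd gE] := IH q; first by move=> t tr; apply: qd; rewrite subr0.
  by rewrite -E // hB.
by exists g => // t tr; rewrite E // gE.
Qed.

Lemma sum_geom_le (q : R) n : 0 <= q < 1 -> \sum_(l < n) q ^+ l <= (1 - q)^-1.
Proof.
move=> /andP[q0 q1]; have h : (1 - q) * \sum_(l < n) q ^+ l = 1 - q ^+ n.
  elim: n => [|n IH]; first by rewrite big_ord0 expr0 mulr0 subrr.
  by rewrite big_ord_recr /= mulrDr IH exprS; ring.
rewrite -(ler_pM2l (_ : 0 < 1 - q)); last by lra.
by rewrite h divff ?gt_eqF ?subr_gt0 // gerBl exprn_ge0.
Qed.

(** Near [t] the partial sums are dominated by a geometric series, so [bounded_limit] applies to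
    them. *)
Lemma pseries_cdiff (a : nat -> C) (eps : R) :
  (forall t, nm t < eps -> cvgn (series (fun l => a l * t ^+ l))) ->
  forall t, nm t < eps -> cdiff (fun t => limn (series (fun l => a l * t ^+ l))) t.
Proof.
move=> acv t te.
have n0 := nm_ge0 t.
(* One third of the gap to [eps] is left for convergence at [rho], one third for the ratio [q < 1],
   one third for the disc about [t]. *)
pose d := (eps - nm t) / 3; have d0 : 0 < d by rewrite divr_gt0 // subr_gt0.
pose rho : R := nm t + 2 * d.
have rho0 : 0 < rho by rewrite /rho; lra.
have nrho : nm (rho%:C : C) = rho by rewrite nm_rc gtr0_norm.
have [A A0 hA] : exists2 A : R, 0 <= A & forall l, nm (a l) * rho ^+ l <= A.
  have : cvgn (series (fun l => a l * rho%:C ^+ l)) by apply: acv; rewrite nrho /rho /d; lra.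
  move=> /cvg_series_cvg_0/(@cvg_nm _ _ _ _ _)/(_ 1 ltr01)[L _ hL].
  exists (1 + \sum_(l < L) nm (a l) * rho ^+ l).
    by rewrite addr_ge0 // sumr_ge0 // => i _; rewrite mulr_ge0 ?nm_ge0 // exprn_ge0 // ltW.
  move=> l; have [Ll|lL] := leqP L l.
    have := hL l Ll; rewrite /= subr0 nmM nmX nrho => h; apply: le_trans (ltW h) _.
    by rewrite lerDl sumr_ge0 // => i _; rewrite mulr_ge0 ?nm_ge0 // exprn_ge0 // ltW.
  rewrite (bigD1 (Ordinal lL)) //= addrCA lerDl addr_ge0 // sumr_ge0 // => i _.
  by rewrite mulr_ge0 ?nm_ge0 // exprn_ge0 // ltW.
pose q := (nm t + d) / rho.
have q01 : 0 <= q < 1.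
  by rewrite divr_ge0 ?(ltW rho0) //= ?ltr_pdivrMr // ?mul1r /rho; lra.
have /andP[q0 q1] := q01.
have ball u : nm (u - t) < d -> nm u < eps /\ nm u <= q * rho.
  move=> ut; rewrite /q divfK ?gt_eqF //; have := nmD (u - t) t; rewrite subrK /d in ut *; lra.
suff [D hD _] : exists2 d, has_deriv (fun u => limn (series (fun l => a l * u ^+ l))) t d &
    derive1 (fun u => series (fun l => a l * u ^+ l) n) t @[n --> \oo] --> d.
  exact: has_deriv_cdiff hD.
apply: (@bounded_limit R _ _ t d (A * (1 - q)^-1) d0); last first.
  by move=> u /ball[ue _]; exact: acv.
near=> n => u /ball[_ uq]; split; last rewrite seriesEord /=.
  rewrite (_ : (fun _ => _) = fun u => \sum_(l < n) a l * u ^+ l); last first.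
    by apply/funext => x; rewrite seriesEord.
  apply: has_deriv_cdiff; apply: (@has_deriv_sum R _ _ (fun (l : 'I_n) u => a l * u ^+ l)
    (fun l : 'I_n => 0 * u ^+ l + a l * (l%:R * 1 * u ^+ l.-1))).
  by move=> l; apply: has_derivM; [exact: has_deriv_cst|apply: has_derivX; exact: has_deriv_id].
apply: le_trans (nm_sum _ _ _) _.
apply: (@le_trans _ _ (A * \sum_(l < n) q ^+ l)); last first.
  by rewrite ler_wpM2l // sum_geom_le.
rewrite mulr_sumr; apply: ler_sum => l _; rewrite nmM nmX.
apply: le_trans (ler_wpM2l (nm_ge0 _) (lerXn2r _ _ _ uq)) _; rewrite ?nnegrE ?nm_ge0 //.
  by rewrite mulr_ge0 // ltW.
rewrite exprMn mulrCA [q ^+ l * _]mulrC ler_wpM2r ?exprn_ge0 //.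
Unshelve. all: by end_near. Qed.
End Disc.

(** * Row vectors with the maximum norm *)

Section RowVectors.
Variable R : realType.
Local Notation C := (Cplx R).
Variable m : nat.
Implicit Types (z w : 'rV[C]_m).

Lemma nm_row_lt w (e : R) : 0 < e -> nm w < e <-> forall j, nm (w 0 j) < e.
Proof.
move=> e0; have e1 : 0 < e%:C :> C by rewrite -rc0 ltrc.
have -> : (nm w < e) = (`|w| < e%:C :> C) by rewrite nmE ltrc.
have bE : ball (0 : 'rV[C]_m) e%:C w <-> `|w| < e%:C.
  by rewrite -ball_normE /ball_ /= sub0r normrN.
split=> [/bE h j|h].
  have : ball ((0 : 'rV[C]_m) 0 j) e%:C (w 0 j) by have [_] := h; exact.
  by rewrite -ball_normE /ball_ /= mxE sub0r normrN nmE ltrc.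
apply/bE; split=> // i j; rewrite (ord1 i).
by rewrite -ball_normE /ball_ /= mxE sub0r normrN nmE ltrc.
Qed.

Lemma nm_coord w j : nm (w 0 j) <= nm w.
Proof.
apply/ler_addgt0Pr => e e0; apply: ltW.
have h0 : 0 < nm w + e by have := nm_ge0 w; lra.
by have /(nm_row_lt w h0)/(_ j) : nm w < nm w + e by lra.
Qed.

Lemma nm_delta (j : 'I_m) : nm (delta_mx 0 j : 'rV[C]_m) <= 1.
Proof.
apply/ler_addgt0Pr => e e0; apply: ltW; apply/nm_row_lt; first by lra.
by move=> k; rewrite mxE eqxx /=; case: eqP => _; rewrite ?nm1 ?nm0; lra.
Qed.

Lemma differentiable_row (g : 'I_m -> C -> C) t : (forall j, cdiff (g j) t) ->
  differentiable (fun x => (\row_j g j x : 'rV[C]_m)) t.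
Proof.
move=> gd.
have -> : (fun x => (\row_j g j x : 'rV[C]_m)) =
    (fun x => \sum_(j < m) g j x *: (delta_mx 0 j : 'rV[C]_m)).
  apply/funext => x; rewrite [LHS]row_sum_delta; apply: eq_bigr => j _.
  by rewrite mxE.
have -> : (fun x => \sum_(j < m) g j x *: (delta_mx 0 j : 'rV[C]_m)) =
    \sum_(j < m) (fun x => g j x *: (delta_mx 0 j : 'rV[C]_m)).
  by apply/funext => x; rewrite fct_sumE.
apply: differentiable_sum => j; apply: differentiableZl.
by apply/derivable1_diffP; exact: gd.
Qed.
End RowVectors.

(** * Mixed partial derivatives and bounds on Taylor coefficients *)

Section MixedPartials.
Variable R : realType.
Local Notation C := (Cplx R).
Variables (m : nat) (U : set 'rV[C]_m).
Hypothesis Uo : nopen U.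
Implicit Types (z w : 'rV[C]_m) (G H : 'rV[C]_m -> C) (p : 'I_m -> nat) (i j : 'I_m).

Let eqU G H := forall z, U z -> G z = H z.
Let part (s : seq 'I_m) p G := foldr (fun j => iter (p j) (partial j)) G s.

Lemma curve_holo_partial j G : curve_holo U G -> curve_holo U (partial j G).
Proof. by move=> Gh; have := curve_holo_derive (delta_mx 0 j) Uo Gh. Qed.

Let partial_ext j G H : eqU G H -> eqU (partial j G) (partial j H).
Proof. by move=> GH z Uz; have := curve_holo_ext Uo GH (delta_mx 0 j) Uz. Qed.

Let partialC i j G : curve_holo U G -> eqU (partial i (partial j G)) (partial j (partial i G)).
Proof.
by move=> Gh z Uz; have := deriveC (delta_mx 0 j) (delta_mx 0 i) Uo Gh Uz.
Qed.

Lemma curve_holo_iter j k G : curve_holo U G -> curve_holo U (iter k (partial j) G).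
Proof. by move=> Gh; elim: k => [//|k IH]; rewrite iterS; exact: curve_holo_partial. Qed.

Let part_cons j s p G : part (j :: s) p G = iter (p j) (partial j) (part s p G).
Proof. by []. Qed.

Let curve_holo_part s p G : curve_holo U G -> curve_holo U (part s p G).
Proof. by move=> Gh; elim: s => [//|j s IH]; rewrite part_cons; exact: curve_holo_iter. Qed.

Lemma curve_holo_mixed p G : curve_holo U G -> curve_holo U (mixed_partial p G).
Proof. exact: curve_holo_part. Qed.

Let iter_ext j k G H : eqU G H -> eqU (iter k (partial j) G) (iter k (partial j) H).
Proof.
by move=> GH; elim: k => [//|k IH]; rewrite !iterS; exact: partial_ext.
Qed.

Let iterC i j k G : curve_holo U G ->
  eqU (iter k (partial j) (partial i G)) (partial i (iter k (partial j) G)).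
Proof.
move=> Gh; elim: k => [//|k IH] z Uz; rewrite !iterS.
apply: (etrans (partial_ext j IH Uz)).
exact: (partialC j i (curve_holo_iter j k Gh) Uz).
Qed.

Let partC i s p G : curve_holo U G -> eqU (part s p (partial i G)) (partial i (part s p G)).
Proof.
move=> Gh; elim: s => [//|j s IH] z Uz; rewrite !part_cons.
apply: (etrans (iter_ext j (p j) IH Uz)).
exact: (iterC i j (p j) (curve_holo_part s p Gh) Uz).
Qed.

Definition addi p i : 'I_m -> nat := fun j => (p j + (j == i))%N.

(** [i] occurs exactly once in [s]: the extra derivative is taken there and commuted to the
    front. *)
Let part_addi i s p G : curve_holo U G -> uniq s -> i \in s ->
  eqU (part s (addi p i) G) (partial i (part s p G)).
Proof.
move=> Gh; elim: s => [//|j s IH]; rewrite cons_uniq => /andP[js su].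
rewrite inE => /orP[/eqP ij|is_] z Uz; rewrite !part_cons.
  have E : part s (addi p i) G = part s p G.
    move: js; rewrite -ij {IH su}; elim: s => [//|k s IH].
    rewrite !part_cons inE negb_or => /andP[ik /IH ->].
    by rewrite /addi eq_sym (negbTE ik) addn0.
  by rewrite -ij E /addi eqxx addn1 iterS.
have ji : j == i = false by apply/eqP => ji; move: js; rewrite ji is_.
have -> : addi p i j = p j by rewrite /addi ji addn0.
apply: (etrans (iter_ext j (p j) (IH su is_) Uz)).
exact: (iterC i j (p j) (curve_holo_part s p Gh) Uz).
Qed.

(** Serves to recognise the series of dF/dy_i in the linear part of the expansion of F(x, Phi). *)
Lemma taylor_coef_partial i G z p : curve_holo U G -> U z ->
  taylor_coef (partial i G) z p = (p i).+1%:R * taylor_coef G z (addi p i).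
Proof.
move=> Gh Uz; rewrite /taylor_coef /mixed_partial.
have ie : i \in enum 'I_m by rewrite mem_enum.
have E := etrans (partC i (enum 'I_m) p Gh Uz) (esym (part_addi p Gh (enum_uniq _) ie Uz)).
rewrite (_ : foldr _ (partial i G) _ z = part (enum 'I_m) (addi p i) G z); last exact: E.
have -> : (\prod_j (addi p i j)`! = (p i).+1 * \prod_j (p j)`!)%N.
  rewrite (bigD1 i) //= [X in _ = (_ * X)%N](bigD1 i) //=.
  have -> : addi p i i = (p i).+1 by rewrite /addi eqxx addn1.
  rewrite factS -mulnA; congr (_ * (_ * _))%N; apply: eq_bigr => j ji.
  by rewrite /addi (negbTE ji) addn0.
rewrite -/(part (enum 'I_m) (addi p i) G) natrM invfM.
by rewrite [X in _ = _ * X]mulrCA [RHS]mulrA divff ?mul1r // pnatr_eq0.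
Qed.

(** Each derivative shrinks the radius by [s] and costs a factor [4 / s]. *)
Lemma iter_partial_bound j k G z (r M s : R) : curve_holo U G -> 0 < s ->
  (forall x, nm (x - z) < r -> U x) ->
  (forall x, nm (x - z) < r -> nm (G x) <= M) ->
  forall x, nm (x - z) < r - k%:R * s -> nm (iter k (partial j) G x) <= M * (4 / s) ^+ k.
Proof.
move=> Gh s0 rU GM; elim: k => [|k IH] x xr.
  by rewrite expr0 mulr1; apply: GM; move: xr; rewrite mul0r subr0.
have -> : M * (4 / s) ^+ k.+1 = 4 * (M * (4 / s) ^+ k) / s by rewrite exprSr; ring.
have xr' : nm (x - z) + s < r - k%:R * s by move: xr; rewrite -natr1; lra.
have hM y : nm (y - z) < r - k%:R * s -> U y /\ nm (iter k (partial j) G y) <= M * (4 / s) ^+ k.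
  move=> yr; split; last exact: IH.
  by apply: rU; apply: lt_le_trans yr _; rewrite gerBl mulr_ge0 // ltW.
have xs : nm (x - z) + s * nm (delta_mx 0 j : 'rV[C]_m) < r - k%:R * s.
  by have := ler_wpM2l (ltW s0) (nm_delta R j); lra.
by have := derive_bound (curve_holo_iter j k Gh) s0 hM xs.
Qed.

Let part_bound t p G z (r M s : R) : curve_holo U G -> 0 < s ->
  (forall x, nm (x - z) < r -> U x) ->
  (forall x, nm (x - z) < r -> nm (G x) <= M) ->
  forall x, nm (x - z) < r - (\sum_(j <- t) p j)%:R * s ->
  nm (part t p G x) <= M * (4 / s) ^+ (\sum_(j <- t) p j).
Proof.
move=> Gh s0 rU GM; elim: t => [|j t IH] x.
  by rewrite big_nil mul0r subr0 expr0 mulr1; exact: GM.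
rewrite big_cons part_cons natrD mulrDl opprD [- _ - _]addrC addrA => xr.
rewrite addnC exprD mulrA.
have rU' y : nm (y - z) < r - (\sum_(j <- t) p j)%:R * s -> U y.
  by move=> yr; apply: rU; apply: lt_le_trans yr _; rewrite gerBl mulr_ge0 // ltW.
by have := iter_partial_bound j (curve_holo_part t p Gh) s0 rU' IH xr.
Qed.

Lemma pow_le_exp (x : R) l : 0 <= x -> x ^+ l / l`!%:R <= expR x.
Proof.
move=> x0; case: l => [|l].
  by rewrite expr0 fact0 divr1; have := expR_ge1Dx x; lra.
by have := expR_ge1Dxn l x0; lra.
Qed.

(* Cauchy's estimate for first derivatives is applied |p| times with steps
   r / (|p| + 1); the resulting (|p| + 1) ^ |p| / p! is at most
   exp (m (|p| + 1)). *)
Lemma taylor_coef_bound G z p (r M : R) : curve_holo U G -> 0 < r ->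
  (forall x, nm (x - z) < r -> U x) ->
  (forall x, nm (x - z) < r -> nm (G x) <= M) ->
  nm (taylor_coef G z p) <=
    M * expR m%:R * (4 * expR m%:R / r) ^+ (\sum_j p j).
Proof.
move=> Gh r0 rU GM; set q := (\sum_j p j)%N.
have M0 : 0 <= M by apply: le_trans (nm_ge0 _) (GM z _); rewrite subrr nm0.
pose s := r / q.+1%:R; have s0 : 0 < s by rewrite divr_gt0.
(* After [q] steps a disc of radius [s] is left, so the bound still holds at the centre. *)
have sq : q%:R * s = r - s by rewrite /s -natr1; field; rewrite natr1 pnatr_eq0.
have qE : (\sum_(j <- enum 'I_m) p j = q)%N by rewrite big_enum.
have := @part_bound (enum 'I_m) p G z r M s Gh s0 rU GM z.
rewrite qE sq subrr nm0 => /(_ _) h.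
rewrite /taylor_coef nmM nmV nm_nat.
have f0 : 0 < (\prod_j (p j)`!)%:R :> R by rewrite ltr0n prodn_gt0 // => j; rewrite fact_gt0.
rewrite ler_pdivrMr //; apply: le_trans (h _) _; first by lra.
(* Distributing the power over the variables leaves one term of the series of exp(q + 1) for each
   variable. *)
have E1 : q.+1%:R ^+ q <= expR m%:R ^+ q.+1 * (\prod_j (p j)`!)%:R :> R.
  rewrite -ler_pdivrMr //.
  have -> : q.+1%:R ^+ q / (\prod_j (p j)`!)%:R = \prod_j (q.+1%:R ^+ p j / (p j)`!%:R) :> R.
    by rewrite big_split /= prodfV -natr_prod -expr_sum.
  apply: (@le_trans _ _ (\prod_(j < m) expR (q.+1%:R : R))).
    apply: ler_prod => j _; rewrite pow_le_exp // andbT.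
    by rewrite divr_ge0 // exprn_ge0.
  by rewrite prodr_const card_ord -!expRM_natl mulrC.
rewrite /s; set e := expR _ in E1 *.
have -> : 4 / (r / q.+1%:R) = 4 / r * q.+1%:R :> R by field; rewrite gt_eqF //= pnatr_eq0.
rewrite exprMn mulrA.
have -> : M * e * (4 * e / r) ^+ q * (\prod_j (p j)`!)%:R =
   M * (4 / r) ^+ q * (e ^+ q.+1 * (\prod_j (p j)`!)%:R).
  by rewrite -[4 * e / r]mulrAC exprMn exprS; ring.
by rewrite ler_wpM2l // mulr_ge0 // exprn_ge0 // divr_ge0 // ltW.
Qed.
End MixedPartials.

(** * Substitution of power series modulo powers of the variable *)

Section TruncatedSubstitution.
Variables (K : comNzRingType) (m : nat).
Implicit Types (f g h r : {poly K}) (x y a b : 'I_m -> {poly K}) (c : ('I_m -> nat) -> K).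
Implicit Types (p : 'I_m -> nat) (k l n q L : nat).

Definition eqm n f g := exists r, f = g + r * 'X^n.

Lemma eqm_refl n f : eqm n f f.
Proof. by exists 0; rewrite mul0r addr0. Qed.

Lemma eqmM n f g f' g' : eqm n f g -> eqm n f' g' -> eqm n (f * f') (g * g').
Proof. by move=> [r ->] [s ->]; exists (r * g' + g * s + r * s * 'X^n); ring. Qed.

Lemma eqm_trans n f g h : eqm n f g -> eqm n g h -> eqm n f h.
Proof. by move=> [r ->] [s ->]; exists (r + s); ring. Qed.

Lemma eqmX n f g k : eqm n f g -> eqm n (f ^+ k) (g ^+ k).
Proof.
move=> h; elim: k => [|k IH]; first by rewrite !expr0; exact: eqm_refl.
by rewrite !exprS; exact: eqmM.
Qed.

Lemma eqm_prod n (I : Type) (s : seq I) (u v : I -> {poly K}) :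
  (forall i, eqm n (u i) (v i)) -> eqm n (\prod_(i <- s) u i) (\prod_(i <- s) v i).
Proof.
move=> h; elim: s => [|i s IH]; first by rewrite !big_nil; exact: eqm_refl.
by rewrite !big_cons; exact: eqmM.
Qed.

Lemma eqm_coef n f g l : (l < n)%N -> eqm n f g -> f`_l = g`_l.
Proof. by move=> ln [r ->]; rewrite coefD coefMXn ln addr0. Qed.

Lemma coef_eqm n f g : (forall l, (l < n)%N -> f`_l = g`_l) -> eqm n f g.
Proof.
move=> h; exists (drop_poly n f - drop_poly n g).
rewrite -{1}(poly_take_drop n f) -{1}(poly_take_drop n g) mulrBl.
have -> : take_poly n f = take_poly n g.
  by apply/polyP => i; rewrite !coef_take_poly; case: ifP => // /h.
ring.
Qed.

Lemma low_coef0 n f : (forall l, (l < n)%N -> f`_l = 0) -> exists r, f = r * 'X^n.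
Proof.
move=> h; have [|r ->] := @coef_eqm n f 0; first by move=> l /h ->; rewrite coef0.
by exists r; rewrite add0r.
Qed.

Definition monom x p := \prod_j x j ^+ p j.

Lemma monom_low x p l : (forall j, (x j)`_0 = 0) -> (l < \sum_j p j)%N ->
  (monom x p)`_l = 0.
Proof.
move=> x0 lp; have /choice[y xy] : forall j, exists r, x j = r * 'X^1.
  by move=> j; apply: low_coef0 => -[|//] _.
have -> : monom x p = (\prod_j y j ^+ p j) * 'X^(\sum_j p j).
  rewrite expr_sum -big_split /=; apply: eq_bigr => j _.
  by rewrite xy exprMn expr1.
by rewrite coefMXn lp.
Qed.

(** The sum in [fps_subst] with a free bound [L] on the exponents, independent of [k], so that
    coefficients of different orders can be compared and exponents shifted. *)
Definition subst L c x k :=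
  \sum_(p : {ffun 'I_m -> 'I_L}) c (fun j => p j) * (monom x (fun j => p j))`_k.

Lemma subst_eqm L c x y k : (forall j, eqm k.+1 (x j) (y j)) ->
  subst L c x k = subst L c y k.
Proof.
move=> xy; apply: eq_bigr => p _; congr (_ * _); apply: (@eqm_coef k.+1) => //.
by apply: eqm_prod => j; exact: eqmX.
Qed.

(** A monomial of degree above [k] in series without constant term has no coefficient of order
    [k]. *)
Lemma subst_trunc L c x k : (forall j, (x j)`_0 = 0) -> (k < L)%N ->
  subst L c x k = subst k.+1 c x k.
Proof.
move=> x0 kL; rewrite /subst.
rewrite (bigID (fun p : {ffun 'I_m -> 'I_L} => [forall j, (p j < k.+1)%N])) /=.
rewrite [X in _ + X]big1 ?addr0; last first.
  move=> p /forallPn[j]; rewrite -leqNgt => pj; rewrite monom_low ?mulr0 //.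
  by rewrite (bigD1 j) //=; exact: ltn_addr.
pose h (p : {ffun 'I_m -> 'I_k.+1}) := [ffun j => widen_ord kL (p j)] : {ffun 'I_m -> 'I_L}.
pose h' (p : {ffun 'I_m -> 'I_L}) := [ffun j => inord (p j)] : {ffun 'I_m -> 'I_k.+1}.
rewrite (reindex_onto h h') /=; last first.
  move=> p /forallP pk; apply/ffunP => j; rewrite !ffunE; apply/val_inj => /=.
  by rewrite inordK.
apply: eq_big => [p|p _].
  apply/andP; split; first by apply/forallP => j; rewrite ffunE /=.
  by apply/eqP/ffunP => j; rewrite !ffunE; apply/val_inj; rewrite /= inordK.
by congr (c _ * (monom x _)`_k); apply/funext => j; rewrite ffunE.
Qed.

(** Terms with two factors b are divisible by 'X^(k + k). The truncated [p j - 1] is harmless at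
    [p j = 0], where the factor [(p i)%:R] vanishes. *)
Lemma monom_expand k a b p : (forall j, exists r, b j = r * 'X^k) ->
  eqm (k + k) (monom (fun j => a j + b j) p)
    (monom a p + \sum_i (p i)%:R * b i * monom a (fun j => p j - (j == i))%N).
Proof.
move=> bk.
have one j n : eqm (k + k) ((a j + b j) ^+ n) (a j ^+ n + n%:R * b j * a j ^+ n.-1).
  elim: n => [|n IH]; first by rewrite !expr0 !mul0r addr0; exact: eqm_refl.
  rewrite exprS; apply: eqm_trans (eqmM (eqm_refl _ _) IH) _.
  have [r ->] := bk j; exists (n%:R * r * r * a j ^+ n.-1); rewrite exprD.
  case: n {IH} => [|n] /=; first by rewrite !expr0 expr1; ring.
  by rewrite -!natr1 !exprS; ring.
rewrite /monom; move: (index_enum_uniq 'I_m) => su.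
rewrite -[in X in eqm _ _ (_ + X)]/(index_enum 'I_m).
elim: (index_enum 'I_m) su => [_|j s IH /= /andP[js su]].
  by rewrite !big_nil addr0; exact: eqm_refl.
rewrite !big_cons; apply: eqm_trans (eqmM (one j (p j)) (IH su)) _.
have S1 : \sum_(i <- s) (p i)%:R * b i * (\prod_(j0 <- j :: s) a j0 ^+ (p j0 - (j0 == i))) =
    a j ^+ p j * \sum_(i <- s) (p i)%:R * b i * (\prod_(j0 <- s) a j0 ^+ (p j0 - (j0 == i))).
  rewrite mulr_sumr; apply: eq_big_seq => i is_; rewrite big_cons.
  have -> : (j == i) = false by apply/eqP => ji; move: js; rewrite ji is_.
  by rewrite subn0; ring.
rewrite S1.
have S2 : \prod_(j0 <- s) a j0 ^+ (p j0 - (j0 == j)) = \prod_(j0 <- s) a j0 ^+ p j0.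
  apply: eq_big_seq => i is_.
  have -> : (i == j) = false by apply/eqP => ji; move: js; rewrite -ji is_.
  by rewrite subn0.
rewrite S2 eqxx subn1; set P := \prod_(j0 <- s) _; set A := a j ^+ p j.
set Q := a j ^+ (p j).-1.
have [r bj] := bk j.
have [t St] : exists t, \sum_(i <- s) (p i)%:R * b i * (\prod_(j0 <- s) a j0 ^+ (p j0 - (j0 == i))) = t * 'X^k.
  have /choice[u bu] := bk.
  exists (\sum_(i <- s) (p i)%:R * u i * (\prod_(j0 <- s) a j0 ^+ (p j0 - (j0 == i)))).
  by rewrite mulr_suml; apply: eq_bigr => i _; rewrite bu; ring.
by rewrite St bj; exists ((p j)%:R * r * Q * t); rewrite exprD; ring.
Qed.

(** Reindexing by raising the exponent of [i]. Terms with [p i = 0] vanish on the left; those with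
    [p i = L] vanish on the right, their order being above [q]. *)
Lemma subst_shift L c x f i q : (forall j, (x j)`_0 = 0) -> (q < L)%N ->
  \sum_(p : {ffun 'I_m -> 'I_L.+1})
    c (fun j => p j) * ((p i)%:R * f * monom x (fun j => p j - (j == i))%N)`_q =
  \sum_(p : {ffun 'I_m -> 'I_L.+1})
    (p i).+1%:R * c (fun j => p j + (j == i))%N * (f * monom x (fun j => p j))`_q.
Proof.
move=> x0 qL.
rewrite (bigID (fun p : {ffun 'I_m -> 'I_L.+1} => 0 < p i)%N) /=.
rewrite [X in _ + X]big1 ?addr0; last first.
  by move=> p; rewrite lt0n negbK => /eqP ->; rewrite !mul0r coef0 mulr0.
rewrite [RHS](bigID (fun p : {ffun 'I_m -> 'I_L.+1} => p i < L)%N) /=.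
rewrite [X in _ = _ + X]big1 ?addr0; last first.
  move=> p; rewrite -leqNgt => pL; rewrite coefM big1 ?mulr0 // => l _.
  rewrite monom_low ?mulr0 // (bigD1 i) //=; apply: ltn_addr.
  by apply: leq_trans pL; rewrite (leq_ltn_trans _ qL) // leq_subr.
pose h (p : {ffun 'I_m -> 'I_L.+1}) : {ffun 'I_m -> 'I_L.+1} :=
  [ffun j => inord (p j + (j == i))].
pose h' (p : {ffun 'I_m -> 'I_L.+1}) : {ffun 'I_m -> 'I_L.+1} :=
  [ffun j => inord (p j - (j == i))].
have hE (p : {ffun 'I_m -> 'I_L.+1}) : (p i < L)%N -> forall j, h p j = (p j + (j == i))%N :> nat.
  move=> pL j; rewrite ffunE inordK //; case: eqP => [->|_]; first by rewrite addn1.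
  by rewrite addn0 ltn_ord.
have hE' (p : {ffun 'I_m -> 'I_L.+1}) j : h' p j = (p j - (j == i))%N :> nat.
  by rewrite ffunE inordK // (leq_ltn_trans (leq_subr _ _)) ?ltn_ord.
rewrite (reindex_onto h h') /=; last first.
  move=> p p0; apply/ffunP => j; apply/val_inj.
  have pL : (h' p i < L)%N.
    by rewrite hE' eqxx subn1 prednK // -ltnS ltn_ord.
  rewrite /= hE // hE'; case: eqP => [->|_]; last by rewrite subn0 addn0.
  by rewrite subn1 addn1 prednK.
apply: eq_big => [p|p].
  have [pL|pL] := ltnP (p i) L.
    rewrite hE // eqxx addn1 /=; apply/eqP/ffunP => j; apply/val_inj.
    by rewrite /= hE' hE // addnK.
  (* For [p i = L] the raised exponent is out of range and [inord] returns 0, which the condition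
     [0 < h p i] rejects. *)
  apply/negbTE; rewrite negb_and -eqn0Ngt; apply/orP; left.
  rewrite ffunE eqxx addn1 /inord /insubd insubF //=.
  by apply/negbTE; rewrite -leqNgt ltnS.
move=> /andP[hp /eqP hp'].
have pL : (p i < L)%N.
  rewrite ltnNge; apply/negP => pL; move: hp; rewrite ffunE eqxx addn1 /inord /insubd insubF //=.
  by apply/negbTE; rewrite -leqNgt ltnS.
have -> : (fun j => h p j : nat) = (fun j => p j + (j == i))%N by apply/funext => j; rewrite hE.
have -> : (fun j => h p j - (j == i))%N = (fun j => p j : nat).
  by apply/funext => j; rewrite hE // addnK.
by rewrite hE // eqxx addn1 -mulrA mulr_natl coefMn mulrnAr -mulrA mulr_natl.
Qed.

(* The part of a substitution that is linear in the terms b of order at least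
   k; its quadratic part has order at least k + k > q. *)
Lemma subst_linear L c a b k q : (forall j, (a j)`_0 = 0) ->
  (forall j l, (l < k)%N -> (b j)`_l = 0) -> (q < L)%N -> (q < k + k)%N ->
  subst L.+1 c (fun j => a j + b j) q = subst L.+1 c a q +
  \sum_i \sum_(l < (q - k).+1)
    subst L.+1 (fun p => (p i).+1%:R * c (fun j => p j + (j == i))%N) a l * (b i)`_(q - l).
Proof.
move=> a0 bk qL qk.
have bX j : exists r, b j = r * 'X^k by apply: low_coef0 => l /bk.
rewrite /subst.
have -> : \sum_(p : {ffun 'I_m -> 'I_L.+1}) c (fun j => p j) * (monom (fun j => a j + b j) (fun j => p j))`_q =
   \sum_(p : {ffun 'I_m -> 'I_L.+1}) (c (fun j => p j) * (monom a (fun j => p j))`_q +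
   \sum_i c (fun j => p j) * ((p i)%:R * b i * monom a (fun j => p j - (j == i))%N)`_q).
  apply: eq_bigr => p _.
  rewrite (eqm_coef qk (monom_expand a _ bX)) coefD mulrDr coef_sum mulr_sumr //.
rewrite big_split /=; congr (_ + _); rewrite exchange_big /=.
apply: eq_bigr => i _; rewrite subst_shift //.
transitivity (\sum_(p : {ffun 'I_m -> 'I_L.+1}) \sum_(l < q.+1)
    (p i).+1%:R * c (fun j => p j + (j == i))%N *
    ((b i)`_l * (monom a (fun j => p j))`_(q - l))).
  by apply: eq_bigr => p _; rewrite coefM mulr_sumr.
rewrite exchange_big /=.
have kq l : (l < q.+1)%N -> (q - l < (q - k).+1)%N || (l < k)%N.
  by move=> lq; case: ltnP => // ?; lia.
rewrite (bigID (fun l : 'I_q.+1 => l < k)%N) /= big1 ?add0r; last first.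
  by by move=> l /bk h; apply: big1 => p _; rewrite h mul0r mulr0.
have [qk'|kq'] := ltnP q k.
  rewrite big1; last by move=> l; rewrite -leqNgt => kl; have := ltn_ord l; lia.
  rewrite big1 // => l _; rewrite bk ?mulr0 //.
  by have := leq_subr l q; lia.
(* Reversal of the index: the orders at least [k] in [b i] correspond to the orders at most [q - k]
   in the other factor. *)
pose h (l : 'I_(q - k).+1) : 'I_q.+1 := inord (q - l).
pose h' (l : 'I_q.+1) : 'I_(q - k).+1 := inord (q - l).
rewrite (reindex_onto h h') /=; last first.
  move=> l; rewrite -leqNgt => kl; apply/val_inj.
  have lq := ltn_ord l; rewrite /= !inordK; lia.
apply: eq_big => [l|l _].
  have lq := ltn_ord l; rewrite /h inordK; last by lia.
  rewrite -leqNgt; apply/andP; split; first by lia.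
  by apply/eqP/val_inj; rewrite /= /h' !inordK; lia.
have lq := ltn_ord l; rewrite /h inordK; last by lia.
rewrite mulr_suml; apply: eq_bigr => p _.
have -> : (q - (q - l))%N = l by lia.
ring.
Qed.
End TruncatedSubstitution.

(** * The majorant argument with a shift by N *)

Section Majorant.
Variable R : realType.
Implicit Types (e : nat -> R) (d k l q N K : nat).

(** Without constant term, like the increments in [fps_subst] that it is to dominate. *)
Definition positive_part_poly e k : {poly R} :=
  \poly_(l < k) (if l == 0%N then 0 else e l).
Local Notation PP := positive_part_poly.

Lemma coef_poly_exp e k d q : ((PP e k) ^+ d)`_q =
  \sum_(f : {ffun 'I_d -> 'I_k} | (\sum_i f i == q)%N)
     \prod_i (if f i == 0%N :> nat then 0 else e (f i)).
Proof.
rewrite /PP poly_def -[d in LHS]card_ord -prodr_const.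
under eq_bigr => i _ do rewrite -(big_mkord xpredT (fun l => (if l == 0%N then 0 else e l) *: 'X^l)).
under eq_bigr => i _ do rewrite big_mkord.
rewrite bigA_distr_bigA /= coef_sum [RHS]big_mkcond /=; apply: eq_bigr => f _.
rewrite scaler_prod -expr_sum coefZ coefXn eq_sym.
by case: eqP => _; rewrite ?mulr1 ?mulr0.
Qed.

Lemma coef_poly_exp_ge0 e k d q : (forall l, 0 <= e l) -> 0 <= ((PP e k) ^+ d)`_q.
Proof.
by move=> e0; rewrite coef_poly_exp sumr_ge0 // => f _; rewrite prodr_ge0 // => i _; case: ifP.
Qed.

(** The coefficients are nonnegative and their total is the value at 1. *)
Lemma coef_poly_exp_sum e k d (I : seq nat) : (forall l, 0 <= e l) -> uniq I ->
  \sum_(q <- I) ((PP e k) ^+ d)`_q <= (\sum_(1 <= l < k) e l) ^+ d.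
Proof.
move=> e0 uI.
have T : (PP e k).[1] = \sum_(1 <= l < k) e l.
  rewrite horner_poly; under eq_bigr => l _ do rewrite expr1n mulr1.
  rewrite -(big_mkord xpredT (fun l => if l == 0%N then 0 else e l)).
  case: k => [|k]; first by rewrite !big_geq.
  rewrite big_nat_recl // eqxx add0r big_add1 /=; apply: eq_big_nat => l; by [].
rewrite -T -horner_exp horner_coef; under [leRHS]eq_bigr => l _ do rewrite expr1n mulr1.
set f := PP e k ^+ d; set n := size f.
rewrite (bigID (fun q => q < n)%N) /= [X in _ + X]big1 ?addr0; last first.
  by move=> q; rewrite -leqNgt => nq; rewrite nth_default.
rewrite -big_filter -(big_mkord xpredT (fun l => f`_l)).
set J := [seq _ <- I | _].
have uJ : uniq J by rewrite filter_uniq.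
have pe : perm_eq J [seq i <- index_iota 0 n | i \in J].
  apply: uniq_perm => //; first by rewrite filter_uniq // iota_uniq.
  by move=> i; rewrite mem_filter mem_index_iota /= /J mem_filter; case: (i < n)%N; rewrite ?andbT ?andbF.
rewrite (perm_big _ pe) big_filter [leRHS](bigID (fun i => i \in J)) /=.
by rewrite lerDl sumr_ge0 // => i _; exact: coef_poly_exp_ge0.
Qed.

Lemma coef_poly_exp_mono e k k' d q : (forall l, 0 <= e l) -> (k <= k')%N ->
  ((PP e k) ^+ d)`_q <= ((PP e k') ^+ d)`_q.
Proof.
move=> e0 kk; elim: d q => [|d IH] q; first by rewrite !expr0.
rewrite !exprS !coefM; apply: ler_sum => i _.
apply: ler_pM => //.
- by rewrite coef_poly; case: ifP => // _; case: ifP.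
- exact: coef_poly_exp_ge0.
- rewrite !coef_poly; case: ltnP => [ik|ki]; first by rewrite (leq_trans ik kk).
  by case: ifP => // _; case: ifP.
Qed.

(** If nothing is truncated, the sum is N + k > N + K. Otherwise one part yields K, and since it is
    below k the others sum to at least N + 1; they keep that amount, or a second part is truncated
    and yields K > N. The bound by [d] holds since each part counts for at least 1. *)
Lemma truncated_weight N K k d (f : 'I_d -> nat) : (N < K)%N -> (K < k)%N ->
  (forall i, 0 < f i < k)%N -> (\sum_i f i = N + k)%N ->
  (maxn d (N + K).+1 <= \sum_i minn (f i) K)%N.
Proof.
move=> NK Kk f0 fs; rewrite geq_max; apply/andP; split.
  rewrite -[d in (d <= _)%N]card_ord -sum1_card; apply: leq_sum => i _.
  by have /andP[? _] := f0 i; rewrite leq_min; lia.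
have [/forallP h|/forallPn[i0]] := boolP [forall i, (f i <= K)%N].
  rewrite (eq_bigr f) => [|i _]; first by rewrite fs; lia.
  by apply/minn_idPl.
rewrite -ltnNge => Ki0; rewrite (bigD1 i0) //=.
rewrite (bigD1 i0) //= in fs; have /andP[_ fk] := f0 i0.
rewrite (minn_idPr (ltnW Ki0)).
rewrite [X in (X < _)%N]addnC ltn_add2l.
have [/forallP h|/forallPn[i1]] := boolP [forall i, (i != i0) ==> (f i <= K)%N].
  rewrite (eq_bigr f) => [|i ii].
    by move: fs; move: (\sum_(i < d | _) _)%N => s; lia.
  by apply/minn_idPl; exact: implyP (h i) ii.
rewrite negb_imply -ltnNge => /andP[i10 Ki1]; rewrite (bigD1 i1) //=.
by rewrite (minn_idPr (ltnW Ki1)); apply: leq_trans (leq_addr _ _).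
Qed.

(** The weight r^l with the first [K] powers removed: flat up to [K], geometric beyond. *)
Definition rescaled e (r : R) K l := e l * r ^+ (l - minn l K).

Lemma rescaled_coef e (r : R) N K k d : (forall l, 0 <= e l) -> 0 < r <= 1 ->
  (N < K)%N -> (K < k)%N ->
  ((PP e k) ^+ d)`_(N + k) * r ^+ (N + k) <=
  r ^+ maxn d (N + K).+1 * ((PP (rescaled e r K) k) ^+ d)`_(N + k).
Proof.
move=> e0 /andP[r0 r1] NK Kk; rewrite !coef_poly_exp mulr_suml mulr_sumr.
apply: ler_sum => f /eqP fs.
case: (pickP (fun i : 'I_d => f i == 0%N :> nat)) => [i fi|nz].
  by rewrite !(bigD1 (P := xpredT) i) //= fi !mul0r mulr0.
under eq_bigr => i _ do rewrite nz.
under [X in _ <= _ * X]eq_bigr => i _ do rewrite nz.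
rewrite -{1}fs expr_sum -big_split /=.
have -> : \prod_(i < d) (e (f i) * r ^+ f i) =
    r ^+ (\sum_(i < d) minn (f i) K) * \prod_(i < d) rescaled e r K (f i).
  rewrite expr_sum -big_split /=; apply: eq_bigr => i _.
  by rewrite /rescaled mulrCA -exprD subnKC // geq_minl.
apply: ler_wpM2r.
  by rewrite prodr_ge0 // => i _; rewrite mulr_ge0 // exprn_ge0 // ltW.
apply: ler_wiXn2l; rewrite ?(ltW r0) //.
by apply: (@truncated_weight N K k) => // i; rewrite lt0n nz ltn_ord.
Qed.

(** For the rescaled sequence [h] and l > K the recursion is multiplied by r^(N+l). The left side
    becomes h_l r^(N+K), and every term on the right gains at least r^(N+K+1), so a factor r
    survives. Summing over l bounds the tail of [h] by 1 inductively. *)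
Lemma majorant e (C' W : R) N K : (forall l, 0 <= e l) -> 0 <= C' -> 0 <= W ->
  (N < K)%N ->
  (forall k, (K < k)%N ->
     e k <= C' * \sum_(d < (N + k).+1) W ^+ d * ((PP e k) ^+ d)`_(N + k)) ->
  exists r B : R, 0 < r /\ forall k, e k * r ^+ k <= B.
Proof.
move=> e0 C0 W0 NK he.
pose c := (N + K).+1.
(* The head of the sequence plus 1, the bound on the rescaled tail to be proved. *)
pose T0 := \sum_(1 <= l < K.+1) e l + 1.
have T00 : 0 <= T0 by rewrite addr_ge0 // sumr_ge0.
pose y := W * T0 + 1; have y1 : 1 <= y by rewrite lerDr mulr_ge0.
have y0 : 0 < y by lra.
pose D := 2 * C' * (2 * y) ^+ c + 1.
have D1 : 1 <= D by rewrite lerDr !mulr_ge0 // exprn_ge0 // mulr_ge0 // ltW.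
(* The first bound makes the sum over the degree [d] geometric of ratio 1/2; the second lets the
   surplus factor [r] absorb all remaining constants. *)
pose r := Num.min (1 / (2 * y)) (1 / D).
have r0 : 0 < r by rewrite lt_min !divr_gt0 //; lra.
have ry : y * r <= 1 / 2.
  have : r <= 1 / (2 * y) by rewrite ge_min lexx.
  by rewrite ler_pdivlMr; lra.
have rD : r * D <= 1.
  have : r <= 1 / D by rewrite ge_min lexx orbT.
  by rewrite ler_pdivlMr //; lra.
have r1 : r <= 1 by nra.
pose h := rescaled e r K.
have h0 l : 0 <= h l by rewrite mulr_ge0 // exprn_ge0 // ltW.
have hlow l : (l <= K)%N -> h l = e l.
  by move=> lK; rewrite /h /rescaled (minn_idPl lK) subnn expr0 mulr1.
(* For [d <= c] nothing is gained from [r], which (2 y)^c compensates; beyond [c] each degree gains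
   [y * r <= 1 / 2]. *)
have geo d : y ^+ d * r ^+ (maxn d c - c) <= (2 * y) ^+ c * 2^-1 ^+ d.
  have [dc|cd] := leqP d c.
    rewrite subnn expr0 mulr1.
    have : y ^+ d <= y ^+ c by rewrite ler_weXn2l.
    have : 1 <= 2 ^+ c * 2^-1 ^+ d :> R.
      by rewrite -(subnKC dc) exprD mulrAC -exprMn divff // expr1n mul1r exprn_ege1 // ler1n.
    have : 0 <= y ^+ c by rewrite exprn_ge0 // ltW.
    by rewrite exprMn; set a := y ^+ c; set b := 2^-1 ^+ d; set z := 2 ^+ c; nra.
  have -> : d = (c + (d - c))%N by rewrite subnKC // ltnW.
  rewrite addKn !exprD -mulrA -exprMn [(2 * y) ^+ c]exprMn.
  have -> : 2 ^+ c * y ^+ c * (2^-1 ^+ c * 2^-1 ^+ (d - c)) = y ^+ c * 2^-1 ^+ (d - c) * (2 * 2^-1) ^+ c :> R.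
    by rewrite exprMn; ring.
  rewrite divff // expr1n mulr1 ler_wpM2l ?exprn_ge0 ?(ltW y0) //.
  rewrite lerXn2r ?nnegrE ?mulr_ge0 ?invr_ge0 ?(ltW y0) ?(ltW r0) //; lra.
pose S k := \sum_(K.+1 <= l < k) h l.
have main k : (K < k)%N -> S k <= 1.
  elim: k => // k IH; rewrite ltnS leq_eqVlt => /orP[/eqP <-|Kk].
    by rewrite /S big_geq // ler01.
  have {}IH := IH Kk.
  have Tk : \sum_(1 <= l < k) h l <= T0.
    rewrite (big_cat_nat (n := K.+1)) //= ?(ltn_trans _ Kk) //.
    rewrite (eq_big_nat _ _ (F2 := e)) => [|l /andP[_ lK]]; last exact: hlow.
    by rewrite lerD2l.
  have Tk0 : 0 <= \sum_(1 <= l < k) h l by rewrite sumr_ge0.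
  have step l : (K < l < k.+1)%N ->
      h l <= C' * r * \sum_(d < (N + k).+1) W ^+ d * r ^+ (maxn d c - c) * ((PP h k) ^+ d)`_(N + l).
    move=> /andP[Kl lk].
    have rc0 : 0 < r ^+ (N + K) by rewrite exprn_gt0.
    rewrite -(ler_pM2r rc0).
    have -> : h l * r ^+ (N + K) = e l * r ^+ (N + l).
      rewrite /h /rescaled (minn_idPr (ltnW Kl)) -mulrA -exprD.
      by rewrite [(l - K + _)%N]addnC -addnA subnKC // ltnW.
    have rl0 : 0 <= r ^+ (N + l) by rewrite exprn_ge0 // ltW.
    apply: le_trans (ler_wpM2r rl0 (he _ Kl)) _.
    apply: (@le_trans _ _ (C' * \sum_(d < (N + k).+1)
        W ^+ d * (r ^+ maxn d c * ((PP h k) ^+ d)`_(N + l)))).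
      rewrite -mulrA; apply: ler_wpM2l => //; rewrite mulr_suml.
      have lk' : ((N + l).+1 <= (N + k).+1)%N by rewrite ltnS leq_add2l.
      rewrite (big_ord_widen _ (fun d => W ^+ d * ((PP e l) ^+ d)`_(N + l) * r ^+ (N + l)) lk').
      rewrite big_mkcond /=; apply: ler_sum => d _.
      have hk0 : 0 <= ((PP h k) ^+ d)`_(N + l) by exact: coef_poly_exp_ge0.
      have Wd : 0 <= W ^+ d by rewrite exprn_ge0.
      case: ifP => _; last by rewrite !mulr_ge0 // exprn_ge0 // ltW.
      rewrite -mulrA; apply: ler_wpM2l => //.
      have r01 : 0 < r <= 1 by rewrite r0.
      apply: le_trans (rescaled_coef d e0 r01 NK Kl) _.
      apply: ler_wpM2l; first by rewrite exprn_ge0 // ltW.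
      by apply: coef_poly_exp_mono.
    rewrite [leRHS]mulrAC -!mulrA; apply: ler_wpM2l => //.
    rewrite [leRHS]mulrA -exprS -/c mulr_sumr; apply: ler_sum => d _.
    by rewrite -{1}(subnK (leq_maxr d c)) exprD le_eqVlt; apply/orP; left; apply/eqP; ring.
  have St : S k.+1 <= \sum_(K.+1 <= l < k.+1) C' * r *
      \sum_(d < (N + k).+1) W ^+ d * r ^+ (maxn d c - c) * ((PP h k) ^+ d)`_(N + l).
    by rewrite /S big_nat_cond [leRHS]big_nat_cond; apply: ler_sum => l; rewrite andbT; exact: step.
  apply: le_trans St _; rewrite -mulr_sumr exchange_big /=.
  have term d : \sum_(K.+1 <= l < k.+1) W ^+ d * r ^+ (maxn d c - c) * ((PP h k) ^+ d)`_(N + l)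
      <= (2 * y) ^+ c * 2^-1 ^+ d.
    rewrite -mulr_sumr.
    have cs : \sum_(K.+1 <= l < k.+1) ((PP h k) ^+ d)`_(N + l) <= T0 ^+ d.
      rewrite -(big_map (addn N) xpredT (fun q => ((PP h k) ^+ d)`_q)).
      apply: (@le_trans _ _ ((\sum_(1 <= l < k) h l) ^+ d)).
        by apply: coef_poly_exp_sum => //; rewrite map_inj_uniq ?iota_uniq //; exact: addnI.
      by rewrite lerXn2r.
    have Wr : 0 <= W ^+ d * r ^+ (maxn d c - c) by rewrite mulr_ge0 ?exprn_ge0 // ltW.
    apply: le_trans (ler_wpM2l Wr cs) _; apply: le_trans (geo d).
    rewrite mulrAC -exprMn ler_wpM2r ?exprn_ge0 ?(ltW r0) //.
    by rewrite lerXn2r ?nnegrE ?mulr_ge0 ?(ltW y0) //; rewrite /y lerDl.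
  have S2 : \sum_(d < (N + k).+1) \sum_(K.+1 <= l < k.+1)
      W ^+ d * r ^+ (maxn d c - c) * ((PP h k) ^+ d)`_(N + l) <= (2 * y) ^+ c * 2.
    apply: (@le_trans _ _ (\sum_(d < (N + k).+1) (2 * y) ^+ c * 2^-1 ^+ d)).
      by apply: ler_sum => d _; exact: term.
    rewrite -mulr_sumr ler_wpM2l ?exprn_ge0 ?mulr_ge0 ?(ltW y0) //.
    have := @sum_geom_le R 2^-1 (N + k).+1; rewrite invr_ge0 ler0n invf_lt1 // ltr1n => /(_ isT).
    by have -> : (1 - 2^-1)^-1 = 2 :> R by field.
  have Cr : 0 <= C' * r by rewrite mulr_ge0 // ltW.
  apply: le_trans (ler_wpM2l Cr S2) _; apply: le_trans rD.
  by rewrite /D; set z := (2 * y) ^+ c; nra.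
exists r, (\sum_(0 <= l < K.+1) e l + 1); split=> // k.
have [kK|Kk] := leqP k K.
  have ek : e k * r ^+ k <= e k by rewrite ler_piMr // exprn_ile1 // ltW.
  apply: le_trans ek _; rewrite (bigD1_seq k) ?iota_uniq ?mem_index_iota //=.
  by rewrite -addrA lerDl addr_ge0 // sumr_ge0.
have hk : h k <= 1.
  apply: le_trans (main k.+1 _); last by rewrite ltnS ltnW.
  by rewrite /S big_nat_recr //= lerDr sumr_ge0.
have -> : e k * r ^+ k = h k * r ^+ K.
  by rewrite /h /rescaled (minn_idPr (ltnW Kk)) -mulrA -exprD subnK // ltnW.
have rK : r ^+ K <= 1 by rewrite exprn_ile1 // ltW.
have rK0 : 0 <= r ^+ K by rewrite exprn_ge0 // ltW.
have s0 : 0 <= \sum_(0 <= l < K.+1) e l by rewrite sumr_ge0.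
have := h0 k; nra.
Qed.
End Majorant.

(** * The operator k + i eta t d/dt on circles *)

Section CircleEstimate.
Variable R : realType.
Local Notation C := (Cplx R).

Lemma circle_max (u : C -> C) (s : R) : 0 < s -> (forall t, nm t = s -> cdiff u t) ->
  exists2 t0, nm t0 = s & forall t, nm t = s -> nm (u t) <= nm (u t0).
Proof.
move=> s0 ud.
pose circ (z : C) := s%:C * cexp ('i * z).
have nc (x : R) : nm (circ x%:C) = s.
  by rewrite nmM nm_rc gtr0_norm // nm_cexp irc /= expR0 mulr1.
have has_deriv_circ z : exists d, has_deriv circ z d.
  have h1 : has_deriv (fun z => 'i * z : C) z 'i.
    by have := has_derivM (has_deriv_cst 'i z) (has_deriv_id z); rewrite mul0r add0r mulr1.
  by eexists; exact: has_derivM (has_deriv_cst s%:C z) (has_deriv_comp h1 (has_deriv_cexp _)).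
pose f (x : R) := nm (u (circ x%:C)).
have fc : {within `[0, pi *+ 2], continuous f}.
  apply: continuous_subspaceT => x.
  have [d' hc] := has_deriv_circ x%:C.
  have hu := has_deriv_comp hc (cdiff_hd (ud _ (nc x))).
  apply/cvgrPdist_lt => e e0.
  have /(@cvg_nm _ _ _ _ (nbhs_filter (x%:C : C)))/(_ e e0)/nbhs_nm[d d0 hd0] := has_deriv_cont hu.
  exists d => // y /= xy.
  have := hd0 y%:C; rewrite -rcB nm_rc distrC => /(_ xy) h.
  apply: le_lt_trans h; rewrite /f ler_norml.
  have := nm_sub (u (circ x%:C)) (u (circ y%:C)).
  have := nm_sub (u (circ y%:C)) (u (circ x%:C)).
  rewrite [nm (u (circ x%:C) - _)]nmC -/(circ y%:C) -/(circ x%:C); lra.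
have pi2 : 0 <= pi *+ 2 :> R by rewrite mulrn_wge0 // pi_ge0.
have [c _ cmax] := EVT_max pi2 fc.
exists (circ c%:C); first exact: nc.
move=> w ws; have w0 : w != 0 by rewrite -nm_gt0 ws.
have [th th2 ->] := cexp_polar w0; rewrite ws cexpD cexp_rc lnK ?posrE //.
by apply: (cmax th); rewrite in_itv.
Qed.

(* At a point where |u| is maximal on the circle, moving along the circle in the
   direction of decreasing argument shows k |u| <= |k u + i eta t u'|. *)
Lemma circle_estimate (u : C -> C) (s k eta E : R) : 0 < s -> 0 < k ->
  (forall t, nm t = s -> cdiff u t) ->
  (forall t, nm t = s -> nm (k%:C * u t + 'i * eta%:C * t * derive1 u t) <= E) ->
  forall t, nm t = s -> nm (u t) <= E / k.
Proof.
move=> s0 k0 ud uE t ts.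
have has_deriv_rot (w : C) (b : C) z : has_deriv (fun z => w * cexp (b * z)) z (w * (b * cexp (b * z))).
  have h1 : has_deriv (fun z => b * z) z b.
    by have := has_derivM (has_deriv_cst b z) (has_deriv_id z); rewrite mul0r add0r mulr1.
  have := has_derivM (has_deriv_cst w z) (has_deriv_comp h1 (has_deriv_cexp _)).
  by rewrite mul0r add0r.
have [t0 t0s tmax] := circle_max s0 ud.
apply: le_trans (tmax _ ts) _; rewrite ler_pdivlMr //.
apply/ler_addgt0Pr => e e0.
(* For real z the argument of [u] stays on the circle, and the derivative at 0 is i eta t0
   u'(t0). *)
pose g (z : C) := u (t0 * cexp ('i * eta%:C * z)).
have hg : has_deriv g 0 ('i * eta%:C * t0 * derive1 u t0).
  have := has_deriv_rot t0 ('i * eta%:C) 0; rewrite mulr0 cexp0 mulr1 => h1.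
  have h2 : has_deriv u (t0 * cexp ('i * eta%:C * 0)) (derive1 u t0).
    by rewrite mulr0 cexp0 mulr1; exact: cdiff_hd (ud _ t0s).
  by apply: has_deriv_ext (has_deriv_comp h1 h2); ring.
have [d d0 hd0] := hg _ e0.
pose h : R := d / 2; have h0 : 0 < h by rewrite divr_gt0.
have nh : nm (- h%:C : C) = h by rewrite nmN nm_rc gtr0_norm.
have := hd0 (- h%:C); rewrite nh add0r => /(_ _) H.
have {}H : nm (g (- h%:C) - g 0 - - h%:C * ('i * eta%:C * t0 * derive1 u t0)) <= e * h.
  by apply: H; rewrite /h; lra.
have gm : nm (g (- h%:C)) <= nm (u t0).
  apply: tmax; rewrite nmM t0s nm_cexp.
  have -> : 'i * eta%:C * - h%:C = 'i * (eta * - h)%:C by rewrite rcM rcN; ring.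
  by rewrite irc /= expR0 mulr1.
have g0 : g 0 = u t0 by rewrite /g mulr0 cexp0 mulr1.
rewrite g0 in H.
have := uE _ t0s; set D := k%:C * u t0 + _ => HD.
(* A backward Euler step: as |g(-h)| is at most |u(t0)|, taking norms leaves h k |u(t0)| <= h (E +
   e). *)
have E1 : (1 + h * k)%:C * u t0 = g (- h%:C) -
   (g (- h%:C) - u t0 - - h%:C * ('i * eta%:C * t0 * derive1 u t0)) + h%:C * D.
  by rewrite /D rcD rc1 rcM; ring.
have : nm ((1 + h * k)%:C * u t0) <= nm (u t0) + e * h + h * E.
  rewrite E1; apply: le_trans (nmD _ _) _; apply: lerD.
    by apply: le_trans (nmB _ _) _; apply: lerD.
  by rewrite nmM nm_rc gtr0_norm // ler_pM2l.
have hk : 0 < 1 + h * k by rewrite addr_gt0 // mulr_gt0.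
rewrite nmM nm_rc gtr0_norm // => H2.
rewrite -(ler_pM2l h0); lra.
Qed.
End CircleEstimate.

(** * Compactness of closed annuli *)

Section Annulus.
Variable R : realType.
Local Notation C := (Cplx R).

(** The annulus is the image under [cexp] of a closed rectangle, to which [cousin_bound] applies. *)
Lemma annulus_bound (V : C -> R -> Prop) (s1 s2 : R) : 0 < s1 <= s2 ->
  (forall z M M', M <= M' -> V z M -> V z M') ->
  (forall t, s1 <= nm t <= s2 -> exists d M : R, 0 < d /\
     forall z, nm (z - t) < d -> V z M) ->
  exists M : R, forall t, s1 <= nm t <= s2 -> V t M.
Proof.
move=> /andP[s10 s12] mono loc.
have s20 : 0 < s2 by lra.
pose p : C := (ln s1)%:C; pose v1 : C := (ln s2 - ln s1)%:C.
pose v2 : C := 'i * (pi *+ 2)%:C.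
have pE (s t : R) : p + s%:C * v1 + t%:C * v2 =
    (ln s1 + s * (ln s2 - ln s1))%:C + 'i * (t * (pi *+ 2))%:C.
  by rewrite /p /v1 /v2 rcD !rcM; ring.
have ln12 : ln s1 <= ln s2 by rewrite ler_ln ?posrE.
have nE (s t : R) : nm (cexp (p + s%:C * v1 + t%:C * v2)) = expR (ln s1 + s * (ln s2 - ln s1)).
  by rewrite pE nm_cexp irc /= addr0.
have [|s t s01 t01|M hM] := @cousin_bound R (fun w => V (cexp w)) p v1 v2.
- by move=> z M M'; exact: mono.
- set w := _ + _ + t%:C * v2.
  have [|d [M [d0 dM]]] := loc (cexp w).
    have e1 : s1 = expR (ln s1) by rewrite lnK ?posrE.
    have e2 : s2 = expR (ln s2) by rewrite lnK ?posrE.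
    rewrite /w nE; have /andP[a0 a1] := s01; apply/andP; split.
      by rewrite [leLHS]e1 ler_expR; nra.
    by rewrite [leRHS]e2 ler_expR; nra.
  have /(@cvg_nm _ _ _ _ (nbhs_filter w))/(_ d d0)/nbhs_nm[d' d'0 has_deriv'] := has_deriv_cont (has_deriv_cexp w).
  by exists d', M; split=> // z /has_deriv'; exact: dM.
exists M => t /andP[t1 t2].
have nt0 : 0 < nm t by lra.
have t0 : t != 0 by rewrite -nm_gt0.
have [th /andP[th0 th2] tE] := cexp_polar t0.
have pi2 : 0 < pi *+ 2 :> R by rewrite mulrn_wgt0 // pi_gt0.
have l1 : ln s1 <= ln (nm t) by rewrite ler_ln ?posrE.
have l2 : ln (nm t) <= ln s2 by rewrite ler_ln ?posrE.
(* For equal radii the rectangle is a segment and the coordinate is set to 0. *)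
pose s := if ln s2 == ln s1 then 0 else (ln (nm t) - ln s1) / (ln s2 - ln s1).
have [s01 sE] : 0 <= s <= 1 /\ ln s1 + s * (ln s2 - ln s1) = ln (nm t).
  rewrite /s; case: eqP => [E|/eqP E]; first by split; lra.
  have D0 : 0 < ln s2 - ln s1 by rewrite subr_gt0 lt_neqAle ln12 eq_sym E.
  split; last by rewrite divfK ?gt_eqF //; lra.
  by rewrite divr_ge0 ?(ltW D0) ?subr_ge0 //= ler_pdivrMr // mul1r; lra.
have t01 : 0 <= th / (pi *+ 2) <= 1.
  by rewrite divr_ge0 ?(ltW pi2) //= ler_pdivrMr // mul1r.
have := hM _ _ s01 t01; rewrite pE sE divfK ?gt_eqF //.
by rewrite -tE.
Qed.

Lemma annulus_bound_cdiff (u : C -> C) (s1 s2 : R) : 0 < s1 <= s2 ->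
  (forall t, s1 <= nm t <= s2 -> cdiff u t) ->
  exists2 M : R, 0 <= M & forall t, s1 <= nm t <= s2 -> nm (u t) <= M.
Proof.
move=> s12 ud.
have [z M M' MM /le_trans|t /ud/cdiff_locally_bounded//|M hM] :=
  @annulus_bound (fun t M => nm (u t) <= M) s1 s2 s12; first exact.
exists `|M| => // t /hM h; exact: le_trans h (ler_norm _).
Qed.
End Annulus.

(** * Functions on the punctured disc meromorphic at 0 *)

Section Meromorphic.
Variable R : realType.
Local Notation C := (Cplx R).
Variable eps : R.
Implicit Types (f g h : C -> C) (t : C).

(** The numerator is holomorphic on the whole disc, so the zeros of [f] are those of [h]; the value
    of [f] at 0 is left free. *)
Definition mero f := exists (M : nat) h, (forall t, nm t < eps -> cdiff h t) /\
  forall t, 0 < nm t < eps -> f t = h t / t ^+ M.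

Lemma mero_cdiff f t : mero f -> 0 < nm t < eps -> cdiff f t.
Proof.
move=> [M [h [hd0 hf]]] /andP[t0 te].
have r0 : 0 < Num.min (nm t) (eps - nm t) by rewrite lt_min t0 subr_gt0.
apply: has_deriv_cdiff; apply: (@has_deriv_near R (fun x => h x / x ^+ M) f t _ _ r0).
  move=> x; rewrite lt_min => /andP[x1 x2]; rewrite hf //.
  have := nm_sub t x; have := nm_tri x t 0; rewrite !subr0 [nm (t - x)]nmC.
  by move=> ? ?; apply/andP; split; lra.
apply: has_derivM; first exact: cdiff_hd (hd0 _ te).
by apply: has_derivV; [exact: has_derivX (has_deriv_id t)|rewrite expf_neq0 // -nm_gt0].
Qed.

Lemma mero_ext f g : (forall t, 0 < nm t < eps -> f t = g t) -> mero f -> mero g.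
Proof.
by move=> fg [M [h [hd0 hf]]]; exists M, h; split=> // t te; rewrite -fg // hf.
Qed.

Lemma cdiff_mero f : (forall t, nm t < eps -> cdiff f t) -> mero f.
Proof. by move=> fd; exists 0%N, f; split=> // t _; rewrite expr0 divr1. Qed.

Lemma mero_cst c : mero (fun=> c).
Proof. by apply: cdiff_mero => t _; exact: has_deriv_cdiff (has_deriv_cst c t). Qed.

Lemma meroD f g : mero f -> mero g -> mero (fun t => f t + g t).
Proof.
move=> [M [h [hd0 hf]]] [N [k [kd0 kg]]].
exists (M + N)%N, (fun t => h t * t ^+ N + k t * t ^+ M); split=> [t te|t te].
  apply: has_deriv_cdiff; apply: has_derivD; apply: has_derivM; try exact: has_derivX (has_deriv_id t).
    exact: cdiff_hd (hd0 _ te).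
  exact: cdiff_hd (kd0 _ te).
have t0 : t != 0 by rewrite -nm_gt0; case/andP: te.
by rewrite hf // kg // exprD; field; rewrite !expf_neq0.
Qed.

Lemma meroM f g : mero f -> mero g -> mero (fun t => f t * g t).
Proof.
move=> [M [h [hd0 hf]]] [N [k [kd0 kg]]].
exists (M + N)%N, (fun t => h t * k t); split=> [t te|t te].
  by apply: has_deriv_cdiff; apply: has_derivM; [exact: cdiff_hd (hd0 _ te)|exact: cdiff_hd (kd0 _ te)].
have t0 : t != 0 by rewrite -nm_gt0; case/andP: te.
by rewrite hf // kg // exprD; field; rewrite !expf_neq0.
Qed.

Lemma mero_sum (I : Type) (s : seq I) (f : I -> C -> C) :
  (forall i, mero (f i)) -> mero (fun t => \sum_(i <- s) f i t).
Proof.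
move=> fm; elim: s => [|i s IH].
  by apply: mero_ext (mero_cst 0) => t _; rewrite big_nil.
by apply: mero_ext (meroD (fm i) IH) => t _; rewrite big_cons.
Qed.

(** The factor t keeps the pole order: t (h / t^M)' = (t h' - M h) / t^M. *)
Lemma mero_delta (k c : C) f : mero f -> mero (fun t => k * f t + 'i * c * t * derive1 f t).
Proof.
move=> fm; have [M [h [hd0 hf]]] := fm.
have h1 : forall t, nm t < eps -> cdiff (derive1 h) t.
  move=> t te; apply: (@cdiff_derive1 R (fun t => nm (t - 0) < eps)).
  - exact: nopen_ball.
  - by move=> x; rewrite subr0; exact: hd0.
  - by rewrite subr0.
apply: meroD; first exact: meroM (mero_cst _) fm.
exists M, (fun t => 'i * c * (t * derive1 h t - M%:R * h t)); split=> [t te|t te].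
  apply: has_deriv_cdiff; apply: has_derivM; first exact: has_deriv_cst.
  apply: has_derivB; first exact: has_derivM (has_deriv_id t) (cdiff_hd (h1 _ te)).
  exact: has_derivM (has_deriv_cst _ t) (cdiff_hd (hd0 _ te)).
have /andP[t0 te1] := te; have tn : t != 0 by rewrite -nm_gt0.
have r0 : 0 < Num.min (nm t) (eps - nm t) by rewrite lt_min t0 subr_gt0.
have E : has_deriv f t (derive1 h t / t ^+ M + h t * (- (M%:R * 1 * t ^+ M.-1) / (t ^+ M) ^+ 2)).
  apply: (@has_deriv_near R (fun x => h x / x ^+ M) f t _ _ r0).
    move=> x; rewrite lt_min => /andP[x1 x2]; rewrite hf //.
    have := nm_sub t x; have := nm_tri x t 0; rewrite !subr0 [nm (t - x)]nmC.
    by move=> ? ?; apply/andP; split; lra.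
  apply: has_derivM; first exact: cdiff_hd (hd0 _ te1).
  by apply: has_derivV; [exact: has_derivX (has_deriv_id t)|rewrite expf_neq0].
rewrite (has_deriv_derive1 E).
case: M {hf E} => [|M]; first by rewrite !expr0 /=; field.
by rewrite /= exprS; field; rewrite expf_neq0.
Qed.

Definition pmero (P : C -> {poly C}) := forall l, mero (fun t => (P t)`_l).

Lemma pmeroM P Q : pmero P -> pmero Q -> pmero (fun t => P t * Q t).
Proof.
move=> Pm Qm l; apply: mero_ext (_ : mero (fun t => \sum_(i < l.+1) (P t)`_i * (Q t)`_(l - i))).
  by move=> t _; rewrite coefM.
by apply: mero_sum => i; exact: meroM.
Qed.

Lemma pmeroX P d : pmero P -> pmero (fun t => P t ^+ d).
Proof.
move=> Pm; elim: d => [|d IH] l.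
  by apply: mero_ext (mero_cst (1 : {poly C})`_l) => t _; rewrite expr0.
by apply: mero_ext (pmeroM Pm IH l) => t _; rewrite exprS.
Qed.

Lemma pmero_prod (I : Type) (s : seq I) (P : I -> C -> {poly C}) :
  (forall i, pmero (P i)) -> pmero (fun t => \prod_(i <- s) P i t).
Proof.
move=> Pm; elim: s => [|i s IH] l.
  by apply: mero_ext (mero_cst (1 : {poly C})`_l) => t _; rewrite big_nil.
by apply: mero_ext (pmeroM (Pm i) IH l) => t _; rewrite big_cons.
Qed.

Lemma exotic_mero (alpha : nat -> C -> C) k :
  exotic_series eps%:C alpha -> mero (alpha k).
Proof.
move=> [r [a /(_ k)[acv aE]]].
pose S t := limn (series (fun l => a k l * t ^+ l)).
have Sd t : nm t < eps -> cdiff S t.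
  by apply: pseries_cdiff => {}t te; apply: acv; rewrite nmE ltrc.
have dE t : 0 < nm t < eps -> alpha k t = t ^ (- r k) * S t.
  by move=> te; apply: aE; rewrite /punctured_disc /= nmE -rc0 !ltrc.
case: (r k) dE => [M|M] dE.
  by exists M, S; split=> // t te; rewrite dE // mulrC -exprnN.
exists 0%N, (fun t => t ^+ M.+1 * S t); split=> [t te|t te].
  by apply: has_deriv_cdiff; apply: has_derivM; [exact: has_derivX (has_deriv_id t)|exact: cdiff_hd (Sd _ te)].
by rewrite dE // expr0 divr1 NegzE opprK.
Qed.
End Meromorphic.

(** * Coefficientwise domination and the number of multi-indices *)

Section Domination.
Variable R : realType.
Local Notation C := (Cplx R).
Implicit Types (f g : {poly C}) (F G : {poly R}).

Definition dominated f F := forall l, nm f`_l <= F`_l.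

Lemma dominatedM f g F G : dominated f F -> dominated g G -> dominated (f * g) (F * G).
Proof.
move=> fF gG l; rewrite !coefM; apply: le_trans (nm_sum _ _ _) _.
by apply: ler_sum => i _; rewrite nmM ler_pM ?nm_ge0.
Qed.

Lemma dominated1 : dominated 1 1.
Proof. by move=> l; rewrite !coef1; case: (l == 0%N); rewrite ?nm1 ?nm0. Qed.

Lemma dominatedX f F d : dominated f F -> dominated (f ^+ d) (F ^+ d).
Proof.
move=> fF; elim: d => [|d IH]; first by rewrite !expr0; exact: dominated1.
by rewrite !exprS; exact: dominatedM.
Qed.

Lemma dominated_monom m (x : 'I_m -> {poly C}) F p : (forall j, dominated (x j) F) ->
  dominated (monom x p) (F ^+ (\sum_j p j)).
Proof.
move=> xF; rewrite expr_sum /monom.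
elim/big_rec2: _ => [|j f g _ IH]; first exact: dominated1.
by apply: dominatedM => //; exact: dominatedX.
Qed.

(* The number of multi-indices of length d in m variables is at most
   (d + 1) ^ m <= (2 ^ m) ^ d. *)
Lemma sum_by_degree m L (g : nat -> R) : (forall d, 0 <= g d) ->
  (forall d, (L <= d)%N -> g d = 0) ->
  \sum_(p : {ffun 'I_m -> 'I_L}) g (\sum_j p j)%N <= \sum_(d < L) (2 ^ m)%:R ^+ d * g d.
Proof.
move=> g0 gL.
rewrite (bigID (fun p : {ffun 'I_m -> 'I_L} => (\sum_j p j < L)%N)) /=.
rewrite [X in _ + X]big1 ?addr0; last by move=> p; rewrite -leqNgt; exact: gL.
case: L gL => [|L] gL.
  by rewrite big_ord0 big1.
rewrite (partition_big (fun p : {ffun 'I_m -> 'I_L.+1} => (inord (\sum_j p j)%N : 'I_L.+1)) xpredT) //=.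
apply: ler_sum => d _.
rewrite (eq_bigr (fun=> g d)); last first.
  by move=> p /andP[pL /eqP <-]; rewrite inordK.
rewrite sumr_const -[X in X <= _]mulr_natl; apply: ler_wpM2r => //.
rewrite -natrX ler_nat.
apply: (@leq_trans (d.+1 ^ m)); last first.
  rewrite -expnM mulnC expnM; have : (d.+1 <= 2 ^ d)%N by rewrite ltn_expl.
  by move: d.+1 (2 ^ d)%N => a b ab; elim: m => // k IH; rewrite !expnS leq_mul.
have -> : (d.+1 ^ m = #|{ffun 'I_m -> 'I_d.+1}|)%N by rewrite card_ffun !card_ord.
(* The entries of a multi-index of degree [d] are at most [d], so nothing is lost by this
   restriction. *)
pose h (p : {ffun 'I_m -> 'I_L.+1}) : {ffun 'I_m -> 'I_d.+1} := [ffun j => inord (p j)].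
apply: (@leq_card_in _ _ h).
move=> p q; rewrite !unfold_in => /andP[pL /eqP pd] /andP[qL /eqP qd] /ffunP pq.
have le (x : {ffun 'I_m -> 'I_L.+1}) j : (\sum_j x j < L.+1)%N ->
    inord (\sum_j x j)%N = d -> (x j < d.+1)%N.
  by move=> xL <-; rewrite inordK // ltnS (bigD1 j) //= leq_addr.
apply/ffunP => j; apply/val_inj.
have := pq j; rewrite !ffunE => /(f_equal val) /=.
by rewrite !inordK //; exact: le.
Qed.
End Domination.

(** * The formal solution: extension to t = 0 and recursion *)

Section FormalSolution.
Variables (R : realType) (n : nat) (rho : R) (e : 'I_n.+1 -> R).
Local Notation C := (Cplx R).
Implicit Types (t : C) (k l : nat).
Variables (F : 'rV[C]_n.+2 -> C) (eta eps : R) (alpha : nat -> C -> C) (N : nat).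
Let U := polydisc rho%:C (fun i => (e i)%:C).
Let delta_iter i := iter i (delta eta%:C) alpha.
Let z0 t := jet0 n eta%:C alpha t.
Hypothesis F_holomorphic : forall z, U z -> differentiable F z.
Hypothesis eps_gt0 : 0 < eps.
Hypothesis alpha_exotic : exotic_series eps%:C alpha.
Hypothesis jet0_in : forall t, punctured_disc eps%:C t -> U (z0 t).

Lemma polydiscP z : U z <-> nm (z 0 0) < rho /\ forall i, nm (z 0 (lift ord0 i)) < e i.
Proof.
by rewrite /U /polydisc /= nmE ltrc; split=> -[h1 h2]; split=> // i;
  have := h2 i; rewrite nmE ltrc.
Qed.

Lemma punctured_discP t : punctured_disc eps%:C t <-> 0 < nm t < eps.
Proof. by rewrite /punctured_disc /= nmE -rc0 !ltrc. Qed.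

Lemma finite_positive_lower_bound (I : finType) (g : I -> R) : (forall i, 0 < g i) ->
  exists2 r : R, 0 < r & forall i, r <= g i.
Proof.
move=> g0; suff [r r0 hr] : exists2 r : R, 0 < r & forall i, i \in enum I -> r <= g i.
  by exists r => // i; apply: hr; rewrite mem_enum.
elim: (enum I) => [|i s [r r0 hr]]; first by exists 1.
exists (Num.min r (g i)); first by rewrite lt_min r0 g0.
move=> j; rewrite inE => /orP[/eqP ->|/hr h]; first by rewrite ge_min lexx orbT.
by rewrite ge_min h.
Qed.

Lemma polydisc_nopen : nopen U.
Proof.
move=> z /polydiscP[h0 hi].
have [|r r0 hr] := @finite_positive_lower_bound _ (fun i => e i - nm (z 0 (lift ord0 i))).
  by move=> i; rewrite subr_gt0.
exists (Num.min r (rho - nm (z 0 0))); first by rewrite lt_min r0 subr_gt0.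
move=> w; rewrite lt_min => /andP[w1 w2]; apply/polydiscP.
have co j : nm (w 0 j) <= nm (w - z) + nm (z 0 j).
  have := nm_coord (w - z) j; rewrite !mxE => h.
  by have := nmD (w 0 j - z 0 j) (z 0 j); rewrite subrK; lra.
by split=> [|i]; [have := co 0|have := co (lift ord0 i); have := hr i]; lra.
Qed.

Lemma F_curve_holo : curve_holo U F.
Proof. exact: curve_holo_frechet polydisc_nopen F_holomorphic. Qed.

Lemma delta_iter_mero i k : mero eps (delta_iter i k).
Proof.
elim: i k => [|i IH] k; first exact: exotic_mero.
rewrite /delta_iter iterS; exact: mero_delta (IH k).
Qed.

Lemma jet_mero j k : mero eps (jet eta%:C alpha j k).
Proof. by case: j => [|i]; [exact: mero_cst|exact: delta_iter_mero]. Qed.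

Lemma punctured_near t : 0 < nm t < eps ->
  exists2 r : R, 0 < r & forall x, nm (x - t) < r -> 0 < nm x < eps.
Proof.
move=> /andP[t0 te]; exists (Num.min (nm t) (eps - nm t)).
  by rewrite lt_min t0 subr_gt0.
move=> x; rewrite lt_min => /andP[x1 x2].
have := nm_sub t x; have := nm_tri x t 0; rewrite !subr0 [nm (t - x)]nmC.
by move=> ? ?; apply/andP; split; lra.
Qed.

(* alpha_0 is bounded, hence has no pole, and by the maximum principle its value
   at 0 stays inside the polydisc. *)
Lemma jet0_extension : exists gam : C -> 'rV[C]_n.+2,
  [/\ forall t, nm t < eps -> differentiable gam t,
      forall t, nm t < eps -> U (gam t) &
      forall t, 0 < nm t < eps -> z0 t = gam t].
Proof.
have e2 : 0 < eps / 2 by rewrite divr_gt0.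
have e21 : eps / 2 < eps by rewrite ltr_pdivrMr // ltr_pMr // ltr1n.
have half : 0 < nm ((eps / 2)%:C : C) < eps by rewrite nm_rc gtr0_norm // e2.
have coordE t i : (z0 t) 0 (lift ord0 i) = delta_iter i 0%N t by rewrite mxE.
have [M [h [hd0 hE]]] := exotic_mero 0%N alpha_exotic.
have hb t : 0 < nm t < eps -> nm (h t / t ^+ M) <= e ord0.
  move=> te; rewrite -hE //.
  have /punctured_discP/jet0_in/polydiscP[_ /(_ ord0)] := te.
  by rewrite coordE => /ltW.
have [g gd gE] := removable eps_gt0 hd0 hb.
pose J i := iter i (fun (f : C -> C) t => 'i * eta%:C * t * derive1 f t) g.
have Jd i t : nm t < eps -> cdiff (J i) t.
  elim: i t => [|i IH] t te; first exact: gd.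
  rewrite /J iterS -/(J i); apply: has_deriv_cdiff; apply: has_derivM.
    exact: has_derivM (has_deriv_cst ('i * eta%:C) t) (has_deriv_id t).
  apply: cdiff_hd; apply: (@cdiff_derive1 R (fun t => nm (t - 0) < eps)).
  - exact: nopen_ball.
  - by move=> x; rewrite subr0; exact: IH.
  - by rewrite subr0.
have JE i t : 0 < nm t < eps -> delta_iter i 0%N t = J i t.
  elim: i t => [|i IH] t te; first by rewrite /= hE // gE.
  rewrite /delta_iter iterS -/(delta_iter i) /J iterS -/(J i) /delta mul0r add0r.
  suff dE : derive1 (delta_iter i 0%N) t = derive1 (J i) t.
    exact: (congr1 (fun x => 'i * eta%:C * t * x) dE).
  have [r r0 near] := punctured_near te.
  apply: has_deriv_derive1; apply: (has_deriv_near r0 (f := J i)).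
    by move=> x /near xe; rewrite IH.
  by apply: cdiff_hd; apply: Jd; case/andP: te.
pose gam t : 'rV[C]_n.+2 := \row_(j < n.+2) (if nat_of_ord j is i.+1 then J i t else 0).
have gE' t : 0 < nm t < eps -> z0 t = gam t.
  move=> te; apply/rowP => j; rewrite !mxE.
  by case: (nat_of_ord j) => [//|i]; exact: JE.
exists gam; split=> [t te||//].
  apply: differentiable_row => j; case: (nat_of_ord j) => [|i]; last exact: Jd.
  exact: has_deriv_cdiff (has_deriv_cst 0 t).
move=> t te; have [t0|t0] := eqVneq t 0; last first.
  have te' : 0 < nm t < eps by rewrite te nm_gt0 t0.
  by rewrite -gE' //; apply: jet0_in; apply/punctured_discP.
have /punctured_discP/jet0_in/polydiscP[h0 hi] := half.
rewrite t0; apply/polydiscP; split.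
  by rewrite mxE /= nm0; apply: le_lt_trans (nm_ge0 _) h0.
move=> i; rewrite mxE /=.
(* For positive index the entry carries a factor t and vanishes at 0; only the entry of alpha_0
   needs the maximum principle. *)
case: i => -[|i] ilt /=; last first.
  by rewrite /J /= mulr0 mul0r nm0; apply: le_lt_trans (nm_ge0 _) (hi _).
have [t1 t1s gmax] : exists2 t1, nm t1 = eps / 2 & forall t, nm t = eps / 2 -> nm (g t) <= nm (g t1).
  by apply: circle_max => // x xs; apply: gd; rewrite xs.
have t1e : 0 < nm t1 < eps by rewrite t1s e2.
have g0 : nm (g 0) <= nm (g t1).
  apply: (@cauchy_value R g 0 eps (eps / 2)); first by rewrite e2.
    by move=> x; rewrite subr0; exact: gd.
  by move=> x; rewrite subr0; exact: gmax.
apply: le_lt_trans g0 _.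
have /punctured_discP/jet0_in/polydiscP[_ /(_ (Ordinal ilt))] := t1e.
by rewrite coordE /= hE // gE.
Qed.

Lemma fps_substE (G : 'rV[C]_n.+2 -> C) (u : 'I_n.+2 -> nat -> C) k :
  fps_subst G u k = subst k.+1 (taylor_coef G (\row_j u j 0%N))
    (fun j => \poly_(l < k.+1) (if l == 0%N then 0 else u j l)) k.
Proof. by []. Qed.

(** Along the extended curve [gam] the Taylor coefficients are holomorphic on the full disc, so
    poles come only from the polynomial in the higher alpha_l. *)
Lemma jet_subst_mero G k : curve_holo U G -> mero eps (jet_subst eta%:C alpha G k).
Proof.
move=> Gh; have [gam [gd gU gE]] := jet0_extension.
pose f (p : {ffun 'I_n.+2 -> 'I_k.+1}) t := taylor_coef G (z0 t) (fun j => p j) *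
  (\prod_(j < n.+2) (\poly_(l < k.+1) (if l == 0%N then 0 else jet eta%:C alpha j l t)) ^+ p j)`_k.
suff fm p : mero eps (f p) by exact: (mero_sum (index_enum _) fm).
rewrite /f; apply: meroM => //.
  apply: (@mero_ext R eps (fun t => taylor_coef G (gam t) (fun j => p j))).
    by move=> t te; rewrite gE.
  apply: cdiff_mero => t te; apply: has_deriv_cdiff; apply: has_derivM; last exact: has_deriv_cst.
  apply: cdiff_hd.
  have [_ mc] := curve_holo_mixed polydisc_nopen (fun j => p j) Gh.
  apply: (mc gam t (eps - nm t)) => //; first by rewrite subr_gt0.
    by move=> x xt; apply: gd; have := nm_tri x t 0; rewrite !subr0; lra.
  exact: gU.
apply: (@pmero_prod R eps) => j; apply: pmeroX => // l.
case: (boolP ((l < k.+1) && (l != 0))%N) => [/andP[lk l0]|].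
  by apply: mero_ext (jet_mero j l) => t _; rewrite coef_poly lk (negbTE l0).
rewrite negb_and negbK => h; apply: (@mero_ext R eps (fun=> 0)); last exact: mero_cst.
move=> t _; rewrite coef_poly; case/orP: h => [/negbTE -> //|->]; by case: ifP.
Qed.

Hypothesis alpha_solution : fzero eps%:C (jet_subst eta%:C alpha F).
Hypothesis dF_low : forall (i : 'I_n.+1) (k : nat), (k < N)%N ->
  forall t, punctured_disc eps%:C t -> jet_subst eta%:C alpha (partial_y i F) k t = 0.

Let B i := jet_subst eta%:C alpha (partial_y i F) N.
Let low k t (j : 'I_n.+2) : {poly C} := \poly_(l < k) (if l == 0%N then 0 else jet eta%:C alpha j l t).

Lemma partial_y_curve_holo i : curve_holo U (partial_y i F).
Proof. exact: curve_holo_partial polydisc_nopen _ _ F_curve_holo. Qed.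

Lemma B_mero i : mero eps (B i).
Proof. exact/jet_subst_mero/partial_y_curve_holo. Qed.

(* The coefficient of x ^ (N + k) in F(x, Phi) = 0. *)
Lemma jet_recursion t k : 0 < nm t < eps -> (N < k)%N -> (1 < k)%N ->
  \sum_(i < n.+1) B i t * delta_iter i k t =
  - subst (N + k).+1 (taylor_coef F (z0 t)) (fun j : 'I_n.+2 => low k t j) (N + k).
Proof.
move=> te Nk k1; have /punctured_discP tp := te.
pose q := (N + k)%N.
(* The jets are split at order [k]; as N < k, the order N + k is below 2 k and only the part linear
   in [hi] survives. *)
pose hi (j : 'I_n.+2) : {poly C} :=
  \poly_(l < q.+1) (if (l < k)%N then 0 else jet eta%:C alpha j l t).
have low0 (j : 'I_n.+2) : (low k t j)`_0 = 0 by rewrite coef_poly; case: ifP.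
have hi_low (j : 'I_n.+2) l : (l < k)%N -> (hi j)`_l = 0.
  by move=> lk; rewrite coef_poly lk; case: ifP.
have sum_poly (j : 'I_n.+2) : \poly_(l < q.+1) (if l == 0%N then 0 else jet eta%:C alpha j l t) =
    low k t j + hi j.
  apply/polyP => l; rewrite coefD !coef_poly.
  have [lk|kl] := ltnP l k.
    have -> : (l < q.+1)%N by rewrite /q; lia.
    by rewrite addr0.
  have -> : (l == 0%N) = false by apply/negbTE; lia.
  by rewrite add0r.
have := alpha_solution q tp; rewrite /jet_subst fps_substE.
have -> : (fun j : 'I_n.+2 => \poly_(l < q.+1) (if l == 0%N then 0 else jet eta%:C alpha j l t)) =
    (fun j => low k t j + hi j) by apply/funext => j; exact: sum_poly.
rewrite -/(z0 t).
have inc0 j : (low k t j + hi j)`_0 = 0 by rewrite coefD low0 hi_low ?addr0 //; lia.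
(* The exponent bound is raised by one, as [subst_linear] wants [q < L] under the bound [L.+1]. *)
rewrite -(@subst_trunc _ _ q.+2) //.
rewrite (@subst_linear _ _ q.+1 _ _ _ k) //; last by rewrite /q; lia.
rewrite subst_trunc // => /eqP; rewrite addrC addr_eq0 => /eqP <-.
have -> : ((q - k) = N)%N by rewrite /q addnK.
(* The coordinate x contributes nothing linear: its only term has order 1, below [k]. *)
rewrite [RHS]big_ord_recl [X in _ = X + _]big1 ?add0r; last first.
  move=> l _; rewrite coef_poly /jet /=.
  have lN := ltn_ord l.
  have -> : (q - l == 1)%N = false by apply/negbTE; rewrite /q; lia.
  by case: ifP => _; rewrite ?mulr0 //; case: ifP => _; rewrite mulr0.
apply: eq_bigr => i _.
have key l : (l <= N)%N ->
    subst q.+2 (fun p => (p (lift ord0 i)).+1%:R *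
      taylor_coef F (\row_j jet eta%:C alpha j 0%N t)
        (fun j => p j + (j == lift ord0 i))%N) (low k t) l =
    jet_subst eta%:C alpha (partial_y i F) l t.
  move=> lN; rewrite subst_trunc //; last by rewrite /q; lia.
  rewrite /jet_subst fps_substE.
  rewrite (@subst_eqm _ _ l.+1 _ _
    (fun j : 'I_n.+2 => \poly_(l0 < l.+1) (if l0 == 0%N then 0 else jet eta%:C alpha j l0 t))).
    apply: eq_bigr => p _; congr (_ * _); apply/esym.
    exact: (taylor_coef_partial polydisc_nopen (lift ord0 i) (fun j => p j) F_curve_holo (jet0_in tp)).
  move=> j; apply: coef_eqm => l0 l0l; rewrite !coef_poly l0l.
  by have -> : (l0 < k)%N by lia.
(* The derivatives of [F] have no terms below x^N, so only the pairing of order N with order k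
   remains. *)
rewrite big_ord_recr big1 ?add0r /=; last first.
  move=> l _; have lN := ltn_ord l; rewrite key; last exact: ltnW.
  by rewrite dF_low // mul0r.
rewrite add0r key // /B; congr (_ * _); rewrite /q addKn coef_poly ltnn.
by have -> : (k < (N + k).+1)%N by lia.
Qed.

Hypothesis Bn_neq0 : exists2 t, punctured_disc eps%:C t & B ord_max t != 0.

Lemma Bn_nonvanishing : exists2 d : R, 0 < d <= eps &
  forall t, 0 < nm t < d -> B ord_max t != 0.
Proof.
have [M [h [hd0 hE]]] := B_mero ord_max.
have [t0 /punctured_discP te Bt] := Bn_neq0; have /andP[t00 t0e] := te.
have ht : h t0 != 0.
  by apply/eqP => ht; move: Bt; rewrite hE // ht mul0r eqxx.
have [d d0 hn] := isolated_zero hd0 t0e ht.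
exists (Num.min d eps); first by rewrite lt_min d0 eps_gt0 ge_min lexx orbT.
move=> t; rewrite lt_min => /and3P[t1 t2 t3].
rewrite hE; last by rewrite t1.
by rewrite mulf_neq0 ?hn ?t1 // invr_neq0 // expf_neq0 // -nm_gt0.
Qed.

(** * Geometric bounds on a fixed closed annulus *)

Section FixedAnnulus.
Variables s1 s2 : R.
Hypothesis s12 : 0 < s1 <= s2.
Hypothesis s2e : s2 < eps.
Hypothesis Bn_annulus : forall t, s1 <= nm t <= s2 -> B ord_max t != 0.
Let A t := s1 <= nm t <= s2.

Lemma annulus_punctured t : A t -> 0 < nm t < eps.
Proof.
have /andP[s10 _] := s12; have s2eps := s2e.
by move=> /andP[t1 t2]; apply/andP; split; lra.
Qed.

(** A single [M] is both constant and ratio, so that the property is monotone in one parameter as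
    [annulus_bound] requires. *)
Lemma coef_bound : exists2 M : R, 0 <= M & forall t, A t -> forall p,
  nm (taylor_coef F (z0 t) p) <= M * M ^+ (\sum_j p j).
Proof.
have [gam [gd gU gE]] := jet0_extension.
suff [M hM] : exists M : R, forall t, A t -> 0 <= M /\
    forall p, nm (taylor_coef F (z0 t) p) <= M * M ^+ (\sum_j p j).
  have As1 : A s1%:C.
    by rewrite /A; have /andP[? ?] := s12; rewrite nm_rc gtr0_norm // lexx.
  by exists M => [|t /hM[_]//]; have [] := hM _ As1.
apply: (annulus_bound (V := fun t M => 0 <= M /\
    forall p, nm (taylor_coef F (z0 t) p) <= M * M ^+ (\sum_j p j)) s12).
  move=> t M M' MM [M0 h]; have M0' : 0 <= M' by exact: le_trans MM.
  split=> // p; apply: le_trans (h p) _; apply: ler_pM; rewrite ?exprn_ge0 //.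
  by rewrite lerXn2r.
move=> t /annulus_punctured te; have /andP[_ te1] := te.
have Ut := gU _ te1.
have [r1 r10 hr1] := polydisc_nopen Ut.
have [r2 [M2 [r20 hM2]]] := F_curve_holo.1 _ Ut.
pose r := Num.min r1 r2 / 2.
have r0 : 0 < r by rewrite divr_gt0 // lt_min r10.
have rr : r + r = Num.min r1 r2 by rewrite /r; field.
have gc : {for t, continuous gam} by exact/differentiable_continuous/gd.
have /nbhs_nm[d d0 has_deriv] := (@cvg_nm _ _ _ _ (nbhs_filter t) _ _).1 gc _ r0.
have [d' d'0 near] := punctured_near te.
have M20 : 0 <= M2 by apply: le_trans (nm_ge0 _) (hM2 (gam t) _); rewrite subrr nm0.
pose a : R := M2 * expR n.+2%:R; pose b : R := 4 * expR n.+2%:R / r.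
have a0 : 0 <= a by rewrite mulr_ge0 // expR_ge0.
have b0 : 0 <= b by rewrite divr_ge0 ?(ltW r0) // mulr_ge0 // expR_ge0.
exists (Num.min d d'), (a + b); split; first by rewrite lt_min d0.
move=> z; rewrite lt_min => /andP[/has_deriv zd /near ze]; split; first by rewrite addr_ge0.
move=> p; rewrite gE //.
have ball x : nm (x - gam z) < r -> nm (x - gam t) < Num.min r1 r2.
  by move=> xz; have := nm_tri x (gam z) (gam t); lra.
have bU x : nm (x - gam z) < r -> U x.
  by move=> /ball; rewrite lt_min => /andP[x1 _]; exact: hr1.
have bM x : nm (x - gam z) < r -> nm (F x) <= M2.
  by move=> /ball; rewrite lt_min => /andP[_ x2]; exact: hM2.
apply: le_trans (taylor_coef_bound polydisc_nopen p F_curve_holo r0 bU bM) _.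
rewrite -/a -/b; apply: ler_pM; rewrite ?exprn_ge0 // ?lerDl //.
by rewrite lerXn2r ?nnegrE ?addr_ge0 // lerDr.
Qed.

Lemma jets_bound k : exists2 M : R, 0 <= M &
  forall i t, (i <= n)%N -> A t -> nm (delta_iter i k t) <= M.
Proof.
have h (i : nat) : exists M : R, 0 <= M /\ forall t, A t -> nm (delta_iter i k t) <= M.
  have [|M M0 hM] := @annulus_bound_cdiff R (delta_iter i k) s1 s2 s12; last by exists M.
  by move=> t /annulus_punctured; exact: mero_cdiff (delta_iter_mero i k).
have [M hM] := choice h.
exists (\sum_(i < n.+1) M i); first by rewrite sumr_ge0 // => i _; have [] := hM i.
move=> i t ilen At; apply: le_trans ((hM i).2 _ At) _.
have ilt : (i < n.+1)%N by [].
rewrite (bigD1 (Ordinal ilt)) //= lerDl sumr_ge0 // => j _; exact: (hM j).1.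
Qed.

(** One majorant for the k-th coefficients of alpha and of all its delta-derivatives up to order
    n. *)
Let E k := sup [set x : R | exists i t, [/\ (i <= n)%N, A t & x = nm (delta_iter i k t)]].

Let E_ub k i t : (i <= n)%N -> A t -> nm (delta_iter i k t) <= E k.
Proof.
move=> ilen At; have [M M0 hM] := jets_bound k.
apply: ub_le_sup; last by exists i, t.
by exists M => _ [j [u [jn Au ->]]]; exact: hM.
Qed.

Let E_le k (x : R) : (forall i t, (i <= n)%N -> A t -> nm (delta_iter i k t) <= x) -> E k <= x.
Proof.
move=> h; apply: ge_sup; last by move=> _ [i [t [ilen At ->]]]; exact: h.
have As1 : A s1%:C.
  by rewrite /A; have /andP[? ?] := s12; rewrite nm_rc gtr0_norm // lexx.
by exists (nm (delta_iter 0 k s1%:C)), 0%N, s1%:C.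
Qed.

Let E_ge0 k : 0 <= E k.
Proof.
have As1 : A s1%:C.
  by rewrite /A; have /andP[? ?] := s12; rewrite nm_rc gtr0_norm // lexx.
exact: le_trans (nm_ge0 _) (@E_ub k 0%N _ (leq0n n) As1).
Qed.

(** [delta_iter i.+1 k] is k + i eta t d/dt applied to [delta_iter i k], so [circle_estimate] gains
    a factor 1/k on every order below n. *)
Let E_small k i t : (0 < k)%N -> (i < n)%N -> A t -> nm (delta_iter i k t) <= E k / k%:R.
Proof.
move=> k0 iln At; have /andP[t0 te] := annulus_punctured At.
apply: (@circle_estimate R (delta_iter i k) (nm t) k%:R eta (E k)) => //.
- by rewrite ltr0n.
- move=> u ut; apply: mero_cdiff (delta_iter_mero i k) _.
  by rewrite ut t0.
- move=> u ut; have Au : A u by rewrite /A ut.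
  rewrite rcn; exact: (@E_ub k i.+1 u iln Au).
Qed.

(** The extra 1 at order 1 accounts for the series x, the entry of the jet with index 0. *)
Let maj l : R := E l + (l == 1%N)%:R.

Let maj_ge0 l : 0 <= maj l.
Proof. by rewrite addr_ge0. Qed.

Let low_dominated k t (j : 'I_n.+2) : A t ->
  dominated (low k t j) (positive_part_poly maj k).
Proof.
move=> At l; rewrite !coef_poly; case: (l < k)%N; last by rewrite nm0.
case: eqP => _; first by rewrite nm0.
rewrite /maj; case: j => -[|i] ji /=.
  by rewrite nm_nat lerDr.
by rewrite (le_trans (@E_ub l i t _ At)) // lerDl.
Qed.

Let subst_bound (M : R) k q t : 0 <= M ->
  (forall t, A t -> forall p, nm (taylor_coef F (z0 t) p) <= M * M ^+ (\sum_j p j)) -> A t ->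
  nm (subst q.+1 (taylor_coef F (z0 t)) (fun j : 'I_n.+2 => low k t j) q) <=
  M * \sum_(d < q.+1) ((2 ^ n.+2)%:R * M) ^+ d * ((positive_part_poly maj k) ^+ d)`_q.
Proof.
move=> M0 hM At; pose PP := positive_part_poly maj k.
pose g d : R := M ^+ d * (PP ^+ d)`_q.
have g0 d : 0 <= g d by rewrite mulr_ge0 ?exprn_ge0 // coef_poly_exp_ge0.
have gq d : (q.+1 <= d)%N -> g d = 0.
  move=> qd; have [|r PPr] := @low_coef0 R 1 PP.
    by move=> [|//] _; rewrite coef_poly; case: ifP.
  by rewrite /g PPr exprMn expr1 coefMXn qd mulr0.
apply: le_trans (nm_sum _ _ _) _.
apply: (@le_trans _ _ (M * \sum_(p : {ffun 'I_n.+2 -> 'I_q.+1}) g (\sum_j p j)%N)).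
  rewrite mulr_sumr; apply: ler_sum => p _; rewrite nmM /g mulrA.
  apply: ler_pM; rewrite ?nm_ge0 //; first exact: hM.
  exact: (dominated_monom (fun j => p j) (fun j => low_dominated k j At)).
apply: ler_wpM2l => //; apply: le_trans (sum_by_degree n.+2 g0 gq) _.
by apply: ler_sum => d _; rewrite /g mulrA -exprMn.
Qed.

Lemma geometric_bound : exists r M : R, 0 < r /\
  forall k t, A t -> nm (alpha k t) * r ^+ k <= M.
Proof.
have [Mc Mc0 hMc] := coef_bound.
have hB (i : 'I_n.+1) : exists M : R, 0 <= M /\ forall t, A t -> nm (B i t) <= M.
  have [|M M0 hM] := @annulus_bound_cdiff R (B i) s1 s2 s12; last by exists M.
  by move=> t /annulus_punctured; exact: mero_cdiff (B_mero i).
have [b hb] := choice hB.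
pose b1 := \sum_i b i; have b10 : 0 <= b1 by rewrite sumr_ge0 // => i _; exact: (hb i).1.
have [|b0 b00 hb0] := @annulus_bound_cdiff R (fun t => (B ord_max t)^-1) s1 s2 s12.
  move=> t At; apply: has_deriv_cdiff; apply: has_derivV; last exact: Bn_annulus.
  exact: cdiff_hd (mero_cdiff (B_mero ord_max) (annulus_punctured At)).
pose c := 1 + b0 * b1; have c0 : 1 <= c by rewrite lerDl mulr_ge0.
have c2 : 0 <= 2 * c by rewrite mulr_ge0 //; lra.
(* Beyond [K] one has [2 * c <= k], so the lower-order derivatives cost at most half of [E k];
   moreover [N < K] as [majorant] demands. *)
pose K := (N + Num.bound (2 * c)).+1.
have step k : (K < k)%N -> maj k <= 2 * b0 * Mc *
    \sum_(d < (N + k).+1) ((2 ^ n.+2)%:R * Mc) ^+ d * ((positive_part_poly maj k) ^+ d)`_(N + k).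
  move=> Kk; set X := \sum_(d < _) _.
  have X0 : 0 <= X.
    by rewrite sumr_ge0 // => d _; rewrite mulr_ge0 ?exprn_ge0 ?mulr_ge0 // coef_poly_exp_ge0.
  have Nk : (N < k)%N by apply: leq_trans Kk; rewrite /K ltnS ltnW // ltnS leq_addr.
  have k1 : (1 < k)%N by apply: leq_trans Kk; rewrite /K ltnS.
  have k0 : 0 < k%:R :> R by rewrite ltr0n ltnW.
  have kc : 2 * c <= k%:R.
    apply: ltW; apply: lt_le_trans (archi_boundP c2) _; rewrite ler_nat.
    by apply: leq_trans (ltnW Kk); rewrite /K leqW // leq_addl.
  have -> : maj k = E k by rewrite /maj gtn_eqF // addr0.
  set e' := E k; have e0 : 0 <= e' by exact: E_ge0.
  have ek0 : 0 <= e' / k%:R by rewrite divr_ge0 // ltW.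
  (* The first summand covers the orders below n; the second comes from solving the recursion for
     the order n derivative after division by B_n. *)
  suff H : e' <= e' / k%:R + b0 * (Mc * X + b1 * (e' / k%:R)).
    have : e' / k%:R * c <= e' / 2.
      rewrite mulrAC ler_pdivrMr // -mulrA ler_wpM2l //.
      by rewrite mulrC ler_pdivlMr //; lra.
    by move: H; rewrite /c; set y := e' / k%:R; lra.
  apply: E_le => i t; rewrite leq_eqVlt => /orP[/eqP ->|iln] At; last first.
    apply: le_trans (E_small (ltnW k1) iln At) _.
    by rewrite lerDl mulr_ge0 // addr_ge0 ?mulr_ge0.
  have te := annulus_punctured At.
  have := jet_recursion te Nk k1; rewrite big_ord_recr /=.
  set T := \sum_(i < n) _; set Y := subst _ _ _ _ => rec.
  have Bt : B ord_max t != 0 := Bn_annulus At.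
  have -> : delta_iter n k t = (B ord_max t)^-1 * (- Y - T).
    by rewrite -rec [T + _]addrC addrK mulKf.
  rewrite nmM.
  have Yb : nm Y <= Mc * X by exact: subst_bound.
  have Tb : nm T <= b1 * (e' / k%:R).
    apply: le_trans (nm_sum _ _ _) _; rewrite /b1 big_ord_recr /= mulrDl mulr_suml.
    apply: (@le_trans _ _ (\sum_(i < n) b (widen_ord (leqnSn n) i) * (e' / k%:R))).
      apply: ler_sum => j _; rewrite nmM; apply: ler_pM; rewrite ?nm_ge0 //.
        exact: (hb _).2.
      exact: E_small (ltnW k1) (ltn_ord j) At.
    by rewrite lerDl mulr_ge0 // (hb _).1.
  have YT : nm (- Y - T) <= Mc * X + b1 * (e' / k%:R).
    by apply: le_trans (nmB _ _) _; rewrite nmN lerD.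
  apply: le_trans (ler_pM (nm_ge0 _) (nm_ge0 _) (hb0 _ At) YT) _.
  by rewrite lerDr.
have NK : (N < K)%N by rewrite /K ltnS leq_addr.
have [] := majorant maj_ge0 _ _ NK step.
- by rewrite !mulr_ge0.
- by rewrite mulr_ge0.
move=> r [M [r0 hM]]; exists r, M; split=> // k t At.
apply: le_trans (hM k); rewrite ler_wpM2r ?exprn_ge0 ?(ltW r0) //.
by apply: le_trans (@E_ub k 0%N t (leq0n n) At) _; rewrite lerDl.
Qed.
End FixedAnnulus.
End FormalSolution.

(** * Uniform convergence from a geometric bound *)

Section UniformConvergence.
Variable R : realType.
Local Notation C := (Cplx R).

Lemma uniform_geometric (S : set C) (a : nat -> C -> C) (M : R) :
  (forall k x, S x -> nm (a k x) <= M * 2^-1 ^+ k) ->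
  exists f : C -> C, {uniform S, (fun (K : nat) x => \sum_(k < K) a k x) @ \oo --> f}.
Proof.
move=> ha.
pose g K x := \sum_(k < K) a k x.
have tail x K K' : S x -> (K <= K')%N -> nm (g K' x - g K x) <= 2 * M * 2^-1 ^+ K.
  move=> Sx KK.
  have M0 : 0 <= M.
    by have := ha 0%N x Sx; rewrite expr0 mulr1; exact/le_trans/nm_ge0.
  (* Keeping the subtracted term makes the bound telescope, so that the induction goes through. *)
  suff : nm (g K' x - g K x) <= 2 * M * (2^-1 ^+ K - 2^-1 ^+ K').
    move=> h; apply: le_trans h _; rewrite ler_wpM2l ?mulr_ge0 // gerBl exprn_ge0 // invr_ge0 //.
  rewrite -(subnKC KK); elim: (K' - K)%N => [|j IH].
    by rewrite addn0 !subrr nm0 mulr0.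
  rewrite addnS {1}/g big_ord_recr -/(g (K + j)%N x) /= addrAC.
  apply: le_trans (nmD _ _) _; apply: le_trans (lerD IH (ha _ _ Sx)) _.
  rewrite [2^-1 ^+ (K + j).+1]exprS; move: (2^-1 ^+ (K + j)) => u.
  by rewrite le_eqVlt; apply/orP; left; apply/eqP; field.
have small (e : R) : 0 < e -> \forall K \near \oo, 2 * M * 2^-1 ^+ K < e.
  move=> e0.
  have : 2 * M * 2^-1 ^+ K @[K --> \oo] --> 2 * M * 0.
    by apply: cvgMr; apply: cvg_expr; rewrite ger0_norm ?invr_ge0 // invf_lt1 // ltr1n.
  rewrite mulr0 => /cvgrPdist_lt/(_ e e0); apply: filterS => K.
  by rewrite sub0r normrN; exact/le_lt_trans/ler_norm.
have /choice[f fP] : forall x, exists l : C, S x -> g K x @[K --> \oo] --> l.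
  move=> x; have [Sx|nS] := pselect (S x); last by exists 0.
  have [|l hl] := @nm_complete R _ \oo _ (fun K => g K x); last by exists l.
  move=> e e0; have [K _ hK] := small _ e0; exists (g K x).
  exists K => // K' /= KK'; apply: le_lt_trans (tail _ _ _ Sx KK') _.
  exact: (hK K (leqnn K)).
exists f.
have ftail x K : S x -> nm (g K x - f x) <= 2 * M * 2^-1 ^+ K.
  move=> Sx; apply/ler_addgt0Pr => e e0.
  have /cvg_nm/(_ e e0)[K1 _ hK1] := fP x Sx.
  have h1 := hK1 (maxn K K1) (leq_maxr _ _).
  have h2 := tail x K (maxn K K1) Sx (leq_maxl _ _).
  rewrite nmC in h2; have := nm_tri (g K x) (g (maxn K K1) x) (f x).
  by move: h1 h2; rewrite /=; lra.
move=> P /uniform_nbhs[D [entD DP]].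
move: entD; rewrite -entourage_ballE => -[_ /gt0_rc[e e0 ->] eD].
have [K0 _ hK] := small _ e0.
exists K0 => // K /= KK; apply: DP => y Sy; apply: eD => /=.
rewrite -ball_normE /ball_ /= nmE ltrc nmC.
by apply: le_lt_trans (ftail y K Sy) (hK K KK).
Qed.
End UniformConvergence.

(** * The branch of log x and the annulus containing x^(i eta) *)

Section Spiral.
Variable R : realType.
Local Notation C := (Cplx R).
Implicit Types x : C.

Lemma sector_upper (q : R) x : sector 0 pi q x -> (~` @nneg_reals R) x /\ nm x <= q.
Proof.
move=> [s [th [/andP[s0 sq] th01 ->]]]; split.
  move=> [z _ zE]; have := sin_gt0_pi th01.
  have : complex.Im (s%:C * cexp ('i * th%:C)) = s * sin th.
    by rewrite cexp_irc /= mul0r addr0.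
  rewrite -zE /= => /esym/eqP; rewrite mulf_eq0 gt_eqF //= => /eqP ->.
  by rewrite ltxx.
by rewrite nmM nm_rc gtr0_norm // nm_cexp irc /= expR0 mulr1 ltW.
Qed.

(* Adding a multiple of 2 pi i to log x multiplies |x ^ (i eta)|, which depends
   on arg x only, by an arbitrarily small factor. *)
Lemma ipow_annulus (eta d : R) : eta != 0 -> 0 < d ->
  exists c s1 s2 : R, [/\ cexp ('i * c%:C) = 1, 0 < s1 <= s2, s2 < d &
    forall x, s1 <= nm (ipow (fun x => (ln (nm x))%:C + 'i * (carg x + c)%:C) eta x) <= s2].
Proof.
move=> eta_neq0 d0.
pose a := `|eta| * (pi *+ 2).
have pi2 : 0 < pi *+ 2 :> R by rewrite mulrn_wgt0 // pi_gt0.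
have a0 : 0 < a by rewrite mulr_gt0 // normr_gt0.
(* Enough turns for exp(- M a) to be at most [d / 2], where [a] is the variation of log |x^(i eta)|
   over one full turn. *)
pose M := Num.bound (`|ln (d / 2)| / a).
have Ma : - (M%:R * a) <= ln (d / 2).
  have := archi_boundP (divr_ge0 (normr_ge0 (ln (d / 2))) (ltW a0)).
  rewrite ltr_pdivrMr // -/M => h.
  by have := ler_norm (- ln (d / 2)); rewrite normrN; lra.
pose s1 := expR (- (M%:R * a) - a); pose s2 := expR (- (M%:R * a)).
have s12 : 0 < s1 <= s2 by rewrite expR_gt0 ler_expR gerBl ltW.
have s2d : s2 < d.
  have : s2 <= d / 2 by rewrite -[leRHS](lnK (x := d / 2)) ?posrE ?divr_gt0 // ler_expR.
  by lra.
(* The sign of [c] follows that of [eta], and one more turn is taken for negative [eta], so that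
   [eta * (carg x + c)] lies between [M a] and [(M + 1) a] in both cases. *)
pose c : R := if 0 < eta then (pi *+ 2) * M%:R else - ((pi *+ 2) * M.+1%:R).
have cexp_turn k : cexp ('i * ((pi *+ 2) * k%:R)%:C) = 1 :> C.
  by rewrite rcM rcn mulrA mulr_natr cexpMn cexp_2pi expr1n.
have cexp_c : cexp ('i * c%:C) = 1.
  rewrite /c; case: ifP => _; first exact: cexp_turn.
  by rewrite rcN mulrN cexpN cexp_turn invr1.
exists c, s1, s2; split=> // x.
set L := fun x => _.
have -> : nm (ipow L eta x) = expR (- (eta * (carg x + c))).
  rewrite /ipow nm_cexp; congr expR.
  have -> : 'i * eta%:C * L x =
      'i * (eta * ln (nm x))%:C + ('i * 'i) * (eta * (carg x + c))%:C.
    by rewrite /L !rcM; ring.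
  by rewrite -expr2 sqrCi mulN1r -rcN irc /= add0r.
have /andP[ca0 ca1] := carg_itv x.
rewrite !ler_expR /a /c -natr1.
move: ca0 ca1; move: (carg x) (pi *+ 2) (M%:R : R) => y p2 m y0 y1.
case: (ltrgt0P eta) => [e0|e0|e0]; last by move: eta_neq0; rewrite e0 eqxx.
  by apply/andP; split; nra.
by apply/andP; split; nra.
Qed.
End Spiral.

Theorem theorem1 (R : realType) (n : nat) (rho : R) (e : 'I_n.+1 -> R)
    (F : 'rV[Cplx R]_n.+2 -> Cplx R) (eta eps : R)
    (alpha : nat -> Cplx R -> Cplx R) (N : nat)
    (rho_gt0 : 0 < rho) (e_gt0 : forall i, 0 < e i)
    (F_holomorphic : forall z,
       polydisc (cplx_of_real rho) (fun i => cplx_of_real (e i)) z ->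
       differentiable F z)
    (eta_neq0 : eta != 0) (eps_gt0 : 0 < eps)
    (alpha_exotic : exotic_series (cplx_of_real eps) alpha)
    (jet0_in : forall t, punctured_disc (cplx_of_real eps) t ->
       polydisc (cplx_of_real rho) (fun i => cplx_of_real (e i))
         (jet0 n (cplx_of_real eta) alpha t))
    (alpha_solution :
       fzero (cplx_of_real eps) (jet_subst (cplx_of_real eta) alpha F))
    (dFn_neq0 :
       ~ fzero (cplx_of_real eps)
           (jet_subst (cplx_of_real eta) alpha (partial_y ord_max F)))
    (dF_low : forall (i : 'I_n.+1) (k : nat), (k < N)%N ->
       forall t, punctured_disc (cplx_of_real eps) t ->
       jet_subst (cplx_of_real eta) alpha (partial_y i F) k t = 0)
    (Bn_neq0 : exists2 t, punctured_disc (cplx_of_real eps) t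
       & jet_subst (cplx_of_real eta) alpha (partial_y ord_max F) N t != 0)
    (ord_ge : forall i : 'I_n.+1,
       (order_at0 (jet_subst (cplx_of_real eta) alpha (partial_y ord_max F) N)
        <= order_at0 (jet_subst (cplx_of_real eta) alpha (partial_y i F) N))%E) :
  exists (L : Cplx R -> Cplx R) (theta1 theta2 rad : R) (f : Cplx R -> Cplx R),
    [/\ log_branch (~` @nneg_reals R) L,
        theta1 < theta2 /\ 0 < rad,
        sector theta1 theta2 rad `<=` ~` @nneg_reals R,
        forall x, sector theta1 theta2 rad x ->
          punctured_disc (cplx_of_real eps) (ipow L eta x)
      & {uniform sector theta1 theta2 rad,
          (fun (K : nat) (x : Cplx R) =>
             \sum_(k < K) alpha k (ipow L eta x) * x ^+ k) @ \oo --> f}].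
Proof.
clear dFn_neq0 ord_ge.
have Bh := Bn_nonvanishing F_holomorphic eps_gt0 alpha_exotic jet0_in Bn_neq0.
have [d /andP[d0 de] Bn] := Bh.
have [c [s1 [s2 [cexp_c s12 s2d]]]] := ipow_annulus eta_neq0 d0.
set L := fun x => _ => nm_ipow.
have /andP[s10 _] := s12; have s2e : s2 < eps := lt_le_trans s2d de.
have BnA t : s1 <= nm t <= s2 ->
    jet_subst (cplx_of_real eta) alpha (partial_y ord_max F) N t != 0.
  move=> /andP[t1 t2]; apply: Bn.
  by rewrite (lt_le_trans s10 t1) (le_lt_trans t2 s2d).
have [r [B [r0 hB]]] := geometric_bound F_holomorphic eps_gt0 alpha_exotic jet0_in
  alpha_solution dF_low s12 s2e BnA.
clear F_holomorphic alpha_exotic jet0_in alpha_solution dF_low Bn_neq0 Bh Bn BnA.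
(* Half the radius [r] of the geometric bound gives ratio 1/2 on the upper half disc, which avoids
   the cut. *)
have ha k x : sector 0 pi (r / 2) x -> nm (alpha k (ipow L eta x) * x ^+ k) <= B * 2^-1 ^+ k.
  move=> /sector_upper[_ xr]; rewrite nmM nmX.
  have r2 : 0 <= r / 2 by rewrite divr_ge0 // ltW.
  have xk : nm x ^+ k <= r ^+ k * 2^-1 ^+ k.
    by rewrite -exprMn lerXn2r // nnegrE nm_ge0.
  apply: le_trans (ler_wpM2l (nm_ge0 _) xk) _; rewrite mulrA.
  by rewrite ler_wpM2r ?hB ?nm_ipow // exprn_ge0 // invr_ge0.
have [f hf] := uniform_geometric ha.
exists L, 0, pi, (r / 2), f; split.
- exact: log_branch_shift cexp_c.
- by split; [exact: pi_gt0|rewrite divr_gt0].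
- by move=> x /sector_upper[].
- move=> x _; rewrite /punctured_disc /= nmE -rc0 !ltrc.
  have /andP[h1 h2] := nm_ipow x.
  by rewrite (lt_le_trans s10 h1) (le_lt_trans h2 s2e).
- exact: hf.
Qed.
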